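(* For each integer $k\ge 0$, \[ N_{3,k}(\Sigma)=\frac{8\pi}{(3+k)!}\Sigma^{3+k}+\sum_{m=0}^{k-1}\frac{C_{k-1-m}}{m!}\Sigma^m+o_k(\Sigma) \] as an element of $\dot{\mathscr{S}}'(\mathbb{R}^{\ge 0})$ (i.e.\ as an identity in $\mathscr{S}'(\mathbb{R})$ after multiplying every term on the right by the Heaviside function $\Theta(\Sigma)=1_{\Sigma\ge 0}$), where $\{C_j\}_{j\ge 0}\subset\mathbb{R}$ is given by the absolutely convergent series \[ C_j=\begin{cases}0 & j \text{ odd},\\ +(2j+4)(2\pi)^{-j-3}\sum_{n=1}^\infty r_3(n)n^{-2-j/2} & j\equiv 0 \pmod 4,\\ -(2j+4)(2\pi)^{-j-3}\sum_{n=1}^\infty r_3(n)n^{-2-j/2} & j\equiv 2\pmod 4,\end{cases} \] and $o_k\in\dot{\mathscr{S}}'(\mathbb{R}^{\ge0})$ is \[ o_k(\Sigma)=-\frac1\pi\sum_{n=1}^\infty\frac{r_3(n)}{n}\frac{1}{(2\pi\sqrt n)^k}\Big[\Re[i^k]\,\Sigma\cos(2\pi\sqrt n\Sigma)-\Im[i^k]\,\Sigma\sin(2\pi\sqrt n\Sigma)+\frac{k+1}{2\pi\sqrt n}\Im[i^k]\cos(2\pi\sqrt n\Sigma)-\frac{k+1}{2\pi\sqrt n}\Re[i^k]\sin(2\pi\sqrt n\Sigma)\Big] \] (each term multiplied by $\Theta(\Sigma)$). The series defining $o_k$ is unconditionally summable in $\dot{\mathscr{S}}'(\mathbb{R}^{\ge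 0})$. If $k\ge 2$, the identity holds in the ordinary pointwise sense for each $\Sigma\ge 0$, with the series for $o_k$ absolutely convergent; moreover for $k\ge2$, $o_k$ is (the distribution of) a continuous function on $[0,\infty)$ vanishing at $0$, and on every compact $K\subset[0,\infty)$ the series converges uniformly to it.
   Context: For $\Sigma\ge0$, $N_3(\Sigma)=\#\{\bm v\in\mathbb{Z}^3:|\bm v|\le\Sigma\}$ and $N_3(\Sigma)=0$ for $\Sigma<0$. $r_3(n)=\#\{\bm v\in\mathbb{Z}^3:|\bm v|^2=n\}$. Set $N_{3,0}=N_3$ and $N_{3,k}(\Sigma)=\int_0^\Sigma N_{3,k-1}(\sigma)\,d\sigma$ for $k\ge1$. $\dot{\mathscr{S}}'(\mathbb{R}^{\ge0})$ denotes the subspace of tempered distributions on $\mathbb{R}$ supported in $[0,\infty)$, with the subspace topology from $\mathscr{S}'(\mathbb{R})$; polynomially bounded locally integrable functions are identified with tempered distributions by integration.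
   Formalization: The sign of the Im[i^k] Σ sin(2π√n Σ) term in o_k is corrected from − to + (the printed identity fails for odd k), and ''o_k vanishes at 0'' is claimed only for even k ≥ 2, since for odd k the identity at Σ=0 gives o_k(0) = −C_{k−1} ≠ 0. *)

(* Defs.v *)
From HB Require Import structures.
From mathcomp Require Import all_boot all_order all_algebra finmap.
From mathcomp Require Import all_classical all_reals all_analysis.
From mathcomp Require Import complex.
From mathcomp Require summability.

Set Implicit Arguments.
Unset Strict Implicit.
Unset Printing Implicit Defensive.

Import Order.TTheory GRing.Theory Num.Theory.
Import numFieldNormedType.Exports Normc.

Local Open Scope ring_scope.
Local Open Scope classical_set_scope.

Section SchwartzSpace.
Variable R : realType.
Implicit Types (f : R -> R) (phi : R -> R[i]^o).

Definition smooth f := forall (n : nat) (x : R), derivable (derive1n n f) x 1.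

(* The derivative along R of a complex-valued function, taken on the real and
   imaginary parts. *)
Definition cderivn (n : nat) phi (x : R) : R[i] :=
  Complex (derive1n n (@complex.Re R \o phi) x) (derive1n n (@complex.Im R \o phi) x).

Definition is_schwartz phi : Prop :=
  [/\ smooth (@complex.Re R \o phi), smooth (@complex.Im R \o phi) &
      forall a b : nat, exists M : R,
        forall x : R, `|x| ^+ a * normc (cderivn b phi x) <= M].

Definition schwartz_pred : {pred R -> R[i]^o} := [pred phi | `[< is_schwartz phi >]].

Lemma is_deriveZD (c d : R) f g (x : R) : derivable f x 1 -> derivable g x 1 ->
  is_derive x 1 (fun y => c * f y + d * g y) (c * f^`()%classic x + d * g^`()%classic x).
Proof.
move=> df dg; rewrite !derive1E.
have hf : is_derive x 1 f ('D_1 f x) by apply: DeriveDef.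
have hg : is_derive x 1 g ('D_1 g x) by apply: DeriveDef.
exact: (is_deriveD (is_deriveZ c hf) (is_deriveZ d hg)).
Qed.

Lemma derive1nZD (c d : R) f g : smooth f -> smooth g -> forall n,
  derive1n n (fun x => c * f x + d * g x) =
  (fun x => c * derive1n n f x + d * derive1n n g x).
Proof.
move=> sf sg; elim=> [//|n IH]; rewrite !derive1nS IH; apply/funext => x.
have := is_deriveZD c d (sf n x) (sg n x).
by rewrite [in LHS]derive1E => /@derive_val.
Qed.

Lemma smoothZD (c d : R) f g : smooth f -> smooth g ->
  smooth (fun x => c * f x + d * g x).
Proof.
move=> sf sg n x; rewrite derive1nZD //.
by have [] := is_deriveZD c d (sf n x) (sg n x).
Qed.

Arguments smoothZD c d {f g}.

Lemma smooth0 : smooth (fun=> 0).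
Proof.
have E n : derive1n n (fun=> 0 : R) = (fun=> 0 : R).
  by elim: n => [//|n IH]; rewrite derive1nS IH; apply/funext => x;
     rewrite derive1_cst.
by move=> n x; rewrite E; exact: derivable_cst.
Qed.

Lemma schwartz_submod_closed : submod_closed schwartz_pred.
Proof.
split.
- apply/asboolP; split; try exact: smooth0.
  move=> a b; exists 0 => x.
  have E n : derive1n n (fun=> 0 : R) = (fun=> 0 : R).
    by elim: n => [//|n IH]; rewrite derive1nS IH; apply/funext => y;
       rewrite derive1_cst.
  rewrite /cderivn (_ : @complex.Re R \o 0 = fun=> 0 : R) //.
  rewrite (_ : @complex.Im R \o 0 = fun=> 0 : R) // E.
  by rewrite (_ : Complex 0 0 = 0 :> R[i]) // normc0 mulr0.
move=> [c d] phi psi /asboolP[s1 s2 bphi] /asboolP[t1 t2 bpsi]; apply/asboolP.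
set chi := _ + _.
have Er : @complex.Re R \o chi = fun x => 1 * (c * (@complex.Re R \o phi) x +
    (- d) * (@complex.Im R \o phi) x) + 1 * (@complex.Re R \o psi) x.
  apply/funext => x; rewrite !mul1r /= /chi /=.
  rewrite -[(_ + _) x]/(Complex c d * phi x + psi x).
  by case: (phi x) (psi x) => [p q] [r s] /=; rewrite mulNr.
have Ei : @complex.Im R \o chi = fun x => 1 * (c * (@complex.Im R \o phi) x +
    d * (@complex.Re R \o phi) x) + 1 * (@complex.Im R \o psi) x.
  apply/funext => x; rewrite !mul1r /= /chi /=.
  rewrite -[(_ + _) x]/(Complex c d * phi x + psi x).
  by case: (phi x) (psi x) => [p q] [r s] /=; rewrite [in RHS](mulrC d) mulrC;
     rewrite ?(mulrC q) ?(mulrC p).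
split.
- by rewrite Er; exact: (smoothZD 1 1 (smoothZD c (- d) s1 s2) t1).
- by rewrite Ei; exact: (smoothZD 1 1 (smoothZD c d s2 s1) t2).
move=> a b; have [M1 H1] := bphi a b; have [M2 H2] := bpsi a b.
exists (normc (Complex c d) * M1 + M2) => x.
have -> : cderivn b chi x = Complex c d * cderivn b phi x + cderivn b psi x.
  rewrite /cderivn Er Ei.
  rewrite (derive1nZD 1 1 (smoothZD c (- d) s1 s2) t1) (derive1nZD c (- d) s1 s2).
  rewrite (derive1nZD 1 1 (smoothZD c d s2 s1) t2) (derive1nZD c d s2 s1).
  by rewrite !mul1r; congr Complex => /=; rewrite mulNr.
have := @le_normcD R (Complex c d * cderivn b phi x) (cderivn b psi x).
move=> /(ler_wpM2l (exprn_ge0 a (normr_ge0 x))) /le_trans; apply.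
rewrite mulrDr normcM lerD ?H2 // mulrCA ler_wpM2l ?H1 //.
by rewrite /normc sqrtr_ge0.
Qed.

HB.instance Definition _ :=
  GRing.isSubmodClosed.Build _ _ schwartz_pred schwartz_submod_closed.

Record schwartz := Schwartz {
  schwartz_fun :> R -> R[i]^o;
  _ : schwartz_fun \in schwartz_pred }.

HB.instance Definition _ := [isSub for schwartz_fun].
HB.instance Definition _ := [Choice of schwartz by <:].
HB.instance Definition _ := [SubChoice_isSubLmodule of schwartz by <:].

End SchwartzSpace.

Section TemperedDistributions.
Variable R : realType.
Notation S := (schwartz R).
Notation mu := (@lebesgue_measure R).
Implicit Types (f : R -> R) (T : S -> R[i]^o).

Definition schwartz_norm (a b : nat) (phi : S) : R :=
  sup [set `|x| ^+ a * normc (cderivn b phi x) | x in [set: R]].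

(* Continuity for the Frechet topology given by the seminorms above. *)
Definition schwartz_continuous T : Prop :=
  exists (n : nat) (c : R), forall phi : S,
    normc (T phi) <= c * \sum_(a < n) \sum_(b < n) schwartz_norm a b phi.

Definition tempered T : Prop := linear T /\ schwartz_continuous T.

Definition supported_in_nonneg T : Prop := forall phi : S,
  let supp := closure [set x : R | phi x != 0] in
  compact supp -> supp `<=` [set x | x < 0] -> T phi = 0.

Definition dotS' T : Prop := tempered T /\ supported_in_nonneg T.

Definition schwartz_bounded (B : set S) : Prop := forall a b : nat,
  exists M : R, forall phi, B phi -> schwartz_norm a b phi <= M.

(* Convergence of the net of finite partial sums in the strong dual topology,
   i.e. uniformly on the bounded subsets of the Schwartz space. *)
Definition unconditional_sum (u : nat -> S -> R[i]^o) T : Prop :=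
  {family schwartz_bounded,
    summability.partial_sum u @ summability.totally --> T}.

Definition tempered_fun f : Prop :=
  locally_integrable [set: R] f /\
  exists (m : nat) (c : R), forall x, `|f x| <= c * (1 + `|x|) ^+ m.

Definition distr f : S -> R[i]^o := fun phi =>
  Complex (\int[mu]_x (f x * complex.Re (phi x)))
          (\int[mu]_x (f x * complex.Im (phi x))).

(* f is identified with an element of dot S'. *)
Definition dotS'_fun f : Prop := tempered_fun f /\ dotS' (distr f).

Definition heaviside : R -> R := \1_[set x | 0 <= x].

End TemperedDistributions.

Arguments heaviside R : clear implicits.

Section LatticePoints.
Variable R : realType.
Notation mu := (@lebesgue_measure R).

Definition sqnorm3 (v : 'rV[int]_3) : int := \sum_(i < 3) v 0 i ^+ 2.

(* The set of lattice points is empty when s < 0. *)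
Definition N3 (s : R) : R :=
  #|` fset_set [set v : 'rV[int]_3 | Num.sqrt (sqnorm3 v)%:~R <= s] |%:R.

Definition r3 (n : nat) : nat := #|` fset_set [set v | sqnorm3 v = n%:Z] |.

Fixpoint N3k (k : nat) : R -> R :=
  if k is k'.+1 then fun s => \int[mu]_(x in `[0, s]) N3k k' x else N3.

(* Series over n >= 1 are indexed by n.+1. *)
Definition C_term (j n : nat) : R :=
  (r3 n.+1)%:R * n.+1%:R `^ (- 2 - j%:R / 2).

Definition C_coef (j : nat) : R :=
  if odd j then 0
  else (if (j %% 4 == 0)%N then 1 else -1) * (2 * j + 4)%N%:R
       * (2 * pi) ^- (j + 3) * limn (series (C_term j)).

(* With w = 2 pi sqrt n, the bracket is the real part of
   i^-k (s + i (k+1) / w) e^(i w s), so that the derivative of o_term k.+1 n is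
   o_term k n. This is what fixes the sign of the Im(i^k) s sin(w s) term. *)
Definition o_term (k n : nat) (s : R) : R :=
  let w := 2 * pi * Num.sqrt n%:R in
  let re := complex.Re (Complex 0 1 ^+ k : R[i]) in
  let im := complex.Im (Complex 0 1 ^+ k : R[i]) in
  - pi^-1 * ((r3 n)%:R / n%:R) * (w ^+ k)^-1 *
  (re * s * cos (w * s) + im * s * sin (w * s)
   + k.+1%:R / w * im * cos (w * s) - k.+1%:R / w * re * sin (w * s)).

Definition o_sum (k : nat) (s : R) : R :=
  limn (series (fun n => o_term k n.+1 s)).

Definition leading_term (k : nat) (s : R) : R :=
  8 * pi / (3 + k)`!%:R * s ^+ (3 + k).

Definition poly_term (k m : nat) (s : R) : R :=
  C_coef (k - 1 - m) / m`!%:R * s ^+ m.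

End LatticePoints.

(* Main.v *)
Require Import Defs.
From HB Require Import structures.
From mathcomp Require Import all_boot all_order all_algebra finmap.
From mathcomp Require Import all_classical all_reals all_analysis.
From mathcomp Require Import complex measurable_realfun zify ring lra.
From mathcomp Require summability.

Set Implicit Arguments.
Unset Strict Implicit.
Unset Printing Implicit Defensive.

Import Order.TTheory GRing.Theory Num.Theory.
Import numFieldNormedType.Exports.
Local Open Scope ring_scope.
Local Open Scope classical_set_scope.

(** The expansion is Poisson summation on Z^3 for radial functions, read off level by level.

    The Fourier series of the second Bernoulli polynomial gives Poisson summation for
    e^(-a x^2) on Z, i.e. the transformation law of the theta function; its cube is Poisson
    summation on Z^3 for Gaussians.  Tested against the third derivative of e^(-a s^2), the
    defect of the asserted identity at level k = 2 (where all series converge absolutely)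
    therefore vanishes for every a > 0.  Continuous functions of polynomial growth on [0, oo)
    are determined by their integrals against Gaussians, which forces the defect to be linear
    in s, and letting s -> 0 shows that it is zero.  The levels k > 2 follow by integrating
    over [0, s]: the values of the primitives o_term at 0 add up to the constant - C_k.  The
    levels k < 2 follow by duality, integrating the level k + 1 by parts against the test
    function; the same integration by parts bounds the n-th term by r_3(n) / n^2 times a
    Schwartz seminorm, whence the unconditional summability. *)

(** Level 2 is the first one with absolute convergence: r_3(n) has mean order sqrt n, and the factor
    (2 pi sqrt n)^-k turns r_3(n)/n into a summable weight from k = 2 on, where it becomes
    r_3(n)/n^2. Since N_{3,2} is a threefold primitive of the measure sum r_3(n) delta_(sqrt n),
    three derivatives on the test function lead back to Poisson summation. The price is a blind
    spot: for g even, g'(0) = 0 makes s orthogonal to g''' on [0, oo), so the coefficient C_0 cannot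
    be read off from the tests; it is recovered near 0, where only the origin is counted. On Z the
    second Bernoulli polynomial replaces the first, whose Fourier series does not converge
    absolutely; its additive constant is never computed, because it multiplies values of g' that
    telescope to 0. The primitives of the terms do not vanish at 0: for k >= 2 one has o_k(0) = -
    C_{k-1}, which is zero exactly when k is even. *)

Lemma natSr {R : pzSemiRingType} (n : nat) : n.+1%:R = n%:R + 1 :> R.
Proof. by rewrite -natr1. Qed.

(** * Calculus on the half-line *)

Section Derivatives.
Context {R : realType}.
Implicit Types (f g : R -> R) (a b x : R).

Lemma der_eqP f a b x : is_derive x (1 : R) f a -> a = b -> is_derive x (1 : R) f b.
Proof. by move=> + <-. Qed.

Lemma der_id x : is_derive x (1 : R) (fun y : R => y) 1.
Proof. exact: is_derive_id. Qed.

Lemma der_cst (c : R) x : is_derive x (1 : R) (fun _ : R => c) 0.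
Proof. exact: is_derive_cst. Qed.

Lemma der_add f g a b x : is_derive x (1 : R) f a -> is_derive x (1 : R) g b ->
  is_derive x (1 : R) (fun y => f y + g y) (a + b).
Proof. by move=> hf hg; exact: (is_deriveD hf hg). Qed.

Lemma der_opp f a x : is_derive x (1 : R) f a ->
  is_derive x (1 : R) (fun y => - f y) (- a).
Proof. by move=> hf; exact: (is_deriveN hf). Qed.

Lemma der_mul f g a b x : is_derive x (1 : R) f a -> is_derive x (1 : R) g b ->
  is_derive x (1 : R) (fun y => f y * g y) (a * g x + f x * b).
Proof.
move=> hf hg; apply: (is_derive_eq (is_deriveM hf hg)).
by rewrite /GRing.scale /= addrC (mulrC (g x)).
Qed.

Lemma der_comp (h : R -> R) f a b x : is_derive (f x) (1 : R) h a -> is_derive x (1 : R) f b ->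
  is_derive x (1 : R) (fun y => h (f y)) (b * a).
Proof.
move=> hh hf; apply: (is_derive_eq (@is_derive1_comp R h f x a b hh hf)).
by rewrite mulrC.
Qed.

Lemma der_exp f b x : is_derive x (1 : R) f b ->
  is_derive x (1 : R) (fun y => expR (f y)) (b * expR (f x)).
Proof. by move=> hf; apply: der_comp hf; exact: is_derive_expR. Qed.

Lemma der_sin f b x : is_derive x (1 : R) f b ->
  is_derive x (1 : R) (fun y => sin (f y)) (b * cos (f x)).
Proof. by move=> hf; apply: der_comp hf; exact: is_derive_sin. Qed.

Lemma der_cos f b x : is_derive x (1 : R) f b ->
  is_derive x (1 : R) (fun y => cos (f y)) (b * - sin (f x)).
Proof. by move=> hf; apply: der_comp hf; exact: is_derive_cos. Qed.

Lemma der_pow n f b x : is_derive x (1 : R) f b ->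
  is_derive x (1 : R) (fun y => f y ^+ n) (n%:R * f x ^+ n.-1 * b).
Proof.
move=> hf; suff -> : (fun y => f y ^+ n) = f ^+ n by exact: is_deriveX.
by apply/funext => y; rewrite fctE.
Qed.

Lemma der_recip f b x : f x != 0 -> is_derive x (1 : R) f b ->
  is_derive x (1 : R) (fun y => (f y)^-1) (- b / f x ^+ 2).
Proof.
move=> fx hf; have h := @is_deriveV R f x b 1 fx hf; apply: (der_eqP h).
by rewrite /GRing.scale /= mulNr mulNr mulrC.
Qed.

Lemma der_sum n (f f' : nat -> R -> R) x :
  (forall i, is_derive x (1 : R) (f i) (f' i x)) ->
  is_derive x (1 : R) (fun y => \sum_(0 <= i < n) f i y) (\sum_(0 <= i < n) f' i x).
Proof.
move=> df; elim: n => [|n IH].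
  rewrite big_geq// (_ : (fun y => _) = cst 0); first exact: der_cst.
  by apply/funext => y; rewrite big_geq.
rewrite big_nat_recr//= (_ : (fun y => _) = (fun y => \sum_(0 <= i < n) f i y + f n y)).
  exact: der_add.
by apply/funext => y; rewrite big_nat_recr.
Qed.

Lemma der_cont f f' : (forall x, is_derive x (1 : R) f (f' x)) -> continuous f.
Proof.
move=> df x; apply: differentiable_continuous.
by apply/derivable1_diffP; have [] := df x.
Qed.

Lemma der_derive1 f a x : is_derive x (1 : R) f a -> f^`() x = a.
Proof. by move=> h; rewrite derive1E; exact: derive_val. Qed.

End Derivatives.

(** The rules above are stated for pointwise functions [fun y => ...], so that differentiation can
    follow the syntax. The derivative comes out unsimplified, and [der_eq] leaves its equality with
    the wanted one to [ring] or [field]. *)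
Ltac der := repeat first
  [ eassumption | exact: der_cst | exact: der_id
  | notypeclasses refine (der_add _ _) | notypeclasses refine (der_opp _)
  | notypeclasses refine (der_mul _ _) | notypeclasses refine (der_exp _)
  | notypeclasses refine (der_sin _) | notypeclasses refine (der_cos _)
  | notypeclasses refine (der_pow _ _) ].
Ltac der_eq := notypeclasses refine (der_eqP _ _); [ der | rewrite /= ].

Section Integrals.
Context {R : realType}.
Notation mu := (@lebesgue_measure R).
Implicit Types (f g psi : R -> R) (D : set R).

Lemma cont_meas D f : measurable D -> continuous f -> measurable_fun D f.
Proof. by move=> mD cf; apply: measurable_funTS; exact: continuous_measurable_fun. Qed.

Lemma int_le D f g : measurable D -> measurable_fun D f ->
  mu.-integrable D (EFin \o g) -> (forall x, D x -> `|f x| <= g x) ->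
  mu.-integrable D (EFin \o f).
Proof.
move=> mD mf ig fg; apply: (@le_integrable _ _ _ mu D mD _ _ _ _ ig).
  exact/measurable_EFinP.
by move=> x Dx /=; rewrite lee_fin (le_trans (fg x Dx))// ler_norm.
Qed.

Lemma Rint_bound D f g : measurable D -> measurable_fun D f ->
  mu.-integrable D (EFin \o g) -> (forall x, D x -> `|f x| <= g x) ->
  `|\int[mu]_(x in D) f x| <= \int[mu]_(x in D) g x.
Proof.
move=> mD mf ig fg; have If := int_le mD mf ig fg.
apply: (le_trans (@le_normr_Rintegral _ _ _ mu D f mD If)); apply: le_Rintegral => //.
apply: (int_le mD _ ig); first exact: (measurableT_comp (@normr_measurable R setT)).
by move=> x Dx; rewrite normr_id fg.
Qed.

Lemma Rdominated D (f_ : nat -> R -> R) f g : measurable D ->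
  (forall n, measurable_fun D (f_ n)) ->
  (forall x, D x -> f_ n x @[n --> \oo] --> f x) ->
  mu.-integrable D (EFin \o g) ->
  (forall n x, D x -> `|f_ n x| <= g x) ->
  mu.-integrable D (EFin \o f) /\
  \int[mu]_(x in D) f_ n x @[n --> \oo] --> \int[mu]_(x in D) f x.
Proof.
move=> mD mf_ cf ig fg.
have mf : measurable_fun D f by exact: measurable_fun_cvg mf_ cf.
have [||||| If _ c] := @dominated_convergence _ _ R mu D mD (fun n => EFin \o f_ n)
  (EFin \o f) (EFin \o g).
- by move=> n; apply/measurable_EFinP; exact: mf_.
- exact/measurable_EFinP.
- by apply: aeW => x Dx; apply: cvg_EFin; [exact: nearW|exact: cf].
- exact: ig.
- by apply: aeW => x n Dx; rewrite lee_fin; exact: fg.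
split=> //; apply: fine_cvg.
by rewrite /Rintegral fineK//; exact: integrable_fin_num.
Qed.

Lemma int_mul D f (c : R) : measurable D -> mu.-integrable D (EFin \o f) ->
  mu.-integrable D (EFin \o (fun x => c * f x)).
Proof.
by move=> mD If; exact: (@integrableZl _ _ _ mu D mD c _ If).
Qed.

Lemma int_add D f g : measurable D -> mu.-integrable D (EFin \o f) ->
  mu.-integrable D (EFin \o g) -> mu.-integrable D (EFin \o (fun x => f x + g x)).
Proof. by move=> mD If Ig; exact: (@integrableD _ _ _ mu D mD _ _ If Ig). Qed.

Lemma int_sum D n (f : nat -> R -> R) : measurable D ->
  (forall i, (i < n)%N -> mu.-integrable D (EFin \o f i)) ->
  mu.-integrable D (EFin \o (fun x => \sum_(0 <= i < n) f i x)).
Proof.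
move=> mD; elim: n => [|n IH] If.
  apply: eq_integrable (integrable0 mu D) => // x _ /=.
  by rewrite big_geq.
have := int_add mD (IH (fun i h => If i (ltnW h))) (If n (ltnSn n)).
by apply: eq_integrable => // x _ /=; rewrite big_nat_recr.
Qed.

Lemma Rint_sum D n (f : nat -> R -> R) : measurable D ->
  (forall i, (i < n)%N -> mu.-integrable D (EFin \o f i)) ->
  \int[mu]_(x in D) (\sum_(0 <= i < n) f i x) =
  \sum_(0 <= i < n) \int[mu]_(x in D) f i x.
Proof.
move=> mD; elim: n => [|n IH] If.
  rewrite big_geq// -[RHS](@Rintegral_set0 _ _ _ mu (cst 0)).
  under eq_Rintegral do rewrite big_geq//.
  by rewrite Rintegral_set0 Rintegral_cst// mul0r.
have If' i : (i < n)%N -> mu.-integrable D (EFin \o f i) by move=> /ltnW; exact: If.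
under eq_Rintegral do rewrite big_nat_recr//=.
rewrite RintegralD//; [|exact: int_sum|exact: If].
by rewrite IH// big_nat_recr.
Qed.

Lemma oneDsqrV_int D : measurable D ->
  mu.-integrable D (EFin \o (fun x : R => (oneDsqr x)^-1)).
Proof.
move=> mD; apply: (@integrableS _ _ _ _ setT) => //.
have m : measurable_fun [set: R] (EFin \o (fun x : R => (oneDsqr x)^-1)).
  apply/measurable_EFinP; apply: continuous_measurable_fun.
  exact: continuous_oneDsqrV.
apply/integrableP; split=> //; apply/abse_integralP => //.
rewrite ge0_symfun_integralT//=.
- rewrite (_ : [set x | _] = `[0, +oo[%classic); last first.
    by apply/seteqP; split => x/=; rewrite in_itv/= andbT.
  by rewrite integral0y_oneDsqr ltry.
- exact: continuous_oneDsqrV.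
- by move=> x/=; rewrite /oneDsqr sqrrN.
Qed.

(** Growth is controlled on the whole line although the integrals run over half-lines; in this way
    the closure rules below carry no domain. *)
Definition pbd f := exists (m : nat) (c : R), forall x, `|f x| <= c * (1 + `|x|) ^+ m.

(** Decay is asked of the function alone, not of its derivatives. Integration by parts then asks for
    it separately of [psi] and [psi'], which serves Gaussians and Schwartz functions alike. *)
Definition rapid psi := continuous psi /\
  forall m : nat, exists M : R, forall x, (1 + `|x|) ^+ m * `|psi x| <= M.

Lemma le1D (x : R) : 1 <= 1 + `|x|. Proof. by rewrite lerDl. Qed.

Lemma le1DX (x : R) n m : (n <= m)%N -> (1 + `|x|) ^+ n <= (1 + `|x|) ^+ m.
Proof. by move=> nm; rewrite ler_weXn2l// le1D. Qed.

Lemma pbd_ge0 f : pbd f -> exists (m : nat) (c : R), 0 <= c /\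
  forall x, `|f x| <= c * (1 + `|x|) ^+ m.
Proof.
move=> [m [c h]]; exists m, c; split=> //.
by have := h 0; rewrite normr0 addr0 expr1n mulr1; apply: le_trans.
Qed.

(** Two spare powers of decay produce the integrable majorant 1 / (1 + x^2). Both the integrability
    of the product and its vanishing at infinity, i.e. the boundary term at infinity of an
    integration by parts, come from this bound. *)
Lemma pbd_rapid_bound f psi : pbd f -> rapid psi ->
  exists C : R, 0 <= C /\ forall x, `|f x * psi x| <= C * (oneDsqr x)^-1.
Proof.
move=> /pbd_ge0[m [c [c0 hf]]] [_ /(_ m.+2)[M hM]].
have M0 : 0 <= M.
  by apply: le_trans (hM 0); rewrite mulr_ge0// exprn_ge0// (le_trans ler01)// le1D.
exists (c * M); split; first exact: mulr_ge0.
move=> x; have x1 := le1D x; have x0 : 0 < 1 + `|x| by exact: lt_le_trans x1.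
rewrite normrM ler_pdivlMr; last exact: (lt_le_trans ltr01 (oneDsqr_ge1 x)).
have h : oneDsqr x <= (1 + `|x|) ^+ 2.
  by rewrite /oneDsqr -real_normK ?num_real//; have := normr_ge0 x; nra.
apply: (@le_trans _ _ ((c * (1 + `|x|) ^+ m * `|psi x|) * (1 + `|x|) ^+ 2)).
  apply: ler_pM => //; rewrite ?mulr_ge0//.
  by apply: ler_wpM2r => //; exact: hf.
rewrite (_ : _ * _ * _ = c * ((1 + `|x|) ^+ m.+2 * `|psi x|)); last first.
  by rewrite !exprS; ring.
by apply: ler_wpM2l => //; exact: hM.
Qed.

Lemma pbd_rapid_int D f psi : measurable D -> measurable_fun D f -> pbd f ->
  rapid psi -> mu.-integrable D (EFin \o (fun x => f x * psi x)).
Proof.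
move=> mD mf pf rpsi; have [C [_ h]] := pbd_rapid_bound pf rpsi.
apply: (int_le mD _ (int_mul C mD (oneDsqrV_int mD))) => [|x _ /=].
  by apply: measurable_funM => //; apply: cont_meas => //; case: rpsi.
exact: h.
Qed.

Lemma pbd_rapid_cvg0 f psi : pbd f -> rapid psi ->
  f x * psi x @[x --> +oo] --> (0 : R).
Proof.
move=> pf rpsi; have [C [C0 h]] := pbd_rapid_bound pf rpsi.
apply/norm_cvg0P.
apply: (@squeeze_cvgr _ _ _ _ (fun=> 0) (fun x => C * x^-1)).
- near=> x; rewrite normr_ge0 /=; apply: (le_trans (h x)).
  have x0 : 0 < x by near: x; exact: nbhs_pinfty_gt.
  apply: ler_wpM2l => //; rewrite lef_pV2 ?posrE//.
  by rewrite /oneDsqr; nra.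
- exact: cvg_cst.
- rewrite -[X in _ --> X](mulr0 C); apply: cvgM; first exact: cvg_cst.
  apply/cvgrPdist_lt => e e0; near=> x.
  have x0 : 0 < x by near: x; exact: nbhs_pinfty_gt.
  have xe : e^-1 < x by near: x; apply: nbhs_pinfty_gt; exact: num_real.
  by rewrite sub0r normrN gtr0_norm ?invr_gt0// invf_plt ?posrE.
Unshelve. all: by end_near. Qed.

Lemma rapid_mul f psi : continuous f -> pbd f -> rapid psi ->
  rapid (fun x => f x * psi x).
Proof.
move=> cf /pbd_ge0[m [c [c0 hf]]] [cpsi hpsi]; split.
  by move=> x; apply: cvgM; [exact: cf|exact: cpsi].
move=> k; have [M hM] := hpsi (m + k)%N; exists (c * M) => x.
have x0 : 0 <= 1 + `|x| by rewrite (le_trans ler01)// le1D.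
apply: (@le_trans _ _ ((1 + `|x|) ^+ k * (c * (1 + `|x|) ^+ m * `|psi x|))).
  by rewrite normrM ler_wpM2l ?exprn_ge0// ler_wpM2r.
rewrite (_ : _ ^+ k * _ = c * ((1 + `|x|) ^+ (m + k) * `|psi x|)).
  exact: ler_wpM2l.
by rewrite exprD; ring.
Qed.

Lemma pbd_cst (c : R) : pbd (fun=> c).
Proof. by exists 0%N, `|c| => x; rewrite expr0 mulr1. Qed.

Lemma pbd_id : pbd (fun x => x).
Proof. by exists 1%N, 1 => x; rewrite expr1 mul1r lerDr. Qed.

Lemma pbd_mul f g : pbd f -> pbd g -> pbd (fun x => f x * g x).
Proof.
move=> /pbd_ge0[m [c [c0 hf]]] /pbd_ge0[k [d [d0 hg]]].
exists (m + k)%N, (c * d) => x; rewrite normrM exprD mulrACA.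
by apply: ler_pM.
Qed.

Lemma pbd_add f g : pbd f -> pbd g -> pbd (fun x => f x + g x).
Proof.
move=> /pbd_ge0[m [c [c0 hf]]] /pbd_ge0[k [d [d0 hg]]].
exists (m + k)%N, (c + d) => x; apply: (le_trans (ler_normD _ _)).
rewrite mulrDl lerD//.
  by apply: le_trans (hf x) _; rewrite ler_wpM2l// le1DX// leq_addr.
by apply: le_trans (hg x) _; rewrite ler_wpM2l// le1DX// leq_addl.
Qed.

Lemma pbd_le f g : pbd g -> (forall x, `|f x| <= `|g x|) -> pbd f.
Proof. by move=> [m [c h]] fg; exists m, c => x; apply: le_trans (fg x) (h x). Qed.

Lemma pbd_opp f : pbd f -> pbd (fun x => - f x).
Proof. by move=> pf; apply: (pbd_le pf) => x; rewrite normrN. Qed.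

Lemma pbd_pow f n : pbd f -> pbd (fun x => f x ^+ n).
Proof.
move=> pf; elim: n => [|n IH]; first exact: pbd_cst.
by apply: pbd_le (pbd_mul pf IH) _ => x; rewrite exprS.
Qed.

Lemma pbd_sin f : pbd (fun x => sin (f x)).
Proof. by apply: (pbd_le (pbd_cst 1)) => x; rewrite normr1 ler_norml sin_geN1 sin_le1. Qed.

Lemma pbd_cos f : pbd (fun x => cos (f x)).
Proof. by apply: (pbd_le (pbd_cst 1)) => x; rewrite normr1 ler_norml cos_geN1 cos_le1. Qed.

Definition gauss (a x : R) : R := expR (- (a * x ^+ 2)).

Lemma gauss_der (a x : R) : is_derive x (1 : R) (gauss a) (- (2 * a * x) * gauss a x).
Proof. by rewrite /gauss; der_eq; rewrite /=; ring. Qed.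

(** e^(a x^2) is the (m+1)-st power of e^(a x^2 / (m+1)) >= 1 + a x^2 / (m+1) >= b (1 + x^2), and 1
    + |x| <= 2 (1 + x^2); so each factor 1 + |x| is absorbed by one factor of the exponential at the
    cost 2 / b. *)
Lemma gauss_rapid (a : R) : 0 < a -> rapid (gauss a).
Proof.
move=> a0; split; first exact: (der_cont (gauss_der a)).
move=> m; pose b := Num.min 1 (a / m.+1%:R).
have b0 : 0 < b by rewrite lt_min ltr01 divr_gt0.
exists ((2 / b) ^+ m.+1) => x.
have x1 := le1D x.
rewrite /gauss [X in _ * X <= _]ger0_norm ?expR_ge0// expRN.
have m0 : (m.+1%:R : R) != 0 by rewrite pnatr_eq0.
rewrite -[X in _ / expR X <= _](_ : (a / m.+1%:R * x ^+ 2) * m.+1%:R = _); last by field.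
rewrite expRM_natr.
apply: (@le_trans _ _ ((1 + `|x|) ^+ m.+1 / expR (a / m.+1%:R * x ^+ 2) ^+ m.+1)).
  by rewrite ler_wpM2r ?le1DX// invr_ge0 exprn_ge0// expR_ge0.
rewrite -expr_div_n lerXn2r ?nnegrE ?divr_ge0 ?expR_ge0//; first exact: ltW.
rewrite ler_pdivrMr ?expR_gt0//.
have h1 : 1 + a / m.+1%:R * x ^+ 2 <= expR (a / m.+1%:R * x ^+ 2) by exact: expR_ge1Dx.
have h2 : b * (1 + x ^+ 2) <= 1 + a / m.+1%:R * x ^+ 2.
  rewrite mulrDr mulr1 lerD//; first by rewrite ge_min lexx.
  by rewrite ler_wpM2r ?sqr_ge0// ge_min lexx orbT.
apply: (@le_trans _ _ (2 / b * (b * (1 + x ^+ 2)))).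
  rewrite mulrA divfK ?gt_eqF// -[x ^+ 2]real_normK ?num_real//.
  by have := normr_ge0 x; nra.
by apply: ler_wpM2l; [rewrite divr_ge0 ?(ltW b0)|exact: le_trans h2 h1].
Qed.

Lemma FTC_bounded (F f : R -> R) (a b : R) : a <= b ->
  (forall x, is_derive x (1 : R) F (f x)) -> continuous f ->
  \int[mu]_(x in `[a, b]) f x = F b - F a.
Proof.
rewrite le_eqVlt => /predU1P[<- _ _|ab dF cf].
  by rewrite set_itv1 Rintegral_set1 subrr.
rewrite /Rintegral (@continuous_FTC2 _ f F)//.
- by apply: continuous_subspaceT.
- have cF := der_cont dF; split.
  + by move=> x _; have [] := dF x.
  + by apply: cvg_at_right_filter; exact: cF.
  + by apply: cvg_at_left_filter; exact: cF.
- by move=> x _; exact: der_derive1.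
Qed.

Lemma Rint_itvy_cvg (f : R -> R) (r : R) :
  mu.-integrable `[r, +oo[ (EFin \o f) ->
  \int[mu]_(x in `[r, r + n%:R]) f x @[n --> \oo] --> \int[mu]_(x in `[r, +oo[) f x.
Proof.
move=> If; pose f_ (n : nat) := f \_ `[r, r + n%:R].
have [|||| n x rx|_] := @Rdominated `[r, +oo[ f_ f (fun x => `|f x|) _.
- exact: measurable_itv.
- move=> n; apply/measurable_restrict => //.
  apply: (measurable_funS (E := `[r, +oo[)) => //.
  by case/integrableP : If => /measurable_EFinP.
- move=> x /=; rewrite in_itv /= andbT => rx; apply: cvg_near_cst.
  near=> n; rewrite /f_ patchE mem_set//= in_itv /= rx /= -lerBlDl.
  by near: n; apply: nbhs_infty_ger.
- exact: (integrable_norm If).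
- by rewrite /f_ patchE; case: ifPn => _; rewrite ?normr0.
move=> h; apply: cvg_trans h; apply: near_eq_cvg; near=> n.
rewrite /f_ -Rintegral_mkcondr; congr (Rintegral _ _ _).
apply/seteqP; split=> x /=; rewrite !in_itv /= ?andbT; first by case.
by move=> /andP[-> ->].
Unshelve. all: by end_near. Qed.

Lemma FTC_itvy (F f : R -> R) (r : R) :
  (forall x, is_derive x (1 : R) F (f x)) -> continuous f ->
  mu.-integrable `[r, +oo[ (EFin \o f) -> F x @[x --> +oo] --> (0 : R) ->
  \int[mu]_(x in `[r, +oo[) f x = - F r.
Proof.
move=> dF cf If F0; have h := Rint_itvy_cvg If.
have h2 : \int[mu]_(x in `[r, r + n%:R]) f x @[n --> \oo] --> - F r.
  rewrite (_ : (fun n => _) = (fun n : nat => F (r + n%:R) - F r)); last first.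
    by apply/funext => n; rewrite (FTC_bounded _ dF cf) ?lerDl.
  rewrite -[X in _ --> X]add0r; apply: cvgB; last exact: cvg_cst.
  move/cvg_pinftyP : F0; apply.
  exact: cvg_comp cvgr_idn (cvg_addrl r).
exact: (cvg_unique _ h h2).
Qed.

Lemma IBP_itvy (f f' psi psi' : R -> R) (r : R) :
  (forall x, is_derive x (1 : R) f (f' x)) -> continuous f' -> pbd f -> pbd f' ->
  (forall x, is_derive x (1 : R) psi (psi' x)) -> rapid psi -> rapid psi' ->
  \int[mu]_(x in `[r, +oo[) (f' x * psi x) =
  - (f r * psi r) - \int[mu]_(x in `[r, +oo[) (f x * psi' x).
Proof.
move=> df cf' pf pf' dpsi rp rp'.
have cf := der_cont df; have cp := der_cont dpsi; have cp' := rp'.1.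
have mI : measurable `[r, +oo[%classic by exact: measurable_itv.
have I1 := pbd_rapid_int mI (cont_meas mI cf') pf' rp.
have I2 := pbd_rapid_int mI (cont_meas mI cf) pf rp'.
apply/eqP; rewrite -subr_eq opprK; apply/eqP; rewrite -RintegralD//.
apply: (FTC_itvy (F := fun x => f x * psi x)).
- by move=> x; exact: der_mul.
- move=> x; apply: cvgD; apply: cvgM; [exact: cf'|exact: cp|exact: cf|exact: cp'].
- exact: int_add.
- exact: pbd_rapid_cvg0.
Qed.

End Integrals.

(** * Theta transformation *)

Section GaussTransform.
Context {R : realType}.
Notation mu := (@lebesgue_measure R).

Definition gauss0 (a : R) : R := \int[mu]_(x in `[0, +oo[) gauss a x.

Lemma itv0y_meas : measurable (`[0, +oo[%classic : set R).
Proof. exact: measurable_itv. Qed.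

Lemma rapid_int (D : set R) (psi : R -> R) : measurable D -> rapid psi ->
  mu.-integrable D (EFin \o psi).
Proof.
move=> mD rp; have m1 : measurable_fun D (fun _ : R => 1 : R) by exact: measurable_cst.
have := pbd_rapid_int mD m1 (pbd_cst 1) rp.
by apply: eq_integrable => // x _ /=; rewrite mul1r.
Qed.

(** The substitution x -> sqrt a x in the Gaussian integral. The squared form keeps square roots out
    of the later algebra, where it turns a factor pi / a into a power of [gauss0 a]. *)
Lemma gauss0_sqr (a : R) : 0 < a -> (2 * gauss0 a) ^+ 2 = pi / a.
Proof.
move=> a0; pose b := Num.sqrt a; have b0 : 0 < b by rewrite sqrtr_gt0.
have bb : b ^+ 2 = a by rewrite sqr_sqrtr// ltW.
pose F (x : R) := b * x.
have dF x : is_derive x (1 : R) F b by rewrite /F; der_eq; rewrite mul0r add0r mulr1.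
have F'E : F^`()%classic = cst b.
  by apply/funext => x; rewrite (der_derive1 (dF x)).
have F0 : F 0 = 0 by rewrite /F mulr0.
have cF := der_cont dF.
suff h : (\int[mu]_(x in `[0%R, +oo[) (gauss_fun x)%:E =
    \int[mu]_(x in `[0%R, +oo[) (b * gauss a x)%:E)%E.
  have : Num.sqrt pi / 2 = b * gauss0 a.
    rewrite /gauss0 -RintegralZl//; last first.
      exact: rapid_int (gauss_rapid a0).
    by rewrite /Rintegral -h integral0y_gauss.
  move=> h2; have pi0 := @pi_ge0 R.
  have -> : gauss0 a = Num.sqrt pi / 2 / b by rewrite h2 mulrC mulKf// gt_eqF.
  by rewrite !exprMn !exprVn sqr_sqrtr// bb; field; rewrite gt_eqF.
rewrite -{1}F0 (@increasing_ge0_integration_by_substitutiony R F gauss_fun 0) ?F'E.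
- apply: eq_integral => x _; congr EFin; rewrite /= fctE /= mulrC /gauss_fun /gauss /F.
  by rewrite exprMn bb.
- by move=> x y _ _ xy; rewrite /F ltr_pM2l.
- by move=> x _; exact: cvg_cst.
- by apply: is_cvg_cst.
- by apply: is_cvg_cst.
- split; first by move=> x _; have [] := dF x.
  by apply: cvg_at_right_filter; exact: cF.
- apply: gt0_cvgMry => //; exact: cvg_id.
- by apply: continuous_subspaceT; exact: continuous_gauss_fun.
- by move=> x _; exact: gauss_fun_ge0.
Qed.

Lemma gauss_IBP (a r : R) (f f' : R -> R) : 0 < a ->
  (forall x, is_derive x (1 : R) f (f' x)) -> continuous f' -> pbd f -> pbd f' ->
  \int[mu]_(x in `[r, +oo[) (f' x * gauss a x) =
  - (f r * gauss a r) - \int[mu]_(x in `[r, +oo[) (f x * (- (2 * a * x) * gauss a x)).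
Proof.
move=> a0 df cf' pf pf'; apply: IBP_itvy => //.
- exact: gauss_der.
- exact: gauss_rapid.
- apply: rapid_mul; last exact: gauss_rapid.
    by apply: (@der_cont _ _ (fun=> - (2 * a))) => x; der_eq; ring.
  by apply: pbd_opp; apply: pbd_mul; [exact: pbd_cst|exact: pbd_id].
Qed.

Lemma der_sinw (w x : R) : is_derive x (1 : R) (fun x => sin (w * x)) (w * cos (w * x)).
Proof. by der_eq; ring. Qed.

Lemma der_cosw (w x : R) : is_derive x (1 : R) (fun x => cos (w * x)) (- (w * sin (w * x))).
Proof. by der_eq; ring. Qed.

Lemma cont_sinw (w : R) : continuous (fun x => sin (w * x)).
Proof. exact: (der_cont (der_sinw w)). Qed.

Lemma cont_cosw (w : R) : continuous (fun x => cos (w * x)).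
Proof. exact: (der_cont (der_cosw w)). Qed.

Lemma cont_mul (f g : R -> R) : continuous f -> continuous g -> continuous (fun x => f x * g x).
Proof. by move=> cf cg x; apply: cvgM; [exact: cf|exact: cg]. Qed.

Lemma cont_add (f g : R -> R) : continuous f -> continuous g -> continuous (fun x => f x + g x).
Proof. by move=> cf cg x; apply: cvgD; [exact: cf|exact: cg]. Qed.

Lemma cont_opp (f : R -> R) : continuous f -> continuous (fun x => - f x).
Proof. by move=> cf x; apply: cvgN; exact: cf. Qed.

Lemma cont_cst (c : R) : continuous (fun _ : R => c).
Proof. by move=> x; exact: cvg_cst. Qed.

Lemma cont_id : continuous (fun x : R => x).
Proof. by move=> x; exact: cvg_id. Qed.

Lemma rapid_xgauss (a : R) : 0 < a -> rapid (fun x => x * gauss a x).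
Proof.
move=> a0; apply: rapid_mul; [exact: cont_id|exact: pbd_id|exact: gauss_rapid].
Qed.

(** Differentiation under the integral followed by one integration by parts gives I'(w) = - w / (2
    a) I(w); hence I(w) e^(w^2 / (4 a)) has derivative 0 and equals its value at w = 0. *)
Lemma gaussFT (a w : R) : 0 < a ->
  \int[mu]_(x in `[0, +oo[) (cos (w * x) * gauss a x) =
  gauss0 a * expR (- (w ^+ 2 / (4 * a))).
Proof.
move=> a0; pose I (w : R) := \int[mu]_(x in `[0, +oo[) (cos (w * x) * gauss a x).
have mI := itv0y_meas.
have Iint u : mu.-integrable `[0, +oo[ (EFin \o (fun x => cos (u * x) * gauss a x)).
  apply: pbd_rapid_int => //; [|exact: pbd_cos|exact: gauss_rapid].
  by apply: cont_meas => //; exact: cont_cosw.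
have dI (u : R) : is_derive u (1 : R) I (- (u / (2 * a)) * I u).
  pose f (v x : R) := cos (v * x) * gauss a x.
  have df v x : is_derive v (1 : R) (f ^~ x) (- (x * sin (v * x)) * gauss a x).
    by rewrite /f; der_eq; ring.
  have dfE v x : partial1of2 f v x = - (x * sin (v * x)) * gauss a x.
    by rewrite /partial1of2 (der_derive1 (df v x)).
  pose G (x : R) := `|x * gauss a x|.
  have intG : mu.-integrable `[0, +oo[ (EFin \o G).
    exact: (integrable_norm (rapid_int mI (rapid_xgauss a0))).
  have uI : (`]u - 1, u + 1[)%classic u by rewrite /= in_itv /=; apply/andP; split; lra.
  have i1 v : (`]u - 1, u + 1[)%classic v -> mu.-integrable `[0, +oo[ (EFin \o f v).
    by move=> _; exact: Iint.
  have i2 v x : (`]u - 1, u + 1[)%classic v -> (`[0, +oo[)%classic x -> derivable (f ^~ x) v 1.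
    by move=> _ _; have [] := df v x.
  have i3 v x : (`]u - 1, u + 1[)%classic v -> (`[0, +oo[)%classic x ->
      `|partial1of2 f v x| <= G x.
    move=> _ _; rewrite dfE /G !normrM normrN !normrM -mulrA ler_wpM2l//.
    rewrite ler_piMl//; first by rewrite ler_norml sin_geN1 sin_le1.
  have D := @derivable_under_integral R _ _ mu f `[0, +oo[%classic mI u (u - 1) (u + 1)
    uI i1 i2 G (fun=> normr_ge0 _) intG i3.
  have DE := @differentiation_under_integral R _ _ mu f `[0, +oo[%classic mI u (u - 1) (u + 1)
    uI i1 i2 G (fun=> normr_ge0 _) intG i3.
  apply: DeriveDef; first exact: D.
  rewrite -derive1E [LHS]DE.
  under eq_Rintegral do rewrite dfE.
  have := @gauss_IBP a 0 (fun x => sin (u * x)) _ a0 (der_sinw u)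
    (cont_mul (@cont_cst u) (@cont_cosw u)) (pbd_sin _) (pbd_mul (pbd_cst u) (pbd_cos _)).
  rewrite mulr0 sin0 mul0r oppr0 add0r.
  rewrite (_ : (fun x => u * cos (u * x) * gauss a x) =
    (fun x => u * (cos (u * x) * gauss a x))); last by apply/funext => x; ring.
  rewrite RintegralZl// -/(I u).
  rewrite (_ : (fun x => sin (u * x) * _) =
    (fun x => (2 * a) * (- (x * sin (u * x)) * gauss a x))); last first.
    by apply/funext => x; ring.
  have Is : mu.-integrable `[0, +oo[
      (EFin \o (fun x => - (x * sin (u * x)) * gauss a x)).
    apply: pbd_rapid_int => //; last exact: gauss_rapid.
      apply: cont_meas => //; apply: cont_opp.
      by apply: cont_mul; [exact: cont_id|exact: cont_sinw].
    by apply: pbd_opp; apply: pbd_mul; [exact: pbd_id|exact: pbd_sin].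
  rewrite RintegralZl// => h.
  have a2 : 2 * a != 0 by rewrite mulf_neq0// gt_eqF.
  have -> : - (u / (2 * a)) * I u = - (u * I u) / (2 * a) by ring.
  by rewrite h opprK mulrAC divff// mul1r.
pose H (u : R) := I u * expR (u ^+ 2 / (4 * a)).
have dH u : is_derive u (1 : R) H 0.
  have dIu := dI u; rewrite /H; der_eq; field; rewrite gt_eqF//.
have : H w = H 0 by exact: is_derive_0_is_cst.
rewrite /H expr0n /= mul0r expR0 mulr1 => h.
have -> : gauss0 a = I 0.
  rewrite /gauss0 /I; apply: eq_Rintegral => x _.
  by rewrite mul0r cos0 mul1r.
by rewrite -h -mulrA -expRD subrr expR0 mulr1.
Qed.

End GaussTransform.

(** * Fourier series of the second Bernoulli polynomial *)

Section FourierB2.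
Context {R : realType}.
Notation mu := (@lebesgue_measure R).

(** Partial sums of the Fourier series of pi^2 B_2(x) = pi^2 ((x - 1/2)^2 - 1/12) on [0, 1]. *)
Definition T2 (N : nat) (x : R) : R :=
  \sum_(0 <= n < N) cos (2 * pi * n.+1%:R * x) / n.+1%:R ^+ 2.

Lemma invsq_le (N : nat) : \sum_(0 <= n < N) (n.+1%:R ^- 2 : R) <= 2.
Proof.
(* The strengthened bound telescopes, since 1 / (n+1)^2 <= 1/n - 1/(n+1). *)
suff h : \sum_(0 <= n < N.+1) (n.+1%:R ^- 2 : R) <= 2 - N.+1%:R^-1.
  apply: (@le_trans _ _ (\sum_(0 <= n < N.+1) (n.+1%:R ^- 2 : R))).
    by rewrite [leRHS]big_nat_recr//= lerDl invr_ge0 exprn_ge0.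
  by apply: (le_trans h); rewrite lerBlDr lerDl invr_ge0.
elim: N => [|N IH].
  by rewrite big_nat1 expr1n invr1; lra.
rewrite big_nat_recr//=; apply: (le_trans (lerD IH (lexx _))).
have n0 : (0 : R) < N.+1%:R by [].
rewrite [N.+2%:R]natSr; set n := N.+1%:R in n0 *.
rewrite -subr_ge0 (_ : _ - _ = (n * (n + 1) ^+ 2)^-1).
  have n0' := ltW n0; by rewrite invr_ge0 mulr_ge0// exprn_ge0// addr_ge0.
by field; rewrite !gt_eqF// addr_gt0.
Qed.

Lemma cvg_invsq : cvgn (series (fun n => n.+1%:R ^- 2 : R)).
Proof.
apply: nondecreasing_is_cvgn.
  by apply: nondecreasing_series => n _ _; rewrite invr_ge0 exprn_ge0.
by exists 2 => _ [N _ <-]; exact: invsq_le.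
Qed.

Lemma T2_term_le (n : nat) (x : R) :
  `|cos (2 * pi * n.+1%:R * x) / n.+1%:R ^+ 2| <= n.+1%:R ^- 2.
Proof.
rewrite normrM [X in _ * X]ger0_norm ?invr_ge0 ?exprn_ge0//.
by rewrite ler_piMl ?invr_ge0 ?exprn_ge0// ler_norml cos_geN1 cos_le1.
Qed.

Lemma T2_le (N : nat) (x : R) : `|T2 N x| <= 2.
Proof.
apply: (le_trans (ler_norm_sum _ _ _)); apply: le_trans (invsq_le N).
by apply: ler_sum => n _; exact: T2_term_le.
Qed.

Lemma T2_cvg (x : R) : cvgn (T2 ^~ x).
Proof.
apply: (@normed_cvg _ _ (fun n => cos (2 * pi * n.+1%:R * x) / n.+1%:R ^+ 2)).
apply: series_le_cvg cvg_invsq => n; [exact: normr_ge0| |exact: T2_term_le].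
by rewrite invr_ge0 exprn_ge0.
Qed.

Lemma cosDn (y : R) (m : nat) : cos (y + 2 * pi * m%:R) = cos y.
Proof.
elim: m => [|m IH]; first by rewrite mulr0 addr0.
rewrite -[RHS]IH -[RHS](cosD2pi (y + 2 * pi * m%:R)) natSr; congr cos.
by rewrite mulr2n; ring.
Qed.

Lemma T2_periodic N (x : R) (m : nat) : T2 N (x + m%:R) = T2 N x.
Proof.
apply: eq_bigr => n _; rewrite -(cosDn (_ * x) (n.+1 * m)); congr (cos _ / _).
by rewrite natrM; ring.
Qed.

Lemma T2_sym N (x : R) : T2 N (1 - x) = T2 N x.
Proof.
apply: eq_bigr => n _; rewrite -cosN -(cosDn (- _) n.+1); congr (cos _ / _).
by ring.
Qed.

Lemma MVT_le (f f' : R -> R) (a b K : R) : a <= b ->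
  (forall y, a <= y <= b -> is_derive y (1 : R) f (f' y)) ->
  (forall y, a <= y <= b -> `|f' y| <= K) -> `|f b - f a| <= K * (b - a).
Proof.
rewrite le_eqVlt => /predU1P[<- _ _|ab df fK].
  by rewrite !subrr normr0 mulr0.
have [|| c cab ->] := @MVT R f f' a b ab.
- move=> y; rewrite in_itv /= => /andP[ay yb]; apply: df.
  by rewrite !ltW.
- apply: derivable_within_continuous => y; rewrite in_itv /= => /df h.
  by have [] := h.
have ba : 0 <= b - a by rewrite subr_ge0 ltW.
rewrite normrM [X in _ * X]ger0_norm// ler_wpM2r//.
by move: cab; rewrite in_itv /= => /andP[ac cb]; rewrite fK// !ltW.
Qed.

(** Telescoping of 2 sin(B) cos(A) = sin(A + B) - sin(A - B). The second derivative of [T2 N] - pi^2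
    (y - 1/2)^2 is - 2 pi^2 times this kernel. *)
Lemma dirichlet N (y : R) :
  sin (pi * y) * (1 + 2 * \sum_(0 <= n < N) cos (2 * pi * n.+1%:R * y)) =
  sin ((2 * N)%N.+1%:R * pi * y).
Proof.
elim: N => [|N IH].
  by rewrite big_geq// mulr0 addr0 mulr1 muln0 mul1r.
rewrite big_nat_recr//=; set S := \sum_(_ <= _ < _) _ in IH *.
have -> (C : R) : sin (pi * y) * (1 + 2 * (S + C)) =
    sin (pi * y) * (1 + 2 * S) + 2 * sin (pi * y) * C by ring.
rewrite IH; set A := 2 * pi * N.+1%:R * y; set B := pi * y.
have -> : (2 * N)%N.+1%:R * pi * y = A - B.
  by rewrite /A /B natSr natrM [N.+1%:R]natSr; ring.
have -> : (2 * N.+1)%N.+1%:R * pi * y = A + B.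
  by rewrite /A /B natSr natrM; ring.
by rewrite sinB sinD; ring.
Qed.

Lemma sinpin (m : nat) : sin (pi * m%:R : R) = 0.
Proof.
elim: m => [|m IH]; first by rewrite mulr0 sin0.
by rewrite natSr mulrDr mulr1 sinDpi IH oppr0.
Qed.

(* The derivative of T2 - pi^2 (x - 1/2)^2 is small away from the integers: its own
   derivative is a Dirichlet kernel, whose oscillation gains a factor 1/N. *)
Lemma T2_half_bound (x : R) : 0 < x -> x <= 1 / 2 -> exists C : R, forall N,
  `|(T2 N (1 / 2)) - (T2 N x - pi ^+ 2 * (x - 1 / 2) ^+ 2)| <= C / (2 * N)%N.+1%:R.
Proof.
move=> x0 x12; have pi0 := @pi_gt0 R; pose s := sin (pi * x).
have sinle y : x <= y <= 1 / 2 -> s <= sin (pi * y).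
  move=> /andP[xy y12]; rewrite /s le_eqVlt; move: xy; rewrite le_eqVlt => /predU1P[->|xy].
    by rewrite eqxx.
  apply/orP; right; rewrite ltr_sin ?in_itv /= ?ltr_pM2l//; apply/andP; split; nra.
have s0 : 0 < s by apply: sin_gt0_pi; apply/andP; split; nra.
exists (2 * pi / s + 2 * pi ^+ 2 / s ^+ 2) => N.
pose L : R := (2 * N)%N.+1%:R; have L0 : 0 < L by [].
pose U (y : R) := T2 N y - pi ^+ 2 * (y - 1 / 2) ^+ 2.
pose U1 (y : R) := - (2 * pi * \sum_(0 <= n < N) sin (2 * pi * n.+1%:R * y) / n.+1%:R)
  - 2 * pi ^+ 2 * (y - 1 / 2).
pose c := 2 * pi / L.
(* Integration by parts of U1' = - 2 pi^2 sin(L pi y) / sin(pi y): the boundary term is c cos(L pi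
   y) / sin(pi y) with c = 2 pi / L. Once it is subtracted, the derivative V' also carries the small
   factor c. *)
pose V (y : R) := U1 y - c * (cos (L * pi * y) * (sin (pi * y))^-1).
pose V' (y : R) := c * pi * cos (L * pi * y) * cos (pi * y) / sin (pi * y) ^+ 2.
have dU (y : R) : is_derive y (1 : R) U (U1 y).
  have dT : is_derive y (1 : R) (T2 N)
      (\sum_(0 <= n < N) - (2 * pi) * (sin (2 * pi * n.+1%:R * y) / n.+1%:R)).
    apply: (@der_sum R N _ (fun n y => - (2 * pi) * (sin (2 * pi * n.+1%:R * y) / n.+1%:R)) y) => n.
    by der_eq; field; rewrite addrC natr1 pnatr_eq0.
  by rewrite /U; der_eq; rewrite -big_distrr /= /U1; field.
have sy0 y : x <= y <= 1 / 2 -> 0 < sin (pi * y).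
  by move=> /sinle; exact: lt_le_trans.
have dV (y : R) : x <= y <= 1 / 2 -> is_derive y (1 : R) V (V' y).
  move=> xy; have sy := sy0 y xy; have syN : sin (pi * y) != 0 by rewrite gt_eqF.
  have d1 : is_derive y (1 : R)
      (fun y => \sum_(0 <= n < N) sin (2 * pi * n.+1%:R * y) / n.+1%:R)
      (\sum_(0 <= n < N) 2 * pi * cos (2 * pi * n.+1%:R * y)).
    apply: (@der_sum R N _ (fun n y => 2 * pi * cos (2 * pi * n.+1%:R * y)) y) => n.
    by der_eq; field; rewrite addrC natr1 pnatr_eq0.
  have d2 : is_derive y (1 : R) (fun y => (sin (pi * y))^-1)
     (- (pi * cos (pi * y)) / sin (pi * y) ^+ 2).
    by apply: (der_recip (f := fun y => sin (pi * y))) => //; der_eq; ring.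
  have D := dirichlet N y.
  rewrite /V /U1; der_eq; rewrite /V' -big_distrr /=.
  have -> : \sum_(0 <= n < N) cos (2 * pi * n.+1%:R * y) =
      (sin (L * pi * y) / sin (pi * y) - 1) / 2 by rewrite -D; field.
  by rewrite /c; field; rewrite syN gt_eqF.
(* The base point 1/2 is chosen because all the sines in U1 vanish there and, L being odd, so does
   cos(L pi / 2). *)
have V0 : V (1 / 2) = 0.
  rewrite /V /U1 subrr mulr0 subr0 big1 => [|n _].
    rewrite mulr0 oppr0 add0r (_ : L * pi * (1 / 2) = pi * N%:R + pi / 2).
      by rewrite cosDpihalf sinpin oppr0 mul0r mulr0 oppr0.
    by rewrite /L natSr natrM; field.
  rewrite (_ : 2 * pi * n.+1%:R * (1 / 2) = pi * n.+1%:R); last by field.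
  by rewrite sinpin mul0r.
have c0 : 0 < c by rewrite /c divr_gt0// mulr_gt0.
have sV y : x <= y <= 1 / 2 -> (sin (pi * y))^-1 <= s^-1.
  by move=> xy; rewrite lef_pV2 ?posrE//; first [exact: sinle|exact: sy0].
have cos1 (z : R) : `|cos z| <= 1 by rewrite ler_norml cos_geN1 cos_le1.
have V'le y : x <= y <= 1 / 2 -> `|V' y| <= c * pi * s^-1 ^+ 2.
  move=> xy; have -> : V' y = (c * pi) * (cos (L * pi * y) * cos (pi * y)
      * (sin (pi * y))^-1 ^+ 2) by rewrite /V' -exprVn; ring.
  have cp : 0 <= c * pi by rewrite mulr_ge0// ltW.
  rewrite normrM (ger0_norm cp) ler_wpM2l//.
  rewrite normrM (normrM (cos _)) normrX (@gtr0_norm _ (sin _)^-1) ?invr_gt0 ?sy0//.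
  have h1 := cos1 (L * pi * y); have h2 := cos1 (pi * y).
  have h3 : `|cos (L * pi * y)| * `|cos (pi * y)| <= 1 by rewrite mulr_ile1.
  apply: (@le_trans _ _ (1 * (sin (pi * y))^-1 ^+ 2)).
    by rewrite ler_wpM2r ?exprn_ge0// invr_ge0 ltW// sy0.
  by rewrite mul1r lerXn2r ?nnegrE ?invr_ge0 ?(ltW s0) ?(ltW (sy0 _ xy))// sV.
have Vle y : x <= y <= 1 / 2 -> `|V y| <= c * pi * s^-1 ^+ 2.
  move=> /andP[xy y12]; have K0 : 0 <= c * pi * s^-1 ^+ 2.
    by rewrite !mulr_ge0 ?exprn_ge0 ?invr_ge0 ?ltW.
  have := @MVT_le V V' y (1 / 2) _ y12.
  rewrite V0 sub0r normrN => /(_ (c * pi * s^-1 ^+ 2)) h.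
  apply: le_trans (h _ _) _.
  - by move=> z /andP[yz z12]; apply: dV; rewrite z12 (le_trans xy).
  - by move=> z /andP[yz z12]; apply: V'le; rewrite z12 (le_trans xy).
  - by rewrite ler_piMr//; lra.
have U1le y : x <= y <= 1 / 2 -> `|U1 y| <= c * pi * s^-1 ^+ 2 + c * s^-1.
  move=> xy; have -> : U1 y = V y + c * (cos (L * pi * y) * (sin (pi * y))^-1).
    by rewrite /V subrK.
  apply: le_trans (ler_normD _ _) _; rewrite lerD ?Vle//.
  rewrite normrM (gtr0_norm c0) ler_pM2l// normrM.
  rewrite (@gtr0_norm _ (sin _)^-1) ?invr_gt0 ?sy0//.
  apply: le_trans _ (sV y xy); rewrite ler_piMl// invr_ge0 ltW//.
  exact: sy0.
have -> : T2 N (1 / 2) - (T2 N x - pi ^+ 2 * (x - 1 / 2) ^+ 2) = U (1 / 2) - U x.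
  by rewrite /U subrr expr0n mulr0 subr0.
apply: le_trans (MVT_le x12 (fun y _ => dU y) U1le) _.
have K0 : 0 <= c * pi * s^-1 ^+ 2 + c * s^-1.
  by rewrite addr_ge0// !mulr_ge0 ?exprn_ge0 ?invr_ge0 ?ltW.
apply: (@le_trans _ _ (c * pi * s^-1 ^+ 2 + c * s^-1)).
  by rewrite ler_piMr//; lra.
rewrite le_eqVlt; apply/orP; left; apply/eqP; rewrite /c -/L.
by field; rewrite !gt_eqF.
Qed.

(** The limit at 1/2 stays symbolic: in the Poisson summation it only multiplies differences of g',
    which telescope to values vanishing at 0 and at infinity. *)
Lemma fourier_B2 (x : R) : 0 < x < 1 ->
  T2 N x @[N --> \oo] --> limn (T2 ^~ (1 / 2)) + pi ^+ 2 * (x - 1 / 2) ^+ 2.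
Proof.
wlog x12 : x / x <= 1 / 2.
  move=> h /andP[x0 x1]; have [x12|x12] := leP x (1 / 2).
    by apply: h => //; rewrite x0.
  have := h (1 - x); rewrite (_ : (1 - x - 1 / 2) ^+ 2 = (x - 1 / 2) ^+ 2); last by field.
  rewrite (_ : T2 ^~ (1 - x) = T2 ^~ x); last first.
    by apply/funext => N; rewrite T2_sym.
  by apply; [lra|apply/andP; split; lra].
move=> /andP[x0 _]; have [C hC] := T2_half_bound x0 x12.
have -> : T2 ^~ x = (fun N => (T2 N (1 / 2)) + pi ^+ 2 * (x - 1 / 2) ^+ 2 -
   (T2 N (1 / 2) - (T2 N x - pi ^+ 2 * (x - 1 / 2) ^+ 2))).
  by apply/funext => N; ring.
rewrite -[X in _ --> X]subr0; apply: cvgB.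
  by apply: cvgD; [exact: T2_cvg|exact: cvg_cst].
apply/norm_cvg0P; apply: (@squeeze_cvgr _ _ _ _ (fun=> 0) (fun N => `|C| * N.+1%:R^-1)).
- apply: nearW => N; rewrite normr_ge0 /=; apply: (le_trans (hC N)).
  apply: (@le_trans _ _ (`|C| / (2 * N)%N.+1%:R)); first by rewrite ler_wpM2r// ler_norm.
  by rewrite ler_wpM2l// lef_pV2 ?posrE// ler_nat ltnS mul2n -addnn leq_addr.
- exact: cvg_cst.
- rewrite -[X in _ --> X](mulr0 `|C|); apply: cvgM; first exact: cvg_cst.
  exact: cvg_harmonic.
Qed.

End FourierB2.

(** * Poisson summation for Gaussians on Z *)

Section Theta.
Context {R : realType}.
Notation mu := (@lebesgue_measure R).

Lemma Rint_split (f : R -> R) (a b c : R) : a <= b -> b <= c ->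
  mu.-integrable `[a, c] (EFin \o f) ->
  \int[mu]_(x in `[a, c]) f x =
  \int[mu]_(x in `[a, b]) f x + \int[mu]_(x in `[b, c]) f x.
Proof.
move=> ab bc If.
have := @Rintegral_itvB R f (BLeft a) (BRight c) b If.
rewrite !bnd_simp => /(_ ab bc) /eqP; rewrite subr_eq addrC => /eqP ->.
congr (_ + _); apply: Rintegral_itv_obnd_cbnd.
apply: integrableS If => //.
by apply: subset_itv; rewrite bnd_simp.
Qed.

Lemma Rint_open (f : R -> R) (a b : R) : mu.-integrable `[a, b] (EFin \o f) ->
  \int[mu]_(x in `[a, b]) f x = \int[mu]_(x in `]a, b[) f x.
Proof.
move=> If; rewrite -Rintegral_itv_bndo_bndc.
  rewrite Rintegral_itv_obnd_cbnd//.
  by apply: integrableS If => //; apply: subset_itv; rewrite bnd_simp.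
by apply: integrableS If => //; apply: subset_itv; rewrite bnd_simp.
Qed.

Lemma int_itv_cont (f : R -> R) (a b : R) : continuous f ->
  mu.-integrable `[a, b] (EFin \o f).
Proof.
move=> cf; apply: continuous_compact_integrable; first exact: segment_compact.
exact: continuous_subspaceT.
Qed.

Definition theta (a : R) (N : nat) : R :=
  1 + 2 * \sum_(0 <= n < N) expR (- (a * n.+1%:R ^+ 2)).

(** The integral of T g'' over [0, oo), with T the periodic limit of [T2], is evaluated twice. Term
    by term, two integrations by parts and [gaussFT] give the theta sum at pi^2 / a; interval by
    interval, T is a quadratic polynomial and the boundary terms give the theta sum at a.
    Convergence of both theta sums is part of the result, as both are expressed through convergent
    integrals. *)
Lemma theta_transform (a : R) : 0 < a -> exists l : R,
  theta (pi ^+ 2 / a) N @[N --> \oo] --> l /\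
  theta a N @[N --> \oo] --> 2 * gauss0 a * l.
Proof.
move=> a0; have pi0 := @pi_gt0 R; pose g := gauss a.
pose g1 (x : R) := - (2 * a * x) * g x.
pose g2 (x : R) := (4 * a ^+ 2 * x ^+ 2 - 2 * a) * g x.
have dg (x : R) : is_derive x (1 : R) g (g1 x) by exact: gauss_der.
have dg1 (x : R) : is_derive x (1 : R) g1 (g2 x).
  have := dg x; rewrite /g2 /g1 => h; der_eq; rewrite /g1; ring.
have rg : rapid g by exact: gauss_rapid.
have rg1 : rapid g1.
  apply: rapid_mul => //.
    by apply: (@der_cont _ _ (fun=> - (2 * a))) => x; der_eq; ring.
  by apply: pbd_opp; apply: pbd_mul; [exact: pbd_cst|exact: pbd_id].
have rg2 : rapid g2.
  apply: rapid_mul => //.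
    by apply: (@der_cont _ _ (fun x => 8 * a ^+ 2 * x)) => x; der_eq; ring.
  apply: pbd_add; last exact: pbd_cst.
  by apply: pbd_mul; [exact: pbd_cst|apply: pbd_pow; exact: pbd_id].
have mI := @itv0y_meas R.
pose T (x : R) := limn (T2 ^~ x).
have cT2 N : continuous (T2 N : R -> R).
  apply: (@der_cont _ _ (fun y => \sum_(0 <= n < N) - (2 * pi * n.+1%:R * sin (2 * pi * n.+1%:R * y)) / n.+1%:R ^+ 2)) => y.
  apply: (@der_sum R N _ (fun n y => - (2 * pi * n.+1%:R * sin (2 * pi * n.+1%:R * y)) / n.+1%:R ^+ 2) y) => n.
  by der_eq; ring.
have [||||I1 c1] := @Rdominated R `[0, +oo[ (fun N x => T2 N x * g2 x)
  (fun x => T x * g2 x) (fun x => 2 * `|g2 x|) mI.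
- by move=> N; apply: measurable_funM; apply: cont_meas => //; exact: rg2.1.
- by move=> x _; apply: cvgM; [exact: T2_cvg|exact: cvg_cst].
- by apply: int_mul => //; exact: (integrable_norm (rapid_int mI rg2)).
- by move=> N x _; rewrite normrM ler_wpM2r// T2_le.
set J := \int[mu]_(x in _) (T x * g2 x) in c1.
have termE (n : nat) : \int[mu]_(x in `[0, +oo[) (cos (2 * pi * n.+1%:R * x) * g2 x) =
   - (4 * pi ^+ 2 * n.+1%:R ^+ 2 * gauss0 a * expR (- (pi ^+ 2 / a * n.+1%:R ^+ 2))).
  set w := 2 * pi * n.+1%:R.
  have pw : pbd (fun x : R => w * cos (w * x)) by apply: pbd_mul; [exact: pbd_cst|exact: pbd_cos].
  have pws : pbd (fun x : R => - (w * sin (w * x))).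
    by apply: pbd_opp; apply: pbd_mul; [exact: pbd_cst|exact: pbd_sin].
  have cw : continuous (fun x : R => w * cos (w * x)).
    by apply: cont_mul; [exact: cont_cst|exact: cont_cosw].
  have cws : continuous (fun x : R => - (w * sin (w * x))).
    by apply: cont_opp; apply: cont_mul; [exact: cont_cst|exact: cont_sinw].
  have := IBP_itvy 0 (der_cosw w) cws (pbd_cos _) pws dg1 rg1 rg2.
  have -> : g1 0 = 0 by rewrite /g1 mulr0 oppr0 mul0r.
  rewrite mulr0 oppr0 add0r => /eqP; rewrite eq_sym eqr_oppLR => /eqP ->.
  have := IBP_itvy 0 (der_sinw w) cw (pbd_sin _) pw dg rg rg1.
  rewrite mulr0 sin0 mul0r oppr0 add0r.
  have -> : (fun x => w * cos (w * x) * g x) = (fun x => w * (cos (w * x) * gauss a x)).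
    by apply/funext => x; rewrite mulrA.
  have Ic : mu.-integrable `[0, +oo[ (EFin \o (fun x => cos (w * x) * gauss a x)).
    apply: pbd_rapid_int => //; [|exact: pbd_cos].
    by apply: cont_meas => //; exact: cont_cosw.
  have Is : mu.-integrable `[0, +oo[ (EFin \o (fun x => sin (w * x) * g1 x)).
    apply: pbd_rapid_int => //; [|exact: pbd_sin].
    by apply: cont_meas => //; exact: cont_sinw.
  rewrite RintegralZl// gaussFT// => h.
  have -> : (fun x => - (w * sin (w * x)) * g1 x) = (fun x => - w * (sin (w * x) * g1 x)).
    by apply/funext => x; ring.
  rewrite RintegralZl// mulNr opprK -[X in w * X]opprK -h.
  have -> : w ^+ 2 / (4 * a) = pi ^+ 2 / a * n.+1%:R ^+ 2.
    by rewrite /w; field; rewrite gt_eqF.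
  by rewrite /w; ring.
have JN N : \int[mu]_(x in `[0, +oo[) (T2 N x * g2 x) =
   - (4 * pi ^+ 2 * gauss0 a * \sum_(0 <= n < N) expR (- (pi ^+ 2 / a * n.+1%:R ^+ 2))).
  have Ic n : mu.-integrable `[0, +oo[ (EFin \o (fun x => cos (2 * pi * n.+1%:R * x) * g2 x)).
    apply: pbd_rapid_int => //; [|exact: pbd_cos].
    by apply: cont_meas => //; exact: cont_cosw.
  rewrite (_ : (fun x => _) = (fun x => \sum_(0 <= n < N)
      n.+1%:R ^- 2 * (cos (2 * pi * n.+1%:R * x) * g2 x))); last first.
    apply/funext => x; rewrite /T2 mulr_suml; apply: eq_bigr => n _; ring.
  rewrite Rint_sum//; last by move=> n _; exact: int_mul.
  rewrite mulr_sumr -sumrN; apply: eq_bigr => n _.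
  rewrite RintegralZl// termE; field.
  by rewrite addrC natr1 pnatr_eq0 gt_eqF.
have g00 : gauss0 a != 0.
  apply/eqP => h; have := gauss0_sqr a0; rewrite h mulr0 expr0n /= => /esym/eqP.
  by rewrite mulf_eq0 invr_eq0 !gt_eqF.
pose c := limn (T2 ^~ (1 / 2 : R)).
(* Two integrations by parts on [m, m+1]: at both ends the polynomial has the value c + pi^2 / 4,
   and its slopes there are - pi^2 and pi^2, which makes the values of g add up. *)
have pieceE (m : nat) : \int[mu]_(x in `[m%:R, m.+1%:R]) (T x * g2 x) =
   (c + pi ^+ 2 / 4) * (g1 m.+1%:R - g1 m%:R) - pi ^+ 2 * (g m%:R + g m.+1%:R)
   + 2 * pi ^+ 2 * \int[mu]_(x in `[m%:R, m.+1%:R]) g x.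
  have sub : `[m%:R, m.+1%:R]%classic `<=` (`[0, +oo[%classic : set R).
    move=> x /=; rewrite !in_itv /= andbT => /andP[h _]; apply: le_trans h.
    exact: ler0n.
  pose h (x : R) := (c + pi ^+ 2 * (x - m%:R - 1 / 2) ^+ 2) * g2 x.
  have ch : continuous h.
    apply: cont_mul; last exact: rg2.1.
    by apply: (@der_cont _ _ (fun x => 2 * pi ^+ 2 * (x - m%:R - 1 / 2))) => x; der_eq; ring.
  (* T is known to be the polynomial only inside the interval, so its end points are dropped
     first. *)
  rewrite Rint_open; last by apply: integrableS I1.
  rewrite (@eq_Rintegral _ _ _ mu _ h); last first.
    move=> x; rewrite inE /= in_itv /= => /andP[mx xm]; rewrite /h /T; congr (_ * _).
    apply: cvg_lim => //.
    rewrite (_ : T2 ^~ x = T2 ^~ (x - m%:R)); last first.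
      by apply/funext => N; rewrite -(T2_periodic N (x - m%:R) m) subrK.
    apply: fourier_B2; apply/andP; split; first lra.
    by move: xm; rewrite natSr; lra.
  rewrite -Rint_open; last exact: int_itv_cont.
  pose F1 (x : R) := (c + pi ^+ 2 * (x - m%:R - 1 / 2) ^+ 2) * g1 x
    - 2 * pi ^+ 2 * (x - m%:R - 1 / 2) * g x.
  have dF1 (x : R) : is_derive x (1 : R) F1 (h x - 2 * pi ^+ 2 * g x).
    have := dg x; have := dg1 x => h1 h2.
    by rewrite /F1; der_eq; rewrite /h /g1; ring.
  have cg : continuous g by exact: (der_cont dg).
  have cF' : continuous (fun x => h x - 2 * pi ^+ 2 * g x).
    by apply: cont_add => //; apply: cont_opp; apply: cont_mul => //; exact: cont_cst.
  have mm : m%:R <= m.+1%:R :> R by rewrite ler_nat.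
  have := FTC_bounded mm dF1 cF'.
  rewrite RintegralB//; [|exact: int_itv_cont|].
    rewrite RintegralZl//; last exact: int_itv_cont.
    move=> /eqP; rewrite subr_eq => /eqP ->; rewrite /F1 natSr; by field.
  by apply: int_mul => //; exact: int_itv_cont.
(* As in the trapezoidal rule, interior integers are met twice and the end points 0 and M once; this
   is [theta a M] minus g(M). *)
have sumE (M : nat) : \int[mu]_(x in `[0, M%:R]) (T x * g2 x) =
   (c + pi ^+ 2 / 4) * g1 M%:R - pi ^+ 2 * (theta a M - g M%:R)
   + 2 * pi ^+ 2 * \int[mu]_(x in `[0, M%:R]) g x.
  elim: M => [|M IH].
    rewrite set_itv1 !Rintegral_set1 /theta big_geq// /g1 /g /gauss !mulr0 addr0 expr0n /=.
    by rewrite !(mulr0, oppr0, expR0, mul0r, addr0, subrr).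
  have M0 : 0 <= M%:R :> R by [].
  have MM : M%:R <= M.+1%:R :> R by rewrite ler_nat.
  have cg : continuous g by exact: (der_cont dg).
  rewrite (Rint_split M0 MM); last first.
    apply: integrableS I1 => // x /=; rewrite !in_itv /= andbT => /andP[]//.
  rewrite [\int[mu]_(x in `[0, M.+1%:R]) g x](Rint_split M0 MM); last exact: int_itv_cont.
  rewrite IH pieceE; have -> : theta a M.+1 = theta a M + 2 * g M.+1%:R.
    by rewrite /theta big_nat_recr//= mulrDr addrA.
  by ring.
have gcvg (psi : R -> R) : rapid psi -> psi n%:R @[n --> \oo] --> (0 : R).
  move=> rp; have := pbd_rapid_cvg0 (pbd_cst 1) rp => /cvg_pinftyP/(_ _ cvgr_idn).
  by under eq_cvg do rewrite mul1r.
have piN : pi != 0 :> R by rewrite gt_eqF.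
(* [e1] and [e3] solve the two evaluations for the theta sums and [e2] matches their limits; the
   analytic quantities are abstracted into variables for [field]. *)
have e1 (p q S : R) : p != 0 -> q != 0 ->
    1 + 2 * S = 1 - (- (4 * p ^+ 2 * q * S)) / (2 * p ^+ 2 * q).
  by move=> p0 G0; field; rewrite p0 G0.
have e2 (p q j d : R) : p != 0 -> q != 0 -> 2 * q * (1 - j / (2 * p ^+ 2 * q)) =
    0 + ((d + p ^+ 2 / 4) * 0 + 2 * p ^+ 2 * q - j) / p ^+ 2.
  by move=> p0 G0; field; rewrite p0 G0.
have e3 (p t G G1 u d : R) : p != 0 -> t = G + ((d + p ^+ 2 / 4) * G1 + 2 * p ^+ 2 * u -
    ((d + p ^+ 2 / 4) * G1 - p ^+ 2 * (t - G) + 2 * p ^+ 2 * u)) / p ^+ 2.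
  by move=> p0; field.
exists (1 - J / (2 * pi ^+ 2 * gauss0 a)); split.
  rewrite (_ : theta _ = (fun N => 1 - (\int[mu]_(x in `[0, +oo[) (T2 N x * g2 x))
      / (2 * pi ^+ 2 * gauss0 a))); last first.
    by apply/funext => N; rewrite JN /theta; exact: e1.
  by apply: cvgB; [exact: cvg_cst|apply: cvgM => //; exact: cvg_cst].
rewrite (@e2 pi (gauss0 a) J c piN g00).
rewrite (_ : theta _ = (fun M => g M%:R + ((c + pi ^+ 2 / 4) * g1 M%:R
  + 2 * pi ^+ 2 * \int[mu]_(x in `[0, M%:R]) g x
  - \int[mu]_(x in `[0, M%:R]) (T x * g2 x)) / pi ^+ 2)); last first.
  by apply/funext => M; rewrite sumE; exact: e3.
apply: cvgD; first exact: gcvg.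
apply: cvgM; last exact: cvg_cst.
apply: cvgB.
  apply: cvgD; (apply: cvgM; first exact: cvg_cst); first exact: gcvg.
  have := Rint_itvy_cvg (rapid_int mI rg).
  by under eq_cvg do rewrite add0r.
have := Rint_itvy_cvg I1.
by under eq_cvg do rewrite add0r.
Qed.

End Theta.

(** * Lattice points in Z^3 *)

Section LatticeCount.
Local Open Scope nat_scope.

Definition sq3 (v : 'rV[int]_3) : nat := \sum_(i < 3) `|v 0%R i| ^ 2.

Lemma sqnorm3E v : sqnorm3 v = (sq3 v)%:Z.
Proof.
rewrite /sqnorm3 /sq3 (big_morph Posz PoszD (erefl _)).
by apply: eq_bigr => i _; rewrite -abszX gez0_abs ?sqr_ge0.
Qed.

(** The cube [-M, M]^3 as an injective image of a finite function type: sums over it are big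
    operators, and those of products factor over the coordinates. *)
Definition boxv (M : nat) (f : {ffun 'I_3 -> 'I_(M.*2.+1)}) : 'rV[int]_3 :=
  (\row_i ((f i : nat)%:Z - M%:Z))%R.
Arguments boxv : clear implicits.

Lemma boxv_inj M : injective (boxv M).
Proof.
move=> f g /rowP h; apply/ffunP => i; apply/val_inj.
by have := h i; rewrite !mxE /=; lia.
Qed.

Lemma boxv_surj M (v : 'rV[int]_3) : (forall i, `|v 0%R i| <= M) ->
  exists f, boxv M f = v.
Proof.
move=> h; exists [ffun i => inord `|(v 0%R i + M%:Z)%R|].
apply/rowP => i; rewrite mxE ffunE; have := h i.
by move=> h'; rewrite inordK; [lia|rewrite -addnn; lia].
Qed.

Lemma sq3_coord (v : 'rV[int]_3) i : `|v 0%R i| ^ 2 <= sq3 v.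
Proof. by rewrite /sq3 (bigD1 i)//= leq_addr. Qed.

Lemma boxv_le M f i : `|boxv M f 0%R i| <= M.
Proof. by rewrite mxE; have := ltn_ord (f i); lia. Qed.

Lemma boxv_sq3 M f : sq3 (boxv M f) <= 3 * M ^ 2.
Proof.
rewrite -[X in X * _]card_ord -sum_nat_const; apply: leq_sum => i _.
by rewrite leq_exp2r// boxv_le.
Qed.

(** If |v|^2 < (M+1)^2, every coordinate is at most M in absolute value, so the cube contains all
    the lattice points that P selects. *)
Lemma boxv_imset (P : pred nat) M : (forall n, P n -> n < M.+1 ^ 2) ->
  [set v | P (sq3 v)] = [set` [fset boxv M f | f in [pred f | P (sq3 (boxv M f))]]%fset].
Proof.
move=> hP; apply/seteqP; split=> v /=.
  move=> Pv; have [|f fv] := @boxv_surj M v.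
    move=> i; have := hP _ Pv; have := sq3_coord v i.
    move=> h1 h2; have := leq_ltn_trans h1 h2; rewrite ltn_exp2r//.
  by rewrite -fv in Pv *; apply/imfsetP; exists f.
by move=> /imfsetP[f /=]; rewrite ?inE => Pf ->.
Qed.

Lemma finite_sq3 (P : pred nat) M : (forall n, P n -> n < M.+1 ^ 2) ->
  finite_set [set v | P (sq3 v)].
Proof. by move=> /boxv_imset ->; exact: finite_fset. Qed.

Lemma card_sq3 (P : pred nat) M : (forall n, P n -> n < M.+1 ^ 2) ->
  #|` fset_set [set v | P (sq3 v)]| = #|[pred f | P (sq3 (boxv M f))]|.
Proof.
move=> hP; rewrite (boxv_imset hP) set_fsetK card_imfset /=; last exact: boxv_inj.
by rewrite cardE.
Qed.

Lemma r3_set n : [set v | sqnorm3 v = n%:Z] = [set v | sq3 v == n].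
Proof.
by apply/seteqP; split=> v /=; rewrite sqnorm3E; [move=> [->]|move=> /eqP ->].
Qed.

Lemma r3_card M n : n < M.+1 ^ 2 -> r3 n = #|[pred f | sq3 (boxv M f) == n]|.
Proof.
by move=> nM; rewrite /r3 r3_set (@card_sq3 (pred1 n) M)// => m /eqP ->.
Qed.

Lemma r3_ge M (n : nat) : #|[pred f | sq3 (boxv M f) == n]| <= r3 n.
Proof.
have -> : #|[pred f | sq3 (boxv M f) == n]| =
    #|` [fset boxv M f | f in [pred f | sq3 (boxv M f) == n]]%fset|.
  by rewrite card_imfset /= ?cardE//; exact: boxv_inj.
rewrite /r3 r3_set.
apply: fsubset_leq_card; apply/fsubsetP => v /imfsetP[f /=].
rewrite ?inE => fn ->; rewrite in_fset_set ?inE//.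
by apply: (@finite_sq3 (pred1 n) n) => m /eqP ->; rewrite expnS; lia.
Qed.

Local Open Scope ring_scope.
Context {R : realType}.

Definition boxsum (M : nat) (F : nat -> R) : R := \sum_f F (sq3 (boxv M f)).

Lemma boxsumE M K (F : nat -> R) : (3 * M ^ 2 < K)%N -> boxsum M F =
  \sum_(0 <= n < K) #|[pred f | sq3 (boxv M f) == n]|%:R * F n.
Proof.
move=> MK; rewrite big_mkord /boxsum.
have hf f : (sq3 (boxv M f) < K)%N by exact: leq_ltn_trans (boxv_sq3 f) MK.
rewrite (partition_big (fun f => Ordinal (hf f)) xpredT)//=.
apply: eq_bigr => n _; rewrite -sum1_card natr_sum mulr_suml.
rewrite [LHS](eq_bigl (fun f => f \in [pred f | sq3 (boxv M f) == n])); last first.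
  by move=> f; rewrite inE -val_eqE.
apply: eq_bigr => f; rewrite inE => /eqP ->; by rewrite mul1r.
Qed.

(** Together with [boxsum_ge] this compares summation by cubes with summation by spheres: the cube
    lies in the ball |v|^2 <= 3 M^2 and contains the ball |v|^2 < (M+1)^2. *)
Lemma boxsum_le M K (F : nat -> R) : (forall n, 0 <= F n) -> (3 * M ^ 2 < K)%N ->
  boxsum M F <= \sum_(0 <= n < K) (r3 n)%:R * F n.
Proof.
move=> F0 MK; rewrite (boxsumE F MK); apply: ler_sum => n _.
by rewrite ler_wpM2r// ler_nat r3_ge.
Qed.

Lemma boxsum_ge M K (F : nat -> R) : (forall n, 0 <= F n) -> (K <= M.+1 ^ 2)%N ->
  \sum_(0 <= n < K) (r3 n)%:R * F n <= boxsum M F.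
Proof.
move=> F0 KM; pose K' := (K + (3 * M ^ 2).+1)%N.
rewrite (@boxsumE M K'); last by rewrite /K'; lia.
rewrite (@big_cat_nat _ _ _ K 0 K')//= ?leq_addr//.
rewrite -[leLHS]addr0 lerD//; last by apply: sumr_ge0 => n _; rewrite mulr_ge0.
rewrite le_eqVlt; apply/orP; left; apply/eqP.
by rewrite !big_nat; apply: eq_bigr => n nK; rewrite (@r3_card M)//; exact: leq_trans nK KM.
Qed.

Lemma sum_box1 (h : nat -> R) M : \sum_(j < M.*2.+1) h `|(j : nat)%:Z - M%:Z|%N =
  h 0%N + 2 * \sum_(0 <= n < M) h n.+1.
Proof.
rewrite -(big_mkord xpredT (fun j => h `|j%:Z - M%:Z|%N)).
rewrite (@big_cat_nat _ _ _ M)//=; last by rewrite -addnn ltnW// ltnS leq_addr.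
rewrite [X in _ + X]big_ltn; last by rewrite -addnn ltnS leq_addr.
rewrite subrr absz0 addrCA mulrDl mul1r; congr (_ + (_ + _)).
  rewrite big_nat_rev /= add0n !big_nat; apply: eq_bigr => n nM; congr h; lia.
rewrite -{1}[M.+1]add0n big_addn (_ : _ - M.+1 = M)%N; last by lia.
by rewrite !big_nat; apply: eq_bigr => n nM; congr h; lia.
Qed.

Lemma sum_box3 M (W : nat -> R) : \sum_f \prod_(i < 3) W `|boxv M f 0%R i|%N =
  (W 0%N + 2 * \sum_(0 <= n < M) W n.+1) ^+ 3.
Proof.
rewrite -sum_box1.
transitivity (\prod_(i < 3) \sum_(j < M.*2.+1) W `|(j : nat)%:Z - M%:Z|%N); last first.
  by rewrite prodr_const card_ord.
rewrite bigA_distr_bigA /=; apply: eq_bigr => f _; apply: eq_bigr => i _.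
by rewrite mxE.
Qed.

(** The Gaussian is a product over the coordinates, so its sum over a cube is exactly the third
    power of a partial theta sum. All terms are nonnegative, hence the two comparisons of cubes with
    balls squeeze the spherical sums to the same limit. *)
Lemma r3_gauss_cvg (a l : R) : 0 < a ->
  (1 + 2 * \sum_(0 <= n < N) expR (- (a * n.+1%:R ^+ 2))) @[N --> \oo] --> l ->
  \sum_(0 <= n < N) (r3 n)%:R * expR (- (a * n%:R)) @[N --> \oo] --> l ^+ 3.
Proof.
move=> a0; set th := (fun N => _) => thl.
pose F n : R := expR (- (a * n%:R)); have F0 n : 0 <= F n by exact: expR_ge0.
have boxE M : boxsum M F = th M ^+ 3.
  have := sum_box3 M (fun n => expR (- (a * n%:R ^+ 2))).
  rewrite expr0n /= mulr0 oppr0 expR0 -/(th M) => <-; apply: eq_bigr => f _.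
  rewrite /F -expR_sum; congr expR.
  rewrite /sq3 natr_sum mulr_sumr -sumrN; apply: eq_bigr => i _.
  by rewrite natrX.
have th_ge0 N : 0 <= th N by rewrite /th addr_ge0// mulr_ge0// sumr_ge0.
have th_nd : {homo th : n m / (n <= m)%N >-> n <= m}.
  move=> n m nm; rewrite /th lerD2l ler_wpM2l// (@big_cat_nat _ _ _ n 0 m)//=.
  by rewrite lerDl sumr_ge0.
have thl_le N : th N <= l.
  by rewrite -(cvg_lim (@Rhausdorff R) thl); apply: nondecreasing_cvgn_le => //; apply/cvg_ex; exists l.
pose A N := \sum_(0 <= n < N) (r3 n)%:R * F n.
have A_nd : {homo A : n m / (n <= m)%N >-> n <= m}.
  move=> n m nm; rewrite /A (@big_cat_nat _ _ _ n 0 m)//= lerDl sumr_ge0// => i _.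
  by rewrite mulr_ge0.
have A_le N : A N <= l ^+ 3.
  apply: (@le_trans _ _ (boxsum N F)).
    by apply: boxsum_ge => //; rewrite expnS; lia.
  rewrite boxE lerXn2r ?nnegrE//.
  exact: le_trans (thl_le 0%N).
have cA : cvgn A.
  by apply: nondecreasing_is_cvgn => //; exists (l ^+ 3) => _ [N _ <-].
suff -> : l ^+ 3 = limn A by [].
apply/eqP; rewrite eq_le; apply/andP; split; last first.
  by apply: limr_le => //; exact: nearW.
have cth3 : th N ^+ 3 @[N --> \oo] --> l ^+ 3.
  by rewrite !exprS expr0 mulr1; under eq_cvg do rewrite !exprS expr0 mulr1;
     apply: cvgM => //; apply: cvgM.
rewrite -(cvg_lim (@Rhausdorff R) cth3); apply: limr_le; first by apply/cvg_ex; exists (l ^+ 3).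
apply: nearW => M; rewrite -boxE.
apply: (le_trans (boxsum_le (K := (3 * M ^ 2).+1) F0 _)) => //.
exact: nondecreasing_cvgn_le.
Qed.

Lemma cbrt_exists (n : nat) : exists u : R, [/\ 1 <= u & u ^+ 3 = n.+1%:R].
Proof.
have e : (n.+1%:R `^ 3^-1 : R) ^+ 3 = n.+1%:R.
  by rewrite -powR_mulrn ?powR_ge0// -powRrM mulVf// powRr1.
exists (n.+1%:R `^ 3^-1); split=> //.
by rewrite -(@ler_pXn2r _ 3)// ?nnegrE ?powR_ge0// expr1n e ler1n.
Qed.

(** With these roots the weights (n+1)^(-4/3) become the integral powers [cbrt n ^- 4], and
    inequalities between them are polynomial. *)
Definition cbrt (n : nat) : R := projT1 (cid (cbrt_exists n)).

Lemma cbrt_ge1 n : 1 <= cbrt n.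
Proof. by rewrite /cbrt; case: cid => u []. Qed.

Lemma cbrtX n : cbrt n ^+ 3 = n.+1%:R.
Proof. by rewrite /cbrt; case: cid => u []. Qed.

(* With u^3 - t^3 = 1 and t <= u, the difference 1/t - 1/u is at least 1/(3 u^4). *)
Lemma sum_cbrt M : \sum_(0 <= n < M) cbrt n.+1 ^- 4 <= 3.
Proof.
suff h : \sum_(0 <= n < M) cbrt n.+1 ^- 4 <= 3 * ((cbrt 0)^-1 - (cbrt M)^-1).
  apply: (le_trans h); have c0 := cbrt_ge1 0; have cM := cbrt_ge1 M.
  have h1 : (cbrt 0)^-1 <= 1 by rewrite invf_le1// (lt_le_trans ltr01).
  have h2 : 0 <= (cbrt M)^-1 by rewrite invr_ge0 (le_trans ler01).
  by lra.
elim: M => [|M IH]; first by rewrite big_geq// subrr mulr0.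
rewrite big_nat_recr//=; apply: (le_trans (lerD IH (lexx _))).
have := cbrt_ge1 M; have := cbrt_ge1 M.+1; have := cbrtX M; have := cbrtX M.+1.
set t := cbrt M; set u := cbrt M.+1; rewrite natSr => u3 t3 u1 t1.
have u0 : 0 < u by exact: lt_le_trans u1.
have t0 : 0 < t by exact: lt_le_trans t1.
have tu : t <= u.
  by rewrite -(@ler_pXn2r _ 3)// ?nnegrE ?(ltW t0) ?(ltW u0)// u3 t3 lerDl.
have q0 : 0 < u ^+ 2 + u * t + t ^+ 2 by rewrite !addr_gt0 ?exprn_gt0// mulr_gt0.
have e : t^-1 - u^-1 = (t * u * (u ^+ 2 + u * t + t ^+ 2))^-1.
  have d1 : (u - t) * (u ^+ 2 + u * t + t ^+ 2) = 1.
    by rewrite (_ : _ * _ = u ^+ 3 - t ^+ 3); [rewrite u3 t3; ring|ring].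
  apply/eqP; rewrite -subr_eq0; apply/eqP.
  rewrite (_ : t^-1 - u^-1 - _ = ((u - t) * (u ^+ 2 + u * t + t ^+ 2) - 1)
    / (t * u * (u ^+ 2 + u * t + t ^+ 2))); first by rewrite d1 subrr mul0r.
  by field; rewrite !gt_eqF.
rewrite -subr_ge0 (_ : _ - _ = 3 * (t^-1 - u^-1) - u ^- 4); last by ring.
rewrite subr_ge0 e -ler_pdivrMl// -invfM lef_pV2 ?posrE ?mulr_gt0 ?exprn_gt0//.
have h : u ^+ 2 + u * t + t ^+ 2 <= 3 * u ^+ 2 by nra.
have h2 : t * u <= u * u by rewrite ler_wpM2r// ltW.
have tu0 : 0 <= t * u by rewrite mulr_ge0 ?ltW.
apply: (le_trans (ler_pM tu0 (ltW q0) h2 h)).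
by rewrite le_eqVlt; apply/orP; left; apply/eqP; ring.
Qed.

(** For v != 0 and q = |v|^2, each (|v_i| + 1)^2 is at most 4 q; the geometric mean of the three
    gives q^-2 <= 16 times the product of the (|v_i| + 1)^(-4/3). The exponent exceeds 1, so the sum
    over each coordinate converges: it is at most 1 + 2 * 3 = 7, and 343 = 7^3. *)
Lemma sum_r3_invsq_le K : \sum_(0 <= n < K) (r3 n.+1)%:R / n.+1%:R ^+ 2 <= 16 * 343 :> R.
Proof.
pose F (n : nat) : R := if n is 0 then 0 else n%:R ^- 2.
have F0 n : 0 <= F n by case: n => // n; rewrite invr_ge0 exprn_ge0.
pose W (n : nat) : R := cbrt n ^- 4.
have W0 n : 0 <= W n by rewrite invr_ge0 exprn_ge0// (le_trans ler01)// cbrt_ge1.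
pose F' (v : 'rV[int]_3) : R := \prod_(i < 3) W `|v 0%R i|%N.
have hF f : F (sq3 (boxv K f)) <= 16 * F' (boxv K f).
  set v := boxv K f; have [->|q0] := eqVneq (sq3 v) 0%N.
    by rewrite /= mulr_ge0// prodr_ge0.
  set q : R := (sq3 v)%:R; have qp : 0 < q by rewrite ltr0n lt0n.
  have -> : F (sq3 v) = q ^- 2 by rewrite /F /q; case: (sq3 v) q0.
  pose u (i : 'I_3) := cbrt `|v 0%R i|%N; have u1 i : 1 <= u i by exact: cbrt_ge1.
  have u0 i : 0 < u i by exact: lt_le_trans (u1 i).
  (* With c = |v_i|, (c + 1)^2 <= 4 q because c^2 <= q and 1 <= q. *)
  have u6 i : u i ^+ 6 <= 4 * q.
    rewrite (_ : 6 = 3 * 2)%N// exprM cbrtX -natrX /q -natrM ler_nat.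
    have := sq3_coord v i; move: (`|v 0%R i|%N) => c cq.
    have : (0 < sq3 v)%N by rewrite lt0n.
    nia.
  have P6 : (\prod_(i < 3) u i ^+ 2) ^+ 3 <= (4 * q) ^+ 3.
    have -> : (4 * q) ^+ 3 = \prod_(i < 3) (4 * q) by rewrite prodr_const card_ord.
    rewrite -prodrXl.
    by apply: ler_prod => i _; rewrite -exprM u6 andbT exprn_ge0// ltW.
  have P0 : 0 < \prod_(i < 3) u i ^+ 2 by apply: prodr_gt0 => i _; rewrite exprn_gt0.
  have P2 : \prod_(i < 3) u i ^+ 2 <= 4 * q.
    by rewrite -(@ler_pXn2r _ 3)// ?nnegrE ?(ltW P0)// mulr_ge0// ltW.
  have -> : F' v = (\prod_(i < 3) u i ^+ 2) ^- 2.
    rewrite /F' -prodrXl -prodfV; apply: eq_bigr => i _.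
    by rewrite /W -exprM.
  rewrite -ler_pdivrMl// -invfM lef_pV2 ?posrE ?mulr_gt0 ?exprn_gt0//.
  rewrite (_ : 16 * _ = (4 * q) ^+ 2); last by ring.
  by rewrite lerXn2r ?nnegrE ?(ltW P0)// mulr_ge0// ltW.
apply: (@le_trans _ _ (\sum_(0 <= n < K.+1) (r3 n)%:R * F n)).
  by rewrite [leRHS]big_nat_recl//= mulr0 add0r.
apply: (le_trans (boxsum_ge (M := K) F0 _)); first by rewrite expnS; lia.
apply: (@le_trans _ _ (16 * \sum_f F' (boxv K f))).
  by rewrite mulr_sumr; apply: ler_sum => f _; exact: hF.
rewrite ler_pM2l//.
rewrite sum_box3.
have -> : 343 = 7 ^+ 3 :> R by rewrite -natrX.
have s0 : 0 <= \sum_(0 <= n < K) W n.+1 by apply: sumr_ge0.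
have s3 := sum_cbrt K.
have W01 : W 0%N = 1.
  rewrite /W; suff -> : cbrt 0 = 1 by rewrite expr1n invr1.
  have c0 := cbrt_ge1 0; apply/eqP; rewrite eq_le c0 andbT.
  by rewrite -(@ler_pXn2r _ 3)// ?nnegrE ?(le_trans ler01)// cbrtX expr1n.
rewrite W01 lerXn2r ?nnegrE//; first by lra.
by move: s3; rewrite -/W; lra.
Qed.

End LatticeCount.

(** * Iterated counting functions as sums of truncated powers *)

Section Count.
Context {R : realType}.
Notation mu := (@lebesgue_measure R).

Definition ptrunc (k : nat) (r s : R) : R := (s - r) ^+ k / k`!%:R.

(** The k-fold primitive of the unit step at sqrt n. For k = 0 the jump point belongs to the step,
    as [N3] counts closed balls. *)
Definition etrunc (k n : nat) (s : R) : R :=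
  if Num.sqrt n%:R <= s then ptrunc k (Num.sqrt n%:R) s else 0.

Lemma etruncE k n : etrunc k n = ptrunc k (Num.sqrt n%:R) \_ `[Num.sqrt n%:R, +oo[.
Proof.
apply/funext => s; rewrite patchE /etrunc; case: ifPn => h.
  by rewrite mem_set//= in_itv /= h.
by rewrite memNset//= in_itv /= andbT; exact/negP.
Qed.

Lemma ptrunc_der k r (s : R) : is_derive s (1 : R) (ptrunc k.+1 r) (ptrunc k r s).
Proof.
have f0 : (k`!%:R : R) != 0 by rewrite pnatr_eq0 -lt0n fact_gt0.
have k0 : (k.+1%:R : R) != 0 by rewrite pnatr_eq0.
rewrite /ptrunc; der_eq; rewrite factS natrM.
move: (k`!%:R : R) f0 (k.+1%:R : R) k0 => A A0 B B0.
by field; rewrite A0 B0.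
Qed.

Lemma ptrunc_cont k r : continuous (ptrunc k r).
Proof.
apply: cont_mul; last exact: cont_cst.
by apply: (@der_cont _ _ (fun s => k%:R * (s - r) ^+ k.-1 * 1)) => s; der_eq; ring.
Qed.

Lemma ptrunc_pbd k r : pbd (ptrunc k r).
Proof.
apply: pbd_mul; last exact: pbd_cst.
apply: pbd_pow; apply: pbd_add; [exact: pbd_id|exact: pbd_cst].
Qed.

Lemma ptruncS0 k r : ptrunc k.+1 r r = 0.
Proof. by rewrite /ptrunc subrr expr0n mul0r. Qed.

Lemma etrunc_meas (D : set R) k n : measurable D -> measurable_fun D (etrunc k n).
Proof.
move=> mD; apply: measurable_funTS; rewrite etruncE.
apply/(measurable_restrictT _ (measurable_itv _)).
by apply: cont_meas => //; exact: ptrunc_cont.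
Qed.

Lemma itv_meas (i : interval R) : measurable ([set` i] : set R).
Proof. exact: measurable_itv. Qed.

Lemma etrunc_int k n (s : R) : 0 <= s ->
  mu.-integrable `[0, s] (EFin \o etrunc k n) /\
  \int[mu]_(x in `[0, s]) etrunc k n x = etrunc k.+1 n s.
Proof.
move=> s0; set r : R := Num.sqrt n%:R; have r0 : 0 <= r by exact: sqrtr_ge0.
split.
  apply: (int_le (itv_meas _) (etrunc_meas _ _ (itv_meas _)) (g := fun x => `|ptrunc k r x|)).
    by apply: int_itv_cont => x; apply: cvg_norm; exact: ptrunc_cont.
  by move=> x _; rewrite /etrunc; case: ifPn => // _; rewrite normr0.
rewrite etruncE -Rintegral_mkcondr.
have [rs|sr] := leP r s; last first.
  rewrite (_ : _ `&` _ = set0) ?Rintegral_set0 /etrunc ?leNgt ?sr//.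
  apply/seteqP; split=> // x [] /=; rewrite !in_itv /= andbT => /andP[_ xs] rx.
  by have := lt_le_trans sr (le_trans rx xs); rewrite ltxx.
rewrite (_ : _ `&` _ = `[r, s]%classic).
  rewrite (FTC_bounded rs (@ptrunc_der k r) (@ptrunc_cont k r)) ptruncS0 subr0.
  by rewrite /etrunc rs.
apply/seteqP; split=> x /=; rewrite !in_itv /= ?andbT.
  by move=> [/andP[_ ->] ->].
by move=> /andP[rx ->]; rewrite rx (le_trans r0 rx).
Qed.

Lemma etrunc_ge0 k n s : 0 <= etrunc k n s.
Proof.
rewrite /etrunc; case: ifPn => // h.
by rewrite mulr_ge0 ?invr_ge0// exprn_ge0// subr_ge0.
Qed.

Lemma etrunc_neg k n s : s < 0 -> etrunc k n s = 0.
Proof. by move=> s0; rewrite /etrunc leNgt (lt_le_trans s0)// sqrtr_ge0. Qed.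

Lemma sqrt_le (n : nat) (s : R) : Num.sqrt n%:R <= s -> n%:R <= s ^+ 2.
Proof.
move=> h; have s0 := le_trans (sqrtr_ge0 _) h.
by rewrite -[leLHS]sqr_sqrtr// lerXn2r ?nnegrE ?sqrtr_ge0.
Qed.

Lemma N3_sum (s : R) (K : nat) : s ^+ 2 < K%:R ->
  N3 s = \sum_(0 <= n < K) (r3 n)%:R * etrunc 0 n s.
Proof.
move=> sK; pose P n := Num.sqrt (n%:R : R) <= s.
pose F n : R := (P n)%:R.
have FE n : etrunc 0 n s = F n.
  by rewrite /etrunc /F /P /ptrunc expr0 divr1; case: ifP.
have PK n : P n -> (n < K)%N.
  by move=> /sqrt_le h; rewrite -(@ltr_nat R); exact: le_lt_trans sK.
have FK n : (K <= n)%N -> F n = 0.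
  by move=> Kn; rewrite /F; case: (boolP (P n)) => // /PK; rewrite ltnNge Kn.
have F0 n : 0 <= F n by [].
rewrite /N3 (_ : [set v | _] = [set v | P (sq3 v)]); last first.
  by apply/seteqP; split=> v /=; rewrite sqnorm3E /P.
rewrite (@card_sq3 P K); last by move=> n /PK nK; rewrite expnS; lia.
transitivity (boxsum K F).
  rewrite /boxsum -sum1_card natr_sum big_mkcond /=; apply: eq_bigr => f _.
  by rewrite /F inE; case: ifP.
rewrite (eq_bigr (fun n => (r3 n)%:R * F n)) => [|n _]; last by rewrite FE.
apply/eqP; rewrite eq_le; apply/andP; split; last first.
  by apply: boxsum_ge => //; rewrite expnS; lia.
pose K' := (K + (3 * K ^ 2).+1)%N.
apply: (le_trans (boxsum_le (K := K') F0 _)); first by rewrite /K'; lia.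
rewrite (@big_cat_nat _ _ _ K 0 K')//= ?leq_addr// [X in _ + X <= _](_ : _ = 0) ?addr0//.
by rewrite big_nat big1// => n /andP[Kn _]; rewrite FK// mulr0.
Qed.

Lemma N3k_neg k (s : R) : s < 0 -> N3k k s = 0.
Proof.
move=> s0; case: k => [|k] /=; last first.
  by rewrite set_itv_ge ?Rintegral_set0// bnd_simp -ltNge.
rewrite (@N3_sum s (Num.truncn (s ^+ 2)).+1); last exact: truncnS_gt.
by apply: big1 => n _; rewrite etrunc_neg// mulr0.
Qed.

(** A single K with s^2 < K serves for all points of [0, s], so the induction integrates only finite
    sums. *)
Lemma N3k_sum k (s : R) (K : nat) : s ^+ 2 < K%:R ->
  N3k k s = \sum_(0 <= n < K) (r3 n)%:R * etrunc k n s.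
Proof.
have [s0|s0] := ltP s 0.
  move=> _; rewrite N3k_neg// big1// => n _; by rewrite etrunc_neg// mulr0.
elim: k s s0 => [|k IH] s s0 sK; first exact: N3_sum.
rewrite /= (@eq_Rintegral _ _ _ mu _ (fun x => \sum_(0 <= n < K) (r3 n)%:R * etrunc k n x)).
  rewrite Rint_sum//; last by move=> n _; apply: int_mul => //; have [] := etrunc_int k n s0.
  by apply: eq_bigr => n _; have [h1 h2] := etrunc_int k n s0; rewrite RintegralZl// h2.
move=> x; rewrite inE /= in_itv /= => /andP[x0 xs]; apply: IH => //.
by apply: le_lt_trans sK; rewrite lerXn2r.
Qed.

Lemma N3k_cvg k (s : R) :
  \sum_(0 <= n < K) (r3 n)%:R * etrunc k n s @[K --> \oo] --> N3k k s.
Proof.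
apply: cvg_near_cst; near=> K; apply/esym/N3k_sum.
rewrite (lt_le_trans (truncnS_gt _))// ler_nat.
by near: K; exact: nbhs_infty_ge.
Unshelve. all: by end_near. Qed.

(** A majorant uniform in the number of terms: only n <= s^2 contribute, and for n >= 1 these
    satisfy 1 <= s^4 / n^2, so [sum_r3_invsq_le] bounds their number. The true order |s|^(3+k) is
    not sought; any polynomial growth suffices for dominated convergence. *)
Definition N3bound (k : nat) (s : R) : R :=
  `|s| ^+ k * ((r3 0)%:R + 16 * 343 * `|s| ^+ 4).

Lemma etrunc_le k n (s : R) : etrunc k n s <= if Num.sqrt n%:R <= s then `|s| ^+ k else 0.
Proof.
rewrite /etrunc; case: ifPn => [h|//].
have s0 := le_trans (sqrtr_ge0 _) h.
rewrite /ptrunc ler_pdivrMr ?ltr0n ?fact_gt0//.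
apply: (@le_trans _ _ (`|s| ^+ k)).
  by rewrite lerXn2r ?nnegrE ?subr_ge0// ger0_norm// gerBl sqrtr_ge0.
by rewrite ler_peMr ?exprn_ge0// ler1n fact_gt0.
Qed.

Lemma N3k_partial_le k K (s : R) :
  `|\sum_(0 <= n < K) (r3 n)%:R * etrunc k n s| <= N3bound k s.
Proof.
rewrite ger0_norm; last by apply: sumr_ge0 => n _; rewrite mulr_ge0// etrunc_ge0.
have [->|K0] := posnP K.
  by rewrite big_geq// /N3bound mulr_ge0 ?addr_ge0 ?mulr_ge0 ?exprn_ge0.
rewrite -(prednK K0) big_nat_recl//= /N3bound mulrDr; apply: lerD.
  rewrite mulrC; apply: ler_wpM2r => //; apply: (le_trans (etrunc_le _ _ _)).
  by case: ifP => // _; rewrite exprn_ge0.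
apply: (@le_trans _ _ (\sum_(0 <= n < K.-1)
    `|s| ^+ k * `|s| ^+ 4 * ((r3 n.+1)%:R / n.+1%:R ^+ 2))).
  apply: ler_sum => n _; rewrite mulrCA ler_wpM2l//.
  apply: (le_trans (etrunc_le _ _ _)).
  case: ifP => h; last by rewrite !mulr_ge0 ?invr_ge0 ?exprn_ge0.
  rewrite -[leLHS]mulr1 -mulrA ler_wpM2l ?exprn_ge0//.
  rewrite ler_pdivlMr ?exprn_gt0// mul1r (_ : 4 = 2 * 2)%N// exprM.
  by rewrite lerXn2r ?nnegrE ?exprn_ge0// real_normK ?num_real// sqrt_le.
rewrite -mulr_sumr -mulrA ler_wpM2l ?exprn_ge0// mulrC.
by rewrite ler_wpM2r ?exprn_ge0// sum_r3_invsq_le.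
Qed.

Lemma norm_cont : continuous (fun s : R => `|s|).
Proof. by move=> x; apply: cvg_norm; exact: cvg_id. Qed.

Lemma cont_pow (f : R -> R) n : continuous f -> continuous (fun x => f x ^+ n).
Proof.
move=> cf; elim: n => [|n IH]; first exact: cont_cst.
rewrite (_ : (fun x => _) = fun x => f x * f x ^+ n); first exact: cont_mul.
by apply/funext => x; rewrite exprS.
Qed.

Lemma N3bound_cont k : continuous (N3bound k).
Proof.
apply: cont_mul; first by apply: cont_pow; exact: norm_cont.
apply: cont_add; first exact: cont_cst.
by apply: cont_mul; [exact: cont_cst|apply: cont_pow; exact: norm_cont].
Qed.

Lemma pbd_norm : pbd (fun s : R => `|s|).
Proof. by apply: (pbd_le pbd_id) => x; rewrite normr_id. Qed.

Lemma N3bound_pbd k : pbd (N3bound k).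
Proof.
apply: pbd_mul; first by apply: pbd_pow; exact: pbd_norm.
apply: pbd_add; first exact: pbd_cst.
by apply: pbd_mul; [exact: pbd_cst|apply: pbd_pow; exact: pbd_norm].
Qed.

Lemma N3k_le k (s : R) : `|N3k k s| <= N3bound k s.
Proof.
have sK : s ^+ 2 < (Num.truncn (s ^+ 2)).+1%:R by exact: truncnS_gt.
by rewrite (N3k_sum k sK) N3k_partial_le.
Qed.

Lemma N3bound_ge0 k s : 0 <= N3bound k s.
Proof. by rewrite (le_trans _ (N3k_le k s)). Qed.

Lemma N3k_pbd k : pbd (@N3k R k).
Proof.
apply: (pbd_le (N3bound_pbd k)) => x.
by rewrite [leRHS]ger0_norm ?N3bound_ge0 ?N3k_le.
Qed.

Lemma psum_meas (D : set R) k K : measurable D ->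
  measurable_fun D (fun s : R => \sum_(0 <= n < K) (r3 n)%:R * etrunc k n s).
Proof.
move=> mD; elim: K => [|K IH].
  rewrite (_ : (fun s => _) = cst 0); first exact: measurable_cst.
  by apply/funext => s; rewrite big_geq.
rewrite (_ : (fun s => _) = (fun s => (\sum_(0 <= n < K) (r3 n)%:R * etrunc k n s)
  + (r3 K)%:R * etrunc k K s)); last by apply/funext => s; rewrite big_nat_recr.
apply: measurable_funD => //; apply: measurable_funM; first exact: measurable_cst.
exact: etrunc_meas.
Qed.

Lemma N3k_meas (D : set R) k : measurable D -> measurable_fun D (@N3k R k).
Proof.
move=> mD; apply: (measurable_fun_cvg (fun K => psum_meas k K mD)) => x _.
exact: N3k_cvg.
Qed.

Lemma etrunc_test k n (psi : R -> R) : rapid psi ->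
  \int[mu]_(x in `[0, +oo[) (etrunc k n x * psi x) =
  \int[mu]_(x in `[Num.sqrt n%:R, +oo[) (ptrunc k (Num.sqrt n%:R) x * psi x).
Proof.
move=> rp; set r : R := Num.sqrt n%:R; have r0 : 0 <= r by exact: sqrtr_ge0.
rewrite (_ : (fun x => _) = (fun x => ptrunc k r x * psi x) \_ `[r, +oo[); last first.
  by apply/funext => x; rewrite etruncE !patchE; case: ifP => //; rewrite mul0r.
rewrite -Rintegral_mkcondr; congr (Rintegral _ _ _).
apply/seteqP; split=> x /=; rewrite !in_itv /= !andbT; first by case.
by move=> rx; rewrite rx (le_trans r0 rx).
Qed.

Lemma etrunc_test_int k n psi : rapid psi ->
  mu.-integrable `[0, +oo[ (EFin \o (fun x => etrunc k n x * psi x)).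
Proof.
move=> rp; apply: pbd_rapid_int => //; first exact: etrunc_meas.
apply: (pbd_le (ptrunc_pbd k (Num.sqrt n%:R))) => x.
by rewrite /etrunc; case: ifP => // _; rewrite normr0.
Qed.

Lemma ptrunc_IBP k (r : R) (psi psi' : R -> R) : (forall x, is_derive x (1 : R) psi (psi' x)) ->
  rapid psi -> rapid psi' ->
  \int[mu]_(x in `[r, +oo[) (ptrunc k r x * psi x) =
  - \int[mu]_(x in `[r, +oo[) (ptrunc k.+1 r x * psi' x).
Proof.
move=> dpsi rp rp'.
have := @IBP_itvy _ (ptrunc k.+1 r) (ptrunc k r) psi psi' r (@ptrunc_der k r)
  (@ptrunc_cont k r) (@ptrunc_pbd _ _) (@ptrunc_pbd _ _) dpsi rp rp'.
by rewrite ptruncS0 mul0r oppr0 add0r.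
Qed.

Lemma N3k_test_cvg k (psi : R -> R) : rapid psi ->
  \sum_(0 <= n < K) (r3 n)%:R * \int[mu]_(x in `[0, +oo[) (etrunc k n x * psi x)
    @[K --> \oo] --> \int[mu]_(x in `[0, +oo[) (N3k k x * psi x).
Proof.
move=> rp; have mI := @itv0y_meas R.
have [||||_] := @Rdominated R `[0, +oo[
  (fun K x => (\sum_(0 <= n < K) (r3 n)%:R * etrunc k n x) * psi x)
  (fun x => N3k k x * psi x) (fun x => `|N3bound k x * psi x|) mI.
- move=> K; apply: measurable_funM; first exact: psum_meas.
  by apply: cont_meas => //; case: rp.
- by move=> x _; apply: cvgM; [exact: N3k_cvg|exact: cvg_cst].
- apply: (integrable_norm (pbd_rapid_int mI _ (N3bound_pbd k) rp)).
  by apply: cont_meas => //; exact: N3bound_cont.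
- move=> K x _; rewrite normrM [leRHS]normrM ler_wpM2r//.
  by rewrite (le_trans (N3k_partial_le _ _ _))// ler_norm.
apply: cvg_trans; apply: near_eq_cvg; apply: nearW => K.
transitivity (\int[mu]_(x in `[0, +oo[)
    (\sum_(0 <= n < K) (r3 n)%:R * (etrunc k n x * psi x))).
  by apply: eq_Rintegral => x _; rewrite mulr_suml; apply: eq_bigr => n _; rewrite mulrA.
rewrite Rint_sum//.
  by apply: eq_bigr => n _; rewrite RintegralZl//; exact: etrunc_test_int.
by move=> n _; apply: int_mul => //; exact: etrunc_test_int.
Qed.

(* Differentiating N3k (k+1) in the sense of distributions gives N3k k, also for the
   jump function N3k 0, because this holds for every truncated power. *)
Lemma N3k_IBP k (psi psi' : R -> R) : (forall x, is_derive x (1 : R) psi (psi' x)) ->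
  rapid psi -> rapid psi' ->
  \int[mu]_(x in `[0, +oo[) (N3k k x * psi x) =
  - \int[mu]_(x in `[0, +oo[) (N3k k.+1 x * psi' x).
Proof.
move=> dpsi rp rp'; have h1 := N3k_test_cvg (k := k) rp.
have h2 : (fun K : nat => - \sum_(0 <= n < K) (r3 n)%:R *
    \int[mu]_(x in `[0, +oo[) (etrunc k.+1 n x * psi' x)) @ \oo -->
    - \int[mu]_(x in `[0, +oo[) (N3k k.+1 x * psi' x).
  by apply: cvgN; exact: N3k_test_cvg.
move: h1; rewrite (_ : (fun K : nat => _) = (fun K : nat => - \sum_(0 <= n < K) (r3 n)%:R *
    \int[mu]_(x in `[0, +oo[) (etrunc k.+1 n x * psi' x))) => [h1|].
  exact: (cvg_unique (@Rhausdorff R) h1 h2).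
apply/funext => K; rewrite -sumrN; apply: eq_bigr => n _.
by rewrite !etrunc_test// (ptrunc_IBP k _ dpsi rp rp') mulrN.
Qed.

End Count.

(** * Dominated series of functions *)

Section Series.
Context {R : realType}.

Lemma cont_sum n (f : nat -> R -> R) : (forall i, continuous (f i)) ->
  continuous (fun s => \sum_(0 <= i < n) f i s).
Proof.
move=> cf; elim: n => [|n IH].
  rewrite (_ : (fun s => _) = cst 0); first exact: cont_cst.
  by apply/funext => s; rewrite big_geq.
rewrite (_ : (fun s => _) = (fun s => \sum_(0 <= i < n) f i s + f n s)).
  by apply: cont_add => //; exact: cf.
by apply/funext => s; rewrite big_nat_recr.
Qed.

Implicit Types (f M : nat -> R).

Lemma cvg_dominated f M : (forall n, `|f n| <= M n) -> cvgn (series M) ->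
  cvgn [normed series f].
Proof.
move=> fM cM; apply: (series_le_cvg _ _ fM cM) => n; first exact: normr_ge0.
exact: le_trans (fM n).
Qed.

(** The M-test with an explicit tail. The tail of M does not depend on the parameter of f, which is
    what gives continuity, uniform convergence and, later, uniformity on bounded sets of test
    functions. *)
Lemma series_tail f M N : (forall n, `|f n| <= M n) -> cvgn (series M) ->
  `|limn (series f) - series f N| <= limn (series M) - series M N.
Proof.
move=> fM cM; have cf := normed_cvg (cvg_dominated fM cM).
have c1 : `|series f N' - series f N| @[N' --> \oo] --> `|limn (series f) - series f N|.
  by apply: cvg_norm; apply: cvgB; [exact: cf|exact: cvg_cst].
have c2 : series M N' - series M N @[N' --> \oo] --> limn (series M) - series M N.
  by apply: cvgB; [exact: cM|exact: cvg_cst].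
rewrite -(cvg_lim (@Rhausdorff R) c1) -(cvg_lim (@Rhausdorff R) c2).
apply: ler_lim; [by apply/cvg_ex; eexists; exact: c1|by apply/cvg_ex; eexists; exact: c2|].
near=> N'.
have NN' : (N <= N')%N by near: N'; exact: nbhs_infty_ge.
rewrite !sub_series_geq//; apply: (le_trans (ler_norm_sum _ _ _)).
by apply: ler_sum => n _; exact: fM.
Unshelve. all: by end_near. Qed.

Lemma lim_series_norm_le f M : (forall n, `|f n| <= M n) -> cvgn (series M) ->
  `|limn (series f)| <= limn (series M).
Proof.
move=> fM cM; have := series_tail 0 fM cM.
by rewrite /series /= !big_geq// !subr0.
Qed.

Lemma series_tail_small M (e : R) : cvgn (series M) -> 0 < e ->
  \forall N \near \oo, limn (series M) - series M N < e.
Proof.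
move=> cM e0; move/cvgrPdist_lt : cM => /(_ _ e0); apply: filterS => N.
by apply: le_lt_trans; rewrite ler_norm.
Qed.

(** The majorant is asked only for |s| < B because the terms of the remainder grow linearly in s. *)
Lemma weierstrass_cont (f : nat -> R -> R) M (B x : R) :
  (forall n, continuous (f n)) -> (forall n s, `|s| < B -> `|f n s| <= M n) ->
  cvgn (series M) -> `|x| < B ->
  {for x, continuous (fun s => limn (series (f ^~ s)))}.
Proof.
move=> cf fM cM xB; apply/cvgrPdist_lt => e e0.
have e3 : 0 < e / 3 by rewrite divr_gt0.
have [N _ /(_ N (leqnn N)) hN] := series_tail_small cM e3.
have cS : continuous (fun s => series (f ^~ s) N).
  exact: cont_sum.
have := cS x; move/cvgrPdist_lt => /(_ _ e3) => h.
have nB : \forall y \near nbhs x, `|y| < B.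
  apply: open_nbhs_nbhs; split=> //.
  apply: (@open_comp _ _ (fun y : R => `|y|) [set z | z < B]); last exact: open_lt.
  by move=> ? _; exact: norm_cont.
near=> y; have yB : `|y| < B by near: y; exact: nB.
have t1 := series_tail N (fun n => fM n x xB) cM.
have t2 := series_tail N (fun n => fM n y yB) cM.
have t3 : `|series (f ^~ x) N - series (f ^~ y) N| < e / 3 by near: y; exact: h.
rewrite (_ : _ - _ = (limn (series (f ^~ x)) - series (f ^~ x) N)
  + (series (f ^~ x) N - series (f ^~ y) N)
  - (limn (series (f ^~ y)) - series (f ^~ y) N)); last by ring.
apply: (le_lt_trans (ler_normB _ _)).
apply: (le_lt_trans (lerD (ler_normD _ _) (lexx _))).
by lra.
Unshelve. all: by end_near. Qed.

Lemma weierstrass_unif (f : nat -> R -> R) M (K : set R) :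
  (forall n s, K s -> `|f n s| <= M n) -> cvgn (series M) ->
  {uniform K, (fun N s => \sum_(0 <= n < N) f n s) @ \oo -->
    (fun s => limn (series (f ^~ s)))}.
Proof.
move=> fM cM P /uniform_nbhs[E [entE hE]].
move: entE; rewrite -entourage_ballE => -[e /= e0 eE].
have := series_tail_small cM e0; apply: filterS => N hN.
apply: hE => s Ks; apply: eE => /=; rewrite /ball /=.
exact: le_lt_trans (series_tail N (fun n => fM n s Ks) cM) hN.
Qed.

End Series.

(** * The oscillating terms and the constants C_k *)

Section Oterm.
Context {R : realType}.
Notation mu := (@lebesgue_measure R).

Definition cre (k : nat) : R := complex.Re (Complex 0 1 ^+ k : R[i]).
Definition cim (k : nat) : R := complex.Im (Complex 0 1 ^+ k : R[i]).

Lemma cre0 : cre 0 = 1. Proof. by rewrite /cre expr0. Qed.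
Lemma cim0 : cim 0 = 0. Proof. by rewrite /cim expr0. Qed.

Lemma creS k : cre k.+1 = - cim k.
Proof.
rewrite /cre /cim exprS; case: (_ ^+ k) => a b /=.
by rewrite mul0r sub0r mul1r.
Qed.

Lemma cimS k : cim k.+1 = cre k.
Proof.
rewrite /cre /cim exprS; case: (_ ^+ k) => a b /=.
by rewrite mul0r add0r mul1r.
Qed.

Lemma cre_cim_le1 k : `|cre k| <= 1 /\ `|cim k| <= 1.
Proof.
elim: k => [|k [IH1 IH2]]; first by rewrite cre0 cim0 normr1 normr0.
by rewrite creS cimS normrN.
Qed.

Definition osc (w : R) (k : nat) (s : R) : R := (w ^+ k)^-1 *
  (cre k * s * cos (w * s) + cim k * s * sin (w * s)
   + k.+1%:R / w * cim k * cos (w * s) - k.+1%:R / w * cre k * sin (w * s)).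

Definition freq (n : nat) : R := 2 * pi * Num.sqrt n%:R.

Definition oamp (n : nat) : R := - pi^-1 * ((r3 n)%:R / n%:R).

Lemma o_termE k n s : o_term k n s = oamp n * osc (freq n) k s.
Proof. by rewrite /osc mulrA. Qed.

Lemma osc_der (w : R) k s : w != 0 -> is_derive s (1 : R) (osc w k.+1) (osc w k s).
Proof.
move=> w0; rewrite /osc !(creS, cimS); have W0 : w ^+ k != 0 by rewrite expf_neq0.
rewrite exprS [k.+2%:R]natSr.
move: (w ^+ k) W0 (k.+1%:R : R) (cre k) (cim k) => W W0 K a b.
by der_eq; field; rewrite w0 W0.
Qed.

Lemma osc_cont w k : continuous (osc w k).
Proof.
apply: cont_mul; first exact: cont_cst.
apply: cont_add; last first.
  by apply: cont_opp; apply: cont_mul; [exact: cont_cst|exact: cont_sinw].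
apply: cont_add; last by apply: cont_mul; [exact: cont_cst|exact: cont_cosw].
apply: cont_add; apply: cont_mul; [|exact: cont_cosw| |exact: cont_sinw];
  by apply: cont_mul; [exact: cont_cst|exact: cont_id].
Qed.

Lemma osc_pbd w k : pbd (osc w k).
Proof.
apply: pbd_mul; first exact: pbd_cst.
apply: pbd_add; last first.
  by apply: pbd_opp; apply: pbd_mul; [exact: pbd_cst|exact: pbd_sin].
apply: pbd_add; last by apply: pbd_mul; [exact: pbd_cst|exact: pbd_cos].
apply: pbd_add; apply: pbd_mul; [|exact: pbd_cos| |exact: pbd_sin];
  by apply: pbd_mul; [exact: pbd_cst|exact: pbd_id].
Qed.

Lemma o_term_der k n (s : R) : is_derive s (1 : R) (@o_term R k.+1 n.+1) (o_term k n.+1 s).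
Proof.
rewrite o_termE (_ : o_term k.+1 n.+1 = (fun s => oamp n.+1 * osc (freq n.+1) k.+1 s)).
  have h : is_derive s (1 : R) (osc (freq n.+1) k.+1) (osc (freq n.+1) k s).
    by apply: osc_der; rewrite gt_eqF// !mulr_gt0// ?pi_gt0// sqrtr_gt0.
  by der_eq; rewrite mul0r add0r.
by apply/funext => x; rewrite o_termE.
Qed.

Lemma o_term_cont k n : continuous (@o_term R k n).
Proof.
rewrite (_ : o_term k n = (fun s => oamp n * osc (freq n) k s)).
  by apply: cont_mul; [exact: cont_cst|exact: osc_cont].
by apply/funext => x; rewrite o_termE.
Qed.

Lemma o_term_pbd k n : pbd (@o_term R k n).
Proof.
rewrite (_ : o_term k n = (fun s => oamp n * osc (freq n) k s)).
  by apply: pbd_mul; [exact: pbd_cst|exact: osc_pbd].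
by apply/funext => x; rewrite o_termE.
Qed.

(** The common majorant, up to constants, of the series over n related to the remainder and its
    constants. *)
Definition r3inv (n : nat) : R := (r3 n.+1)%:R / n.+1%:R ^+ 2.

Lemma r3inv_ge0 n : 0 <= r3inv n.
Proof. by rewrite mulr_ge0// invr_ge0 exprn_ge0. Qed.

Lemma r3inv_cvg : cvgn (series r3inv).
Proof.
apply: nondecreasing_is_cvgn.
  by apply: nondecreasing_series => n _ _; exact: r3inv_ge0.
by exists (16 * 343) => _ [N _ <-]; exact: sum_r3_invsq_le.
Qed.

Lemma pi_ge1 : 1 <= pi :> R.
Proof. by rewrite (le_trans _ (@pi_ge2 R))// ler1n. Qed.

Lemma freq_sqr n : freq n ^+ 2 = 4 * pi ^+ 2 * n%:R.
Proof. by rewrite /freq exprMn sqr_sqrtr//; ring. Qed.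

Lemma freq_ge1 n : 1 <= freq n.+1.
Proof.
have f0 : 0 <= freq n.+1 by rewrite !mulr_ge0 ?pi_ge0 ?sqrtr_ge0.
rewrite -(@ler_pXn2r _ 2)// ?nnegrE// expr1n freq_sqr.
have h : 1 <= pi ^+ 2 :> R by rewrite exprn_ege1// pi_ge1.
have h1 : 1 <= n.+1%:R :> R by rewrite ler1n.
by nra.
Qed.

Lemma freqV_le k n : (2 <= k)%N -> (freq n.+1 ^+ k)^-1 <= n.+1%:R^-1.
Proof.
move=> k2; have f1 := freq_ge1 n; have n0 : 0 < n.+1%:R :> R by [].
rewrite lef_pV2 ?posrE ?exprn_gt0// ?(lt_le_trans ltr01 f1)//.
apply: (@le_trans _ _ (freq n.+1 ^+ 2)); last by rewrite ler_weXn2l.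
rewrite freq_sqr; have h : 1 <= pi ^+ 2 :> R by rewrite exprn_ege1// pi_ge1.
by nra.
Qed.

Lemma oamp_le n : `|oamp n| <= (r3 n)%:R / n%:R.
Proof.
rewrite /oamp normrM normrN [X in _ * X]ger0_norm ?mulr_ge0 ?invr_ge0//.
rewrite ler_piMl ?mulr_ge0 ?invr_ge0// ger0_norm ?invr_ge0 ?pi_ge0//.
by rewrite invf_le1 ?pi_gt0// pi_ge1.
Qed.

Lemma osc_le (w : R) k s : 1 <= w ->
  `|osc w k s| <= (w ^+ k)^-1 * (2 * (`|s| + k.+1%:R)).
Proof.
move=> w1; have w0 : 0 < w by exact: lt_le_trans w1.
have [re im] := cre_cim_le1 k.
have c1 : `|cos (w * s)| <= 1 by rewrite ler_norml cos_geN1 cos_le1.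
have s1 : `|sin (w * s)| <= 1 by rewrite ler_norml sin_geN1 sin_le1.
rewrite normrM [X in X * _]ger0_norm ?invr_ge0 ?exprn_ge0 ?(ltW w0)//.
rewrite ler_wpM2l ?invr_ge0 ?exprn_ge0 ?(ltW w0)//.
have kw : `|k.+1%:R / w| <= k.+1%:R.
  rewrite ger0_norm ?divr_ge0 ?(ltW w0)// ler_pdivrMr// ler_peMr//.
have b1 (x a b : R) : `|a| <= 1 -> `|b| <= 1 -> `|a * x * b| <= `|x|.
  by move=> ha hb; rewrite !normrM mulrAC ler_piMl// mulr_ile1.
have b2 (x a b : R) : `|x| <= k.+1%:R -> `|a| <= 1 -> `|b| <= 1 -> `|x * a * b| <= k.+1%:R.
  move=> hx ha hb; rewrite [x * a]mulrC; exact: le_trans (b1 _ _ _ ha hb) hx.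
apply: (le_trans (ler_normB _ _)).
apply: (le_trans (lerD (ler_normD _ _) (lexx _))).
apply: (le_trans (lerD (lerD (ler_normD _ _) (lexx _)) (lexx _))).
have := b1 s _ _ re c1; have := b1 s _ _ im s1.
have := b2 _ _ _ kw im c1; have := b2 _ _ _ kw re s1.
by lra.
Qed.

Lemma o_term_le k n s : (2 <= k)%N ->
  `|o_term k n.+1 s| <= 2 * (`|s| + k.+1%:R) * r3inv n.
Proof.
move=> k2; rewrite o_termE normrM.
apply: (@le_trans _ _ ((r3 n.+1)%:R / n.+1%:R * (n.+1%:R^-1 * (2 * (`|s| + k.+1%:R))))).
  apply: ler_pM => //; first exact: oamp_le.
  apply: (le_trans (osc_le _ _ (freq_ge1 n))).
  by rewrite ler_wpM2r ?freqV_le// mulr_ge0// addr_ge0.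
by rewrite le_eqVlt; apply/orP; left; apply/eqP; rewrite /r3inv; field.
Qed.

Lemma o_term0 k n : o_term k n 0 = oamp n * ((freq n ^+ k)^-1 * (k.+1%:R / freq n * cim k)).
Proof.
by rewrite o_termE /osc !mulr0 cos0 sin0 !mulr0 mul0r mulr1 add0r subr0 !add0r.
Qed.

Lemma inv_pow_shift (f c d : R) k : f ^- k.+1 * (c / f * d) = f ^- k.+2 * (c * d).
Proof.
rewrite [f ^+ k.+2]exprSr invfM.
by move: (f ^+ k.+1)^-1 f^-1 => x y; ring.
Qed.

(** At s = 0 only the part with the additional factor 1 / w survives; hence the gain 1 / n,
    elsewhere available from level 2 on, is here available already at level 1. *)
Lemma o_term0_le k n : `|o_term k.+1 n.+1 0| <= k.+2%:R * r3inv n.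
Proof.
have f1 := freq_ge1 n; have f0 : 0 < freq n.+1 by exact: lt_le_trans f1.
rewrite o_term0 (_ : _ * (_ * _) = oamp n.+1 * ((freq n.+1 ^+ k.+2)^-1 * (k.+2%:R * cim k.+1))).
  rewrite normrM.
  apply: (@le_trans _ _ ((r3 n.+1)%:R / n.+1%:R * (n.+1%:R^-1 * k.+2%:R))).
    apply: ler_pM => //; first exact: oamp_le.
    rewrite normrM ger0_norm ?invr_ge0 ?exprn_ge0 ?(ltW f0)//.
    apply: ler_pM => //; rewrite ?invr_ge0 ?exprn_ge0 ?(ltW f0) ?freqV_le//.
    by rewrite normrM ger0_norm// ler_piMr//; have [] := cre_cim_le1 k.+1.
  by rewrite le_eqVlt; apply/orP; left; apply/eqP; rewrite /r3inv; field.
by rewrite inv_pow_shift.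
Qed.

Lemma C_term_le j n : 0 <= @C_term R j n <= r3inv n.
Proof.
rewrite /C_term mulr_ge0 ?powR_ge0//= ler_wpM2l//.
rewrite -[leRHS]powR_inv1 ?exprn_ge0// -powR_mulrn// -powRrM.
by rewrite ler_powR ?ler1n// mulrN1 lerBlDr lerDl divr_ge0.
Qed.

Lemma C_term_cvg j : cvgn [normed series (@C_term R j)].
Proof.
apply: cvg_dominated r3inv_cvg => n.
by have /andP[h1 h2] := C_term_le j n; rewrite ger0_norm.
Qed.

Lemma cre_even j : cre j.*2 = (-1) ^+ j /\ cim j.*2 = 0.
Proof.
elim: j => [|j [IH1 IH2]]; first by rewrite cre0 cim0 expr0.
by rewrite doubleS !(creS, cimS) IH1 IH2 oppr0 exprS mulN1r.
Qed.

(** Origin of the constants C_k: the amplitude 1 / (pi n) = 2 / (2 pi n) times (k+2) / w^(k+2), with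
    w = 2 pi sqrt n, yields the factor 2 k + 4, the power (2 pi)^-(k+3) and n^(-2 - k/2). The sign
    is Im(i^(k+1)) = Re(i^k) = (-1)^(k/2). *)
Lemma o_term0_C k n : ~~ odd k -> o_term k.+1 n.+1 0 =
  - ((if (k %% 4 == 0)%N then 1 else -1) * (2 * k + 4)%N%:R * (2 * pi) ^- (k + 3)) * @C_term R k n.
Proof.
move=> ek; rewrite o_term0 cimS.
have kE : k = k./2.*2 by rewrite even_halfK.
set j := k./2 in kE; have [creE _] := cre_even j.
have -> : cre k = if (k %% 4 == 0)%N then 1 else -1.
  rewrite {1}kE creE -signr_odd.
  have -> : (k %% 4 == 0)%N = ~~ odd j by rewrite kE; lia.
  by case: (odd j).
move: (if _ then _ else _) => e.
have sqE : Num.sqrt (n.+1%:R : R) ^+ k.+2 = n.+1%:R ^+ j.+1.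
  by rewrite kE -doubleS -mul2n exprM sqr_sqrtr.
have -> : @C_term R k n = (r3 n.+1)%:R / n.+1%:R ^+ j.+2 :> R.
  rewrite /C_term; congr (_ * _).
  rewrite -[RHS]powR_inv1 ?exprn_ge0// -powR_mulrn// -powRrM; congr (_ `^ _).
  rewrite {1}kE -mul2n natrM [j.+2%:R]natSr [j.+1%:R]natSr.
  by field.
rewrite /oamp (_ : (freq n.+1 ^+ k.+1)^-1 * (k.+2%:R / freq n.+1 * e) =
  k.+2%:R * e / ((2 * pi) ^+ k.+2 * n.+1%:R ^+ j.+1)); last first.
  by rewrite inv_pow_shift -sqE -exprMn mulrC.
have -> : (2 * k + 4)%N%:R = 2 * k.+2%:R :> R by rewrite -natrM; congr _%:R; lia.
rewrite addn3.
have p0 : pi != 0 :> R by rewrite gt_eqF// pi_gt0.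
have P0 : (2 * pi) ^+ k.+2 != 0 :> R by rewrite expf_neq0// mulf_neq0.
have N0 : n.+1%:R != 0 :> R by rewrite pnatr_eq0.
rewrite [(2 * pi) ^+ k.+3]exprSr [n.+1%:R ^+ j.+2]exprSr.
have M0 : n.+1%:R ^+ j.+1 != 0 :> R by rewrite expf_neq0.
move: (k.+2%:R : R) ((r3 n.+1)%:R : R) (pi : R) p0 (n.+1%:R : R) N0
  ((2 * pi) ^+ k.+2 : R) P0 (n.+1%:R ^+ j.+1 : R) M0 => K r p p0 N N0 P P0 M M0.
by field; rewrite ?M0 ?N0 ?P0 ?p0.
Qed.

Lemma o_term0_series k : series (fun n => @o_term R k.+1 n.+1 0) @ \oo --> - C_coef R k.
Proof.
rewrite /C_coef; case: ifPn => [ok|ek].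
  rewrite oppr0 (_ : series _ = cst 0); first exact: cvg_cst.
  apply/funext => N; rewrite /series /= big1// => n _.
  rewrite o_term0 cimS -(odd_double_half k) ok add1n creS (cre_even _).2 oppr0.
  by rewrite !mulr0.
rewrite -mulNr; set c := - _.
rewrite (_ : series _ = (fun N => c * series (@C_term R k) N)); last first.
  apply/funext => N; rewrite /series /= mulr_sumr; apply: eq_bigr => n _.
  exact: o_term0_C.
by apply: cvgM; [exact: cvg_cst|exact: (normed_cvg (@C_term_cvg k))].
Qed.

Lemma o_sum_abs k s : (2 <= k)%N -> cvgn [normed series (fun n => @o_term R k n.+1 s)].
Proof.
move=> k2; apply: (@cvg_dominated _ _ (fun n => 2 * (`|s| + k.+1%:R) * r3inv n)).
  by move=> n; exact: o_term_le.
exact: (is_cvg_seriesZ (k := 2 * (`|s| + k.+1%:R)) r3inv_cvg).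
Qed.

Lemma o_sum_cvg k (s : R) : (2 <= k)%N ->
  \sum_(0 <= n < N) o_term k n.+1 s @[N --> \oo] --> o_sum k s.
Proof. by move=> k2; exact: (normed_cvg (@o_sum_abs k s k2)). Qed.

Lemma r3invZ_cvg (c : R) : cvgn (series (fun n => c * r3inv n)).
Proof. exact: (is_cvg_seriesZ (k := c) r3inv_cvg). Qed.

Lemma o_sum_cont k : (2 <= k)%N -> continuous (@o_sum R k).
Proof.
move=> k2 x; pose B := `|x| + 1.
apply: (@weierstrass_cont R (fun n => @o_term R k n.+1)
  (fun n => 2 * (B + k.+1%:R) * r3inv n) B) => //.
- by move=> n; exact: o_term_cont.
- move=> n s sB; apply: (le_trans (o_term_le _ _ k2)).
  by rewrite ler_wpM2r ?r3inv_ge0// ler_pM2l// lerD2r ltW.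
- exact: r3invZ_cvg.
- by rewrite /B ltrDl.
Qed.

Definition r3tot : R := limn (series r3inv).

Lemma o_partial_le k N s : (2 <= k)%N ->
  `|\sum_(0 <= n < N) o_term k n.+1 s| <= 2 * (`|s| + k.+1%:R) * r3tot.
Proof.
move=> k2; apply: (le_trans (ler_norm_sum _ _ _)).
apply: (@le_trans _ _ (2 * (`|s| + k.+1%:R) * series r3inv N)).
  by rewrite /series /= mulr_sumr; apply: ler_sum => n _; exact: o_term_le.
rewrite ler_wpM2l ?mulr_ge0 ?addr_ge0//; apply: nondecreasing_cvgn_le.
  by apply: nondecreasing_series => n _ _; exact: r3inv_ge0.
exact: r3inv_cvg.
Qed.

Lemma o_sum_le k s : (2 <= k)%N -> `|o_sum k s| <= 2 * (`|s| + k.+1%:R) * r3tot.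
Proof.
move=> k2; have h : `|\sum_(0 <= n < N) o_term k n.+1 s| @[N --> \oo] --> `|o_sum k s|.
  by apply: cvg_norm; exact: o_sum_cvg.
rewrite -(cvg_lim (@Rhausdorff R) h); apply: limr_le; first by apply/cvg_ex; eexists; exact: h.
by apply: nearW => N; exact: o_partial_le.
Qed.

Lemma obound_pbd k : pbd (fun s : R => 2 * (`|s| + k.+1%:R) * r3tot).
Proof.
apply: pbd_mul; last exact: pbd_cst; apply: pbd_mul; first exact: pbd_cst.
by apply: pbd_add; [exact: pbd_norm|exact: pbd_cst].
Qed.

Lemma obound_cont k : continuous (fun s : R => 2 * (`|s| + k.+1%:R) * r3tot).
Proof.
apply: cont_mul; last exact: cont_cst; apply: cont_mul; first exact: cont_cst.
by apply: cont_add; [exact: norm_cont|exact: cont_cst].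
Qed.

Lemma o_sum_pbd k : (2 <= k)%N -> pbd (@o_sum R k).
Proof.
move=> k2; apply: (pbd_le (obound_pbd k)) => x.
by rewrite (le_trans (o_sum_le x k2))// ler_norm.
Qed.

(** The value at 0 is - C_{k-1}, and constants of odd index vanish. For odd k >= 3 it is nonzero and
    cancels the constant term of the polynomial part. *)
Lemma o_sum0 k : (2 <= k)%N -> ~~ odd k -> o_sum k 0 = 0 :> R.
Proof.
move=> k2 ek; have := @o_sum_cvg k 0 k2.
case: k k2 ek => // k k2 /= ; rewrite negbK => ok h.
have := @o_term0_series k; rewrite /C_coef ok oppr0 => h0.
exact: (cvg_unique (@Rhausdorff R) h h0).
Qed.

End Oterm.

(** * Gaussian test functions *)

Section GaussTests.
Context {R : realType} (a : R) (a0 : 0 < a).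
Notation mu := (@lebesgue_measure R).

Definition gauss1 (x : R) : R := - (2 * a * x) * gauss a x.
Definition gauss2 (x : R) : R := (4 * a ^+ 2 * x ^+ 2 - 2 * a) * gauss a x.
Definition gauss3 (x : R) : R := (12 * a ^+ 2 * x - 8 * a ^+ 3 * x ^+ 3) * gauss a x.

Lemma gauss1_der (x : R) : is_derive x (1 : R) gauss1 (gauss2 x).
Proof.
have h := gauss_der a x; rewrite /gauss1; der_eq.
by rewrite /gauss2 /gauss1; ring.
Qed.

Lemma gauss2_der (x : R) : is_derive x (1 : R) gauss2 (gauss3 x).
Proof.
have h := gauss_der a x; rewrite /gauss2; der_eq.
by rewrite /gauss3; ring.
Qed.

Lemma cont_poly_gauss (p : R -> R) : continuous p -> pbd p -> rapid (fun x => p x * gauss a x).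
Proof. by move=> cp pp; apply: rapid_mul => //; exact: gauss_rapid. Qed.

Lemma gauss1_rapid : rapid gauss1.
Proof.
apply: cont_poly_gauss.
  by apply: cont_opp; apply: cont_mul; [exact: cont_cst|exact: cont_id].
by apply: pbd_opp; apply: pbd_mul; [exact: pbd_cst|exact: pbd_id].
Qed.

Lemma gauss2_rapid : rapid gauss2.
Proof.
apply: cont_poly_gauss.
  apply: cont_add; last exact: cont_cst.
  by apply: cont_mul; [exact: cont_cst|apply: cont_pow; exact: cont_id].
apply: pbd_add; last exact: pbd_cst.
by apply: pbd_mul; [exact: pbd_cst|apply: pbd_pow; exact: pbd_id].
Qed.

Lemma gauss3_rapid : rapid gauss3.
Proof.
apply: cont_poly_gauss.
  apply: cont_add; first by apply: cont_mul; [exact: cont_cst|exact: cont_id].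
  apply: cont_opp; apply: cont_mul; [exact: cont_cst|apply: cont_pow; exact: cont_id].
apply: pbd_add; first by apply: pbd_mul; [exact: pbd_cst|exact: pbd_id].
by apply: pbd_opp; apply: pbd_mul; [exact: pbd_cst|apply: pbd_pow; exact: pbd_id].
Qed.

(** Of the three boundary terms at 0, those with f2(0) and f0(0) vanish by hypothesis and the middle
    one because g'(0) = 0. The slope f1(0) is therefore unconstrained, which is why linear functions
    are invisible to these tests. *)
Lemma test3 (f2 f1 f0 fm : R -> R) :
  (forall x, is_derive x (1 : R) f2 (f1 x)) -> (forall x, is_derive x (1 : R) f1 (f0 x)) ->
  (forall x, is_derive x (1 : R) f0 (fm x)) -> continuous fm ->
  pbd f2 -> pbd f1 -> pbd f0 -> pbd fm -> f2 0 = 0 -> f0 0 = 0 ->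
  \int[mu]_(x in `[0, +oo[) (f2 x * gauss3 x) =
  - \int[mu]_(x in `[0, +oo[) (fm x * gauss a x).
Proof.
move=> d2 d1 d0 cm p2 p1 p0 pm f20 f00.
have := IBP_itvy 0 d2 (der_cont d1) p2 p1 gauss2_der gauss2_rapid gauss3_rapid.
have := IBP_itvy 0 d1 (der_cont d0) p1 p0 gauss1_der gauss1_rapid gauss2_rapid.
have := IBP_itvy 0 d0 cm p0 pm (gauss_der a) (gauss_rapid a0) gauss1_rapid.
rewrite f20 f00 !mul0r oppr0 !add0r.
have -> : gauss1 0 = 0 by rewrite /gauss1 !mulr0 oppr0 mul0r.
rewrite mulr0 oppr0 add0r => h1 h2 h3.
have -> : \int[mu]_(x in `[0, +oo[) (fm x * gauss a x) =
  - \int[mu]_(x in `[0, +oo[) (f0 x * gauss1 x) by exact: h1.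
by rewrite h2 opprK h3 opprK.
Qed.

Lemma x_sin_gauss (w : R) :
  \int[mu]_(x in `[0, +oo[) (x * sin (w * x) * gauss a x) =
  w / (2 * a) * (gauss0 a * expR (- (w ^+ 2 / (4 * a)))).
Proof.
have mI := @itv0y_meas R.
have := @gauss_IBP R a 0 (fun x => sin (w * x)) _ a0 (der_sinw w)
    (cont_mul (@cont_cst R w) (@cont_cosw R w)) (pbd_sin _) (pbd_mul (pbd_cst w) (pbd_cos _)).
rewrite mulr0 sin0 mul0r oppr0 add0r.
rewrite (_ : (fun x => w * cos (w * x) * gauss a x) =
  (fun x => w * (cos (w * x) * gauss a x))); last by apply/funext => x; ring.
rewrite (_ : (fun x => sin (w * x) * _) =
  (fun x => - (2 * a) * (x * sin (w * x) * gauss a x))); last first.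
  by apply/funext => x; ring.
have I1 : mu.-integrable `[0, +oo[ (EFin \o (fun x => cos (w * x) * gauss a x)).
  apply: pbd_rapid_int => //; [|exact: pbd_cos|exact: gauss_rapid].
  by apply: cont_meas => //; exact: cont_cosw.
have I2 : mu.-integrable `[0, +oo[ (EFin \o (fun x => x * sin (w * x) * gauss a x)).
  apply: pbd_rapid_int => //; last exact: gauss_rapid.
    by apply: cont_meas => //; apply: cont_mul; [exact: cont_id|exact: cont_sinw].
  by apply: pbd_mul; [exact: pbd_id|exact: pbd_sin].
rewrite !RintegralZl// gaussFT// mulNr opprK => h.
have a2 : 2 * a != 0 by rewrite mulf_neq0// gt_eqF.
by rewrite mulrAC h mulrAC divff// mul1r.
Qed.

Lemma x2_gauss : \int[mu]_(x in `[0, +oo[) (x ^+ 2 * gauss a x) = gauss0 a / (2 * a).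
Proof.
have mI := @itv0y_meas R.
have := @gauss_IBP R a 0 (fun x => x) (fun=> 1) a0 (@der_id R) (@cont_cst R 1) pbd_id (pbd_cst 1).
rewrite mul0r oppr0 add0r.
rewrite (_ : (fun x => 1 * gauss a x) = gauss a); last by apply/funext => x; ring.
rewrite (_ : (fun x => x * _) =
  (fun x => - (2 * a) * (x ^+ 2 * gauss a x))); last first.
  by apply/funext => x; ring.
have I2 : mu.-integrable `[0, +oo[ (EFin \o (fun x => x ^+ 2 * gauss a x)).
  by apply: pbd_rapid_int => //; [apply: pbd_pow; exact: pbd_id|exact: gauss_rapid].
rewrite RintegralZl// mulNr opprK => h.
have a2 : 2 * a != 0 by rewrite mulf_neq0// gt_eqF.
by rewrite /gauss0 h mulrAC divff// mul1r.
Qed.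

(** Converts the factor produced by radial integrals into the (2 G)^3 = (pi / a)^(3/2) of the cubed
    theta law, G being [gauss0 a]. *)
Lemma gauss0_cube : 2 * pi / a * gauss0 a = (2 * gauss0 a) ^+ 3.
Proof. by rewrite exprS gauss0_sqr//; ring. Qed.

(** Three derivatives turn the term into r_3(n) 4 pi s^2 sin(w s) / (w s), the integral over the
    sphere of radius s of the characters indexed by the vectors of squared length n. The test thus
    yields their share in the dual side of Poisson summation. *)
Lemma o_term_test n : \int[mu]_(x in `[0, +oo[) (o_term 2 n.+1 x * gauss3 x) =
  - ((2 * gauss0 a) ^+ 3 * ((r3 n.+1)%:R * expR (- (pi ^+ 2 / a * n.+1%:R)))).
Proof.
set w := freq n.+1 : R; set A := oamp n.+1 : R.
have w0 : w != 0 by rewrite gt_eqF// (lt_le_trans ltr01)// freq_ge1.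
pose fm (s : R) := (- A * w) * (s * sin (w * s)).
have d0 (s : R) : is_derive s (1 : R) (@o_term R 0 n.+1) (fm s).
  rewrite (_ : o_term 0 n.+1 = (fun s => A * (s * cos (w * s) - w^-1 * sin (w * s)))).
    by der_eq; rewrite /fm; field.
  apply/funext => x; rewrite o_termE /osc expr0 cre0 cim0 invr1.
  by rewrite -/w -/A; field.
have cm : continuous fm.
  apply: cont_mul; first exact: cont_cst.
  by apply: cont_mul; [exact: cont_id|exact: cont_sinw].
have pm : pbd fm.
  apply: pbd_mul; first exact: pbd_cst.
  by apply: pbd_mul; [exact: pbd_id|exact: pbd_sin].
rewrite (test3 (o_term_der 1 n) (o_term_der 0 n) d0)//; last 5 first.
- exact: o_term_pbd.
- exact: o_term_pbd.
- exact: o_term_pbd.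
- by rewrite o_term0 !(cimS, creS) cim0 oppr0 !mulr0.
- by rewrite o_term0 cim0 !mulr0.
have mI := @itv0y_meas R.
rewrite /fm (_ : (fun x => _) = (fun x => (- A * w) * (x * sin (w * x) * gauss a x))); last first.
  by apply/funext => x; rewrite !mulrA.
rewrite RintegralZl//; last first.
  apply: pbd_rapid_int => //; last exact: gauss_rapid.
    by apply: cont_meas => //; apply: cont_mul; [exact: cont_id|exact: cont_sinw].
  by apply: pbd_mul; [exact: pbd_id|exact: pbd_sin].
rewrite x_sin_gauss -gauss0_cube; congr (- _).
have p0 : pi != 0 :> R by rewrite gt_eqF// pi_gt0.
have aN : a != 0 by rewrite gt_eqF.
have N0 : n.+1%:R != 0 :> R by rewrite pnatr_eq0.
have w2 : w ^+ 2 = 4 * pi ^+ 2 * n.+1%:R by exact: freq_sqr.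
have -> : w ^+ 2 / (4 * a) = pi ^+ 2 / a * n.+1%:R by rewrite w2; field.
rewrite /A /oamp.
have -> : - (- pi^-1 * ((r3 n.+1)%:R / n.+1%:R)) * w * (w / (2 * a) *
   (gauss0 a * expR (- (pi ^+ 2 / a * n.+1%:R)))) = w ^+ 2 * (pi^-1 * ((r3 n.+1)%:R / n.+1%:R)
   * ((2 * a)^-1 * (gauss0 a * expR (- (pi ^+ 2 / a * n.+1%:R))))) by ring.
rewrite w2; move: (n.+1%:R : R) N0 (pi : R) p0 (gauss0 a) ((r3 n.+1)%:R : R)
  (expR (- (pi ^+ 2 / a * n.+1%:R))) => N N0 p p0 G r E.
by field; rewrite N0 p0 aN.
Qed.

Lemma leading_der k (s : R) : is_derive s (1 : R) (@leading_term R k.+1) (leading_term k s).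
Proof.
have f0 : ((3 + k)`!%:R : R) != 0 by rewrite pnatr_eq0 -lt0n fact_gt0.
rewrite /leading_term addnS factS natrM.
have k0 : ((3 + k).+1%:R : R) != 0 by rewrite pnatr_eq0.
move: ((3 + k)`!%:R : R) f0 => A A0; move: (3 + k)%N k0 => m m0.
der_eq; move: (m.+1%:R : R) m0 => B B0.
by field; rewrite A0 B0.
Qed.

Lemma leading_cont k : continuous (@leading_term R k).
Proof. by apply: cont_mul; [exact: cont_cst|apply: cont_pow; exact: cont_id]. Qed.

Lemma leading_pbd k : pbd (@leading_term R k).
Proof. by apply: pbd_mul; [exact: pbd_cst|apply: pbd_pow; exact: pbd_id]. Qed.

Lemma leading0 k : @leading_term R k 0 = 0.
Proof. by rewrite /leading_term expr0n mulr0. Qed.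

(** The share of the zero vector in the dual sum: three derivatives leave 4 pi s^2, the area of the
    sphere. *)
Lemma leading_test : \int[mu]_(x in `[0, +oo[) (leading_term 2 x * gauss3 x) =
  - (2 * gauss0 a) ^+ 3.
Proof.
pose fm (s : R) := 4 * pi * s ^+ 2.
have d0 (s : R) : is_derive s (1 : R) (@leading_term R 0) (fm s).
  rewrite /leading_term addn0; der_eq; rewrite /fm !factS fact0 muln1 /=.
  by field.
have cm : continuous fm by apply: cont_mul; [exact: cont_cst|apply: cont_pow; exact: cont_id].
have pm : pbd fm by apply: pbd_mul; [exact: pbd_cst|apply: pbd_pow; exact: pbd_id].
rewrite (test3 (leading_der 1) (leading_der 0) d0)//; last 5 first.
- exact: leading_pbd.
- exact: leading_pbd.
- exact: leading_pbd.
- exact: leading0.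
- exact: leading0.
have mI := @itv0y_meas R.
rewrite /fm (_ : (fun x => _) = (fun x => (4 * pi) * (x ^+ 2 * gauss a x))); last first.
  by apply/funext => x; rewrite !mulrA.
rewrite RintegralZl//; last first.
  by apply: pbd_rapid_int => //; [apply: pbd_pow; exact: pbd_id|exact: gauss_rapid].
rewrite x2_gauss -gauss0_cube; congr (- _).
by field; rewrite gt_eqF.
Qed.

Lemma linear_test (c : R) : \int[mu]_(x in `[0, +oo[) (c * x * gauss3 x) = 0.
Proof.
have d2 (x : R) : is_derive x (1 : R) (fun x => c * x) c by der_eq; ring.
have := test3 d2 (der_cst c) (der_cst 0) (@cont_cst R 0)
  (pbd_mul (pbd_cst c) pbd_id) (pbd_cst c) (pbd_cst 0) (pbd_cst 0).
move=> -> //; last by rewrite mulr0.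
rewrite (_ : (fun x => _) = cst 0); first by rewrite Rintegral_cst ?mul0r ?oppr0//.
by apply/funext => x; rewrite mul0r.
Qed.

(** The third derivative of the truncated square is the Dirac mass at sqrt n, so the test evaluates
    the Gaussian there, up to sign. *)
Lemma etrunc_gauss n : \int[mu]_(x in `[0, +oo[) (etrunc 2 n x * gauss3 x) =
  - expR (- (a * n%:R)).
Proof.
have mI := itv_meas `[Num.sqrt (n%:R : R), +oo[%R.
rewrite etrunc_test; last exact: gauss3_rapid.
set r := Num.sqrt n%:R.
have := ptrunc_IBP 1 r gauss2_der gauss2_rapid gauss3_rapid.
have := ptrunc_IBP 0 r gauss1_der gauss1_rapid gauss2_rapid.
rewrite (_ : (fun x => ptrunc 0 r x * _) = gauss1); last first.
  by apply/funext => x; rewrite /ptrunc expr0 divr1 mul1r.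
rewrite (FTC_itvy (gauss_der a) (der_cont gauss1_der)).
- rewrite {1}/gauss sqr_sqrtr// => /(congr1 -%R); rewrite opprK => h1.
  by move=> /(congr1 -%R); rewrite opprK => <-; rewrite -h1 opprK.
- by apply: rapid_int => //; exact: gauss1_rapid.
- have := pbd_rapid_cvg0 (pbd_cst 1) (gauss_rapid a0).
  by under eq_cvg do rewrite mul1r.
Qed.

Lemma N3_test : \sum_(0 <= n < N) (r3 n)%:R * expR (- (a * n%:R)) @[N --> \oo] -->
  - \int[mu]_(x in `[0, +oo[) (N3k 2 x * gauss3 x).
Proof.
have h := N3k_test_cvg (k := 2) gauss3_rapid.
rewrite (_ : (fun N => _) = (fun N : nat => - \sum_(0 <= n < N) (r3 n)%:R *
   \int[mu]_(x in `[0, +oo[) (etrunc 2 n x * gauss3 x))).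
  by apply: cvgN; exact: h.
apply/funext => N; rewrite -sumrN; apply: eq_bigr => n _.
by rewrite etrunc_gauss mulrN opprK.
Qed.

End GaussTests.

Section OsumTest.
Context {R : realType}.
Notation mu := (@lebesgue_measure R).

Lemma o_term_test_int k n (psi : R -> R) : rapid psi ->
  mu.-integrable `[0, +oo[ (EFin \o (fun x => o_term k n x * psi x)).
Proof.
move=> rp; apply: pbd_rapid_int => //; last exact: o_term_pbd.
by apply: cont_meas => //; exact: o_term_cont.
Qed.

Lemma o_sum_test_cvg k (psi : R -> R) : (2 <= k)%N -> rapid psi ->
  \sum_(0 <= n < N) \int[mu]_(x in `[0, +oo[) (o_term k n.+1 x * psi x) @[N --> \oo]
  --> \int[mu]_(x in `[0, +oo[) (o_sum k x * psi x).
Proof.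
move=> k2 rp; have mI := @itv0y_meas R.
have cS N : continuous (fun s => \sum_(0 <= n < N) @o_term R k n.+1 s).
  by apply: cont_sum => n; exact: o_term_cont.
have [||||_] := @Rdominated R `[0, +oo[
  (fun N x => (\sum_(0 <= n < N) o_term k n.+1 x) * psi x)
  (fun x => o_sum k x * psi x) (fun x => `|2 * (`|x| + k.+1%:R) * r3tot * psi x|) mI.
- by move=> K; apply: measurable_funM; apply: cont_meas => //; case: rp.
- by move=> x _; apply: cvgM; [exact: o_sum_cvg|exact: cvg_cst].
- apply: (integrable_norm (pbd_rapid_int mI _ (obound_pbd k) rp)).
  by apply: cont_meas => //; exact: obound_cont.
- move=> K x _; rewrite normrM [leRHS]normrM ler_wpM2r//.
  by rewrite (le_trans (@o_partial_le R k K x k2))// ler_norm.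
apply: cvg_trans; apply: near_eq_cvg; apply: nearW => K.
transitivity (\int[mu]_(x in `[0, +oo[) (\sum_(0 <= n < K) o_term k n.+1 x * psi x)).
  by apply: eq_Rintegral => x _; rewrite mulr_suml.
by rewrite Rint_sum// => n _; exact: o_term_test_int.
Qed.

End OsumTest.

(** * Uniqueness from Gaussian moments *)

Section Uniqueness.
Context {R : realType}.
Notation mu := (@lebesgue_measure R).

Lemma int_restrict (D I : set R) (f : R -> R) : measurable D -> measurable I ->
  mu.-integrable I (EFin \o f) -> mu.-integrable D (EFin \o (f \_ I)).
Proof.
move=> mD mI If; apply: (@integrableS _ _ _ _ setT) => //.
by have := (@integrable_mkcond _ _ R mu I (EFin \o f) mI).1 If; rewrite restrict_EFin.
Qed.

(** With X = e^(-s^2), the Gaussians with a = 1, 2, ... are the powers X, X^2, ...; the factor X in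
    front of p(X) accounts for a > 0, which excludes the constant function. *)
Lemma gauss_poly_int (h : R -> R) (p : {poly R}) : continuous h -> pbd h ->
  (forall a, 0 < a -> \int[mu]_(x in `[0, +oo[) (h x * gauss a x) = 0) ->
  \int[mu]_(x in `[0, +oo[) (h x * (gauss 1 x * p.[gauss 1 x])) = 0.
Proof.
move=> ch ph h0; have mI := @itv0y_meas R.
have If a : 0 < a -> mu.-integrable `[0, +oo[ (EFin \o (fun x => h x * gauss a x)).
  move=> a0; apply: pbd_rapid_int => //; last exact: gauss_rapid.
  exact: cont_meas.
have i0 (i : nat) : 0 < i.+1%:R :> R by [].
rewrite (_ : (fun x => _) =
  (fun x => \sum_(0 <= i < size p) p`_i * (h x * gauss i.+1%:R x))); last first.
  apply/funext => x; rewrite horner_coef big_mkord !mulr_sumr; apply: eq_bigr => i _.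
  have -> : gauss i.+1%:R x = gauss 1 x * gauss 1 x ^+ i.
    rewrite -exprS /gauss -expRM_natl; congr expR; ring.
  by ring.
rewrite Rint_sum//; last by move=> i _; apply: int_mul => //; exact: If.
by apply: big1 => i _; rewrite RintegralZl ?h0 ?mulr0//; exact: If.
Qed.

Lemma gauss_dec (x y : R) : 0 <= x -> x < y -> gauss 1 y < gauss 1 x.
Proof.
by move=> x0 xy; rewrite /gauss ltr_expR ltrN2 !mul1r ltrXn2r ?nnegrE// (le_trans x0)// ltW.
Qed.

(* Near a point where h > 0 the powers of a polynomial in e^{-s^2} peaking there blow up,
   while elsewhere they stay bounded. *)
Lemma gauss_unique_pos (h : R -> R) (s0 : R) : continuous h -> pbd h ->
  (forall a, 0 < a -> \int[mu]_(x in `[0, +oo[) (h x * gauss a x) = 0) ->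
  0 < s0 -> h s0 <= 0.
Proof.
move=> ch ph h0 s00; rewrite leNgt; apply/negP => hs0.
have mI := @itv0y_meas R.
pose eta := h s0 / 2; have eta0 : 0 < eta by rewrite divr_gt0.
have [d [d0 ds hd]] : exists d : R, [/\ 0 < d, d < s0 & forall x, `|x - s0| <= d -> eta <= h x].
  have := ch s0 => /cvgrPdist_lt /(_ _ eta0) [e /= e0 he].
  exists (Num.min (e / 2) (s0 / 2)); split.
  - by rewrite lt_min !divr_gt0.
  - by rewrite gt_min; apply/orP; right; lra.
  - move=> x; rewrite le_min => /andP[xe _].
    have /he : ball_ Num.norm s0 e x by rewrite /= distrC; lra.
    by rewrite ltr_norml /eta => /andP[]; lra.
pose X := gauss 1 : R -> R; pose x0 := X s0.
have X01 x : 0 < X x <= 1.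
  by rewrite /X /gauss expR_gt0 /= -[leRHS]expR0 ler_expR oppr_le0 mulr_ge0// sqr_ge0.
pose dd := Num.min (X (s0 - d) - x0) (x0 - X (s0 + d)).
have dd0 : 0 < dd by rewrite lt_min !subr_gt0 !gauss_dec//; lra.
pose rho := dd ^+ 2 / 2; have rho0 : 0 < rho by rewrite divr_gt0// exprn_gt0.
(* Q is 1 + rho at s0 and, X being monotone, at most 1 - rho at distance more than d, where (X -
   x0)^2 >= dd^2 = 2 rho. It is nonnegative since X and x0 lie in ]0, 1]. *)
pose Q (x : R) : R := 1 + rho - (X x - x0) ^+ 2.
pose pol : {poly R} := (1 + rho)%:P - ('X - x0%:P) ^+ 2.
have polE x : pol.[X x] = Q x by rewrite /pol !hornerE.
have Q_out x : 0 <= x -> d < `|x - s0| -> 0 <= Q x <= 1.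
  move=> xx0 dx; have := X01 x; have := X01 s0; rewrite -/x0 => /andP[h1 h2] /andP[h3 h4].
  have : dd <= `|X x - x0|.
    have [xs|xs] := ltP x s0.
      have : X (s0 - d) < X x.
        by apply: gauss_dec => //; move: dx; rewrite ltr0_norm; lra.
      by move=> hX; rewrite (le_trans _ (ler_norm _))// /dd ge_min; apply/orP; left; lra.
    have : X x < X (s0 + d).
      by apply: gauss_dec; [lra|move: dx; rewrite ger0_norm; lra].
    by move=> hX; rewrite distrC (le_trans _ (ler_norm _))// /dd ge_min; apply/orP; right; lra.
  move=> hdd; have h5 : dd ^+ 2 <= (X x - x0) ^+ 2.
    by rewrite -[leRHS]real_normK ?num_real// lerXn2r ?nnegrE ?(ltW dd0).
  by rewrite /Q /rho; apply/andP; split; nra.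
have Q_in x : `|x - s0| <= d -> 0 <= Q x.
  move=> _; have := X01 x; have := X01 s0; rewrite -/x0 => /andP[h1 h2] /andP[h3 h4].
  by rewrite /Q; nra.
have cQ : continuous Q.
  rewrite /Q; apply: cont_add; first exact: cont_cst.
  apply: cont_opp; apply: cont_pow; apply: cont_add; last exact: cont_cst.
  exact: (der_cont (gauss_der 1)).
have pQ : pbd Q.
  apply: pbd_add; first exact: pbd_cst.
  apply: pbd_opp; apply: pbd_pow; apply: pbd_add; last exact: pbd_cst.
  apply: (pbd_le (pbd_cst 1)) => x; have /andP[h1 h2] := X01 x.
  by rewrite normr1 gtr0_norm.
have [d' [d'0 d'd hd']] : exists d' : R, [/\ 0 < d', d' <= d &
    forall x, `|x - s0| <= d' -> 1 + rho / 2 <= Q x].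
  have r2 : 0 < rho / 2 by rewrite divr_gt0.
  have := cQ s0 => /cvgrPdist_lt /(_ _ r2) [e /= e0 he].
  exists (Num.min (e / 2) d); split.
  - by rewrite lt_min d0 divr_gt0.
  - by rewrite ge_min lexx orbT.
  - move=> x; rewrite le_min => /andP[xe _].
    have /he : ball_ Num.norm s0 e x by rewrite /= distrC; lra.
    have -> : Q s0 = 1 + rho by rewrite /Q /x0 subrr expr0n subr0.
    by rewrite ltr_norml => /andP[]; lra.
pose B := \int[mu]_(x in `[0, +oo[) `|h x * X x|.
pose c := eta * X (s0 + d).
have c0 : 0 < c by rewrite mulr_gt0//; have /andP[] := X01 (s0 + d).
(* The vanishing integral of h X Q^n is at least the gain on the inner interval minus B. By
   Bernoulli's inequality the gain grows at least linearly in n, while B is fixed. *)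
have key n : c * (n%:R * (rho / 2)) * (2 * d') <= B.
  pose f x := h x * (X x * Q x ^+ n).
  have f0 : \int[mu]_(x in `[0, +oo[) f x = 0.
    rewrite -[RHS](@gauss_poly_int h (pol ^+ n) ch ph h0); apply: eq_Rintegral => x _.
    by rewrite horner_exp polE.
  pose K := c * (n%:R * (rho / 2)).
  pose I : set R := `[s0 - d', s0 + d']%classic.
  have mIn : measurable I by exact: itv_meas.
  have K0 : 0 <= K by rewrite /K mulr_ge0 ?(ltW c0)// mulr_ge0// divr_ge0// ltW.
  have IE (x : R) : I x <-> `|x - s0| <= d'.
    by rewrite /I /= in_itv /= ler_norml; split=> /andP[h1 h2]; apply/andP; split; lra.
  have IfX : mu.-integrable `[0, +oo[ (EFin \o (fun x => h x * X x)).
    apply: pbd_rapid_int => //; last exact: gauss_rapid.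
    exact: cont_meas.
  have If : mu.-integrable `[0, +oo[ (EFin \o f).
    rewrite (_ : f = (fun x => h x * Q x ^+ n * X x)); last first.
      by apply/funext => x; rewrite /f; ring.
    apply: pbd_rapid_int => //; last exact: gauss_rapid.
      by apply: cont_meas => //; apply: cont_mul => //; exact: cont_pow.
    by apply: pbd_mul => //; exact: pbd_pow.
  have IK : mu.-integrable `[0, +oo[ (EFin \o (cst K \_ I)).
    by apply: int_restrict => //; apply: int_itv_cont; exact: cont_cst.
  have Iabs := integrable_norm IfX.
  (* Three zones: within d' the integrand exceeds K, between d' and d it is nonnegative because h
     and Q are, and beyond d the bound 0 <= Q <= 1 leaves at worst -|h X|. *)
  have lef x : (`[0, +oo[)%classic x -> (cst K \_ I) x - `|h x * X x| <= f x.
    rewrite /= in_itv /= andbT => xx0; have /andP[Xx0 Xx1] := X01 x.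
    rewrite patchE; case: ifPn => [/set_mem/IE xI|_].
      have xd : `|x - s0| <= d by exact: le_trans xI d'd.
      have hx := hd x xd; have Qx := hd' x xI.
      have Xd : X (s0 + d) <= X x.
        have : x <= s0 + d by move: xd; rewrite ler_norml; lra.
        by rewrite le_eqVlt => /predU1P[->//|xs]; rewrite ltW// gauss_dec.
      have Qn : n%:R * (rho / 2) <= Q x ^+ n.
        apply: (@le_trans _ _ ((1 + rho / 2) ^+ n)).
          have r2 : 0 <= rho / 2 by rewrite divr_ge0// ltW.
          elim: (n) => [|m IH]; first by rewrite mul0r expr0.
          have m1 : 1 <= (1 + rho / 2) ^+ m by rewrite exprn_ege1// lerDl.
          by rewrite exprS natSr; nra.
        by rewrite lerXn2r ?nnegrE//; [lra|rewrite (le_trans _ Qx)//; lra].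
      have q0 : 0 <= n%:R * (rho / 2) by rewrite mulr_ge0// divr_ge0// ltW.
      have X0 : 0 < X (s0 + d) by have /andP[] := X01 (s0 + d).
      apply: (@le_trans _ _ K); first by rewrite gerBl.
      rewrite /K /f [leRHS]mulrA; apply: ler_pM => //; first exact: ltW.
      by apply: ler_pM => //; exact: ltW.
    change (0 - `|h x * X x| <= f x).
    rewrite sub0r lerNl /f; have [xd|xd] := leP `|x - s0| d.
      have hx := hd x xd; have Qx := Q_in x xd.
      apply: (@le_trans _ _ 0); last exact: normr_ge0.
      rewrite oppr_le0 !mulr_ge0 ?exprn_ge0 ?(ltW Xx0)//.
      exact: le_trans (ltW eta0) hx.
    have /andP[q1 q2] := Q_out x xx0 xd.
    rewrite mulrA -mulNr; apply: (@le_trans _ _ (`|h x * X x| * Q x ^+ n)).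
      by rewrite ler_wpM2r ?exprn_ge0// -normrN ler_norm.
    by rewrite ler_piMr// exprn_ile1.
  have Id : mu.-integrable `[0, +oo[ (EFin \o (fun x => (cst K \_ I) x - `|h x * X x|)).
    exact: (@integrableB _ _ R mu _ mI _ _ IK Iabs).
  have := @le_Rintegral _ _ R mu _ _ _ mI Id If lef.
  rewrite f0 (@RintegralB _ _ R mu _ _ _ mI IK Iabs) subr_le0; apply: le_trans.
  rewrite -Rintegral_mkcondr (_ : _ `&` _ = I).
    have dK (x : R) : is_derive x (1 : R) (fun x => K * x) K by der_eq; ring.
    have sd : s0 - d' <= s0 + d' by lra.
    rewrite (FTC_bounded sd dK (@cont_cst R K)) -/K; lra.
  apply/seteqP; split=> [x []//|x Ix]; split=> //.
  move/IE: (Ix); rewrite ler_norml /= in_itv /= andbT => /andP[h1 h2].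
  by move: ds d'd; lra.
have cr : 0 < c * rho * d' by exact: (mulr_gt0 (mulr_gt0 c0 rho0) d'0).
have := key (Num.truncn (B / (c * rho * d'))).+1.
have := truncnS_gt (B / (c * rho * d')); set n := _.+1.
rewrite ltr_pdivrMr// => h1 h2.
by move: h1; rewrite ltNge => /negP; apply; move: h2; lra.
Qed.

Lemma gauss_unique (h : R -> R) (s : R) : continuous h -> pbd h ->
  (forall a, 0 < a -> \int[mu]_(x in `[0, +oo[) (h x * gauss a x) = 0) ->
  0 <= s -> h s = 0.
Proof.
move=> ch ph h0; have mI := @itv0y_meas R.
have pos x : 0 < x -> h x = 0.
  move=> x0; apply/eqP; rewrite eq_le; apply/andP; split; first exact: gauss_unique_pos.
  rewrite -oppr_le0; apply: (@gauss_unique_pos (fun y => - h y)) => //.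
  - exact: cont_opp.
  - exact: pbd_opp.
  - move=> a a0; rewrite (_ : (fun x => _) = (fun x => -1 * (h x * gauss a x))).
      rewrite RintegralZl ?h0 ?mulr0//; apply: pbd_rapid_int => //; last exact: gauss_rapid.
      exact: cont_meas.
    by apply/funext => y; rewrite mulN1r mulNr.
rewrite le_eqVlt => /predU1P[<-|]; last exact: pos.
have c1 : h n.+1%:R^-1 @[n --> \oo] --> h 0.
  by apply: (cvg_comp _ _ (@cvg_harmonic R)); exact: ch.
have c2 : h n.+1%:R^-1 @[n --> \oo] --> (0 : R).
  rewrite (_ : (fun n : nat => _) = cst 0); first exact: cvg_cst.
  by apply/funext => n; rewrite pos.
exact: (cvg_unique (@Rhausdorff R) c1 c2).
Qed.

(** Since h vanishes on the negative axis, integrating from -oo gives a primitive that is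
    differentiable on both sides of 0, as integration by parts on [0, oo) asks for derivatives at
    every real. *)
Lemma antiderivative (h : R -> R) : continuous h -> (forall x, x <= 0 -> h x = 0) ->
  pbd h -> exists J : R -> R,
  [/\ forall x, is_derive x (1 : R) J (h x), J 0 = 0 & pbd J].
Proof.
move=> ch hneg ph; pose J (x : R) := \int[mu]_(t in `]-oo, x]) h t.
have Jint u : mu.-integrable `]-oo, u] (EFin \o h).
  have := int_restrict (itv_meas `]-oo, u]%R) (itv_meas `[0, u]%R) (int_itv_cont 0 u ch).
  apply: eq_integrable => // x; rewrite inE /= in_itv /= => xu.
  congr EFin; rewrite patchE; case: ifPn => //.
  by rewrite notin_setE /= in_itv /= xu andbT => /negP; rewrite -ltNge => /ltW /hneg.
have dJ (x : R) : is_derive x (1 : R) J (h x).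
  have xx : x < x + 1 by rewrite ltrDl.
  have K := @continuous_FTC1 R h (BInfty _ true) x (x + 1) xx (Jint _).
  have [D E] : derivable J x 1 /\ J^`()%classic x = h x.
    by apply: K; [exact: ltNyr|exact: ch].
  by apply: DeriveDef => //; rewrite -derive1E.
have J0 : J 0 = 0.
  rewrite /J (@eq_Rintegral _ _ _ mu _ (cst 0)) ?Rintegral_cst ?mul0r//.
  by move=> x; rewrite inE /= in_itv /= => /hneg.
exists J; split=> //.
have [m [c [c0 hc]]] := pbd_ge0 ph; exists m.+1, c => x.
have [x0|x0] := leP 0 x.
  have := @MVT_le R J h 0 x (c * (1 + `|x|) ^+ m) x0 (fun y _ => dJ y).
  rewrite J0 !subr0 => H; apply: (le_trans (H _)).
    move=> y /andP[y0 yx]; apply: (le_trans (hc y)); rewrite ler_wpM2l//.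
    by rewrite lerXn2r ?nnegrE ?addr_ge0// lerD2l !ger0_norm.
  rewrite exprSr mulrA ler_wpM2l ?mulr_ge0 ?exprn_ge0 ?addr_ge0//.
  by rewrite ger0_norm// lerDr.
have := @MVT_le R J h x 0 0 (ltW x0) (fun y _ => dJ y).
rewrite J0 sub0r normrN mul0r => H; apply: (le_trans (H _)).
  by move=> y /andP[_ y0]; rewrite hneg// normr0.
by rewrite mulr_ge0// exprn_ge0// addr_ge0.
Qed.

End Uniqueness.

(** * The pointwise expansion *)

Section Level2.
Context {R : realType}.
Notation mu := (@lebesgue_measure R).

Lemma cont_max0 : continuous (fun x : R => Num.max x 0).
Proof.
rewrite (_ : (fun x : R => _) = (fun x : R => (x + `|x|) / 2)).
  apply: cont_mul; last exact: cont_cst.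
  by apply: cont_add; [exact: cont_id|exact: norm_cont].
apply/funext => x; have [x0|x0] := leP x 0.
  by rewrite ler0_norm// subrr mul0r.
by rewrite gtr0_norm//; field.
Qed.

Lemma etruncS_cont k n : continuous (@etrunc R k.+1 n).
Proof.
rewrite (_ : etrunc k.+1 n = (fun x => (Num.max (x - Num.sqrt n%:R) 0) ^+ k.+1 / (k.+1)`!%:R)).
  apply: cont_mul; last exact: cont_cst.
  apply: cont_pow => x.
  apply: (@continuous_comp _ _ _ (fun x : R => x - Num.sqrt n%:R) (fun y => Num.max y 0)).
    by apply: cont_add; [exact: cont_id|exact: cont_cst].
  exact: cont_max0.
apply/funext => x; rewrite /etrunc /ptrunc; case: ifPn => h.
  by rewrite max_l// subr_ge0.
by rewrite max_r ?expr0n ?mul0r// subr_le0 ltW// ltNge.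
Qed.

Lemma N3kS_cont k : continuous (@N3k R k.+1).
Proof.
move=> x; set K := (Num.truncn ((`|x| + 1) ^+ 2)).+1.
have h : \forall y \near x, N3k k.+1 y = \sum_(0 <= n < K) (r3 n)%:R * etrunc k.+1 n y.
  have : \forall y \near x, `|x - y| < 1.
    by apply: (@cvgr_dist_lt _ _ _ (nbhs x) _ id x) => //; exact: cvg_id.
  apply: filterS => y xy; apply: N3k_sum.
  apply: le_lt_trans (truncnS_gt _); rewrite -[y ^+ 2]real_normK ?num_real//.
  rewrite lerXn2r ?nnegrE ?addr_ge0//.
  have := ler_normB x (x - y); rewrite opprB addrC subrK => /le_trans; apply.
  by rewrite lerD2l ltW.
have C := @cont_sum R K (fun n y => (r3 n)%:R * etrunc k.+1 n y)
  (fun n => cont_mul (@cont_cst R _) (@etruncS_cont k n)) x.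
rewrite /continuous_at (nbhs_singleton h); apply: cvg_trans C.
apply: near_eq_cvg; move: h; apply: filterS => y ->.
by [].
Qed.

Lemma r3_0 : r3 0 = 1%N.
Proof.
rewrite (@r3_card 0)//.
rewrite (eq_card (B := {ffun 'I_3 -> 'I_(0.*2.+1)})); first by rewrite card_ffun !card_ord.
by move=> f; rewrite !inE -leqn0 (leq_trans (@boxv_sq3 0 f)).
Qed.

Definition sinc (x : R) : R := if x == 0 then 1 else sin x / x.

Lemma sin_sub_le (x : R) : 0 <= x -> `|sin x - x| <= x * x.
Proof.
move=> x0.
have dc (y : R) : is_derive y (1 : R) (fun y => cos y) (- sin y) by der_eq; ring.
have ds (y : R) : is_derive y (1 : R) (fun y => sin y - y) (cos y - 1) by der_eq; ring.
have hc y : 0 <= y <= x -> `|cos y - 1| <= x.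
  move=> /andP[y0 yx]; have := @MVT_le R _ _ 0 y 1 y0 (fun z _ => dc z).
  rewrite cos0 mul1r subr0 => H; apply: le_trans (H _) yx => z _.
  by rewrite normrN ler_norml sin_geN1 sin_le1.
have := @MVT_le R _ _ 0 x x x0 (fun z _ => ds z) hc.
by rewrite sin0 !subr0.
Qed.

Lemma sinc_sub_le (x : R) : `|sinc x - 1| <= `|x|.
Proof.
wlog x0 : x / 0 <= x.
  move=> h; have [/h//|x0] := leP 0 x; have := h (- x).
  rewrite oppr_ge0 (ltW x0) normrN /sinc oppr_eq0 sinN invrN mulrNN.
  by apply.
rewrite /sinc; case: eqP => [_|/eqP xn]; first by rewrite subrr normr0.
have xp : 0 < x by rewrite lt_neqAle eq_sym xn.
have -> : sin x / x - 1 = (sin x - x) / x by field.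
by rewrite normrM [X in _ * X]ger0_norm ?invr_ge0// ler_pdivrMr// (ger0_norm x0) sin_sub_le.
Qed.

Lemma sin_le_abs (x : R) : `|sin x| <= `|x|.
Proof.
wlog x0 : x / 0 <= x.
  move=> h; have [/h//|x0] := leP 0 x; have := h (- x).
  by rewrite oppr_ge0 (ltW x0) sinN !normrN; apply.
have ds (y : R) : is_derive y (1 : R) (fun y => sin y) (cos y) by der_eq; ring.
have := @MVT_le R _ _ 0 x 1 x0 (fun z _ => ds z).
rewrite sin0 !subr0 mul1r (ger0_norm x0); apply => y _.
by rewrite ler_norml cos_geN1 cos_le1.
Qed.

Lemma sinc_le1 (x : R) : `|sinc x| <= 1.
Proof.
rewrite /sinc; case: eqP => [_|/eqP xn]; first by rewrite normr1.
by rewrite normrM normfV ler_pdivrMr ?normr_gt0// mul1r sin_le_abs.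
Qed.

Lemma sinc_cont : continuous sinc.
Proof.
move=> x; have [->|xn] := eqVneq x 0.
  have -> : continuous_at 0 sinc = (sinc y @[y --> (0 : R)] --> (1 : R)).
    by rewrite /continuous_at {2}/sinc eqxx.
  apply/cvgrPdist_le => e e0.
  have : \forall y \near (0 : R), `|0 - y| <= e.
    by apply: (@cvgr_dist_le _ _ _ (nbhs (0 : R)) _ id 0) => //; exact: cvg_id.
  apply: filterS => y; rewrite sub0r normrN; apply: le_trans.
  by rewrite distrC sinc_sub_le.
have h : \forall y \near x, sinc y = sin y / y.
  have : \forall y \near x, y != 0.
    by apply: open_nbhs_nbhs; split=> //; exact: open_neq.
  by apply: filterS => y yn; rewrite /sinc (negbTE yn).
have c : {for x, continuous (fun y : R => sin y / y)}.
  apply: cvgM; first exact: continuous_sin.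
  by apply: cvgV => //; exact: cvg_id.
rewrite /continuous_at (nbhs_singleton h); apply: cvg_trans c.
by apply: near_eq_cvg; move: h; apply: filterS => y ->.
Qed.

(** The quotient [o_term 2 n.+1 s] / s, extended continuously to s = 0 by means of [sinc]. Its bound
    does not depend on s, so the limit s -> 0 may be taken under the sum. *)
Definition oquot (n : nat) (s : R) : R := oamp n.+1 * ((freq n.+1 ^+ 2)^-1 *
  (3 * sinc (freq n.+1 * s) - cos (freq n.+1 * s))).

Lemma o_term2E n (s : R) : o_term 2 n.+1 s = s * oquot n s.
Proof.
have f0 : freq n.+1 != 0 :> R by rewrite gt_eqF// (lt_le_trans ltr01)// freq_ge1.
rewrite o_termE /osc !(creS, cimS) cre0 cim0 /oquot.
set w := freq n.+1 in f0 *; set A := oamp n.+1.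
have -> : sin (w * s) = w * (s * sinc (w * s)).
  rewrite /sinc; case: eqP => [|/eqP ws].
    by move=> /eqP; rewrite mulf_eq0 (negbTE f0) /= => /eqP ->; rewrite mulr0 sin0 mul0r mulr0.
  by rewrite mulrA [RHS]mulrC divfK.
by field.
Qed.

Lemma oquot_le n (s : R) : `|oquot n s| <= 4 * r3inv n.
Proof.
rewrite /oquot normrM.
apply: (@le_trans _ _ ((r3 n.+1)%:R / n.+1%:R * (n.+1%:R^-1 * 4))).
  apply: ler_pM => //; first exact: oamp_le.
  rewrite normrM; apply: ler_pM => //.
    by rewrite ger0_norm ?invr_ge0 ?sqr_ge0// freqV_le.
  apply: (le_trans (ler_normB _ _)); rewrite normrM (ger0_norm (_ : 0 <= 3))//.
  have := sinc_le1 (freq n.+1 * s).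
  have : `|cos (freq n.+1 * s)| <= 1 by rewrite ler_norml cos_geN1 cos_le1.
  by lra.
by rewrite le_eqVlt; apply/orP; left; apply/eqP; rewrite /r3inv; field.
Qed.

Lemma oquot_cont n : continuous (oquot n).
Proof.
apply: cont_mul; first exact: cont_cst.
apply: cont_mul; first exact: cont_cst.
apply: cont_add; last by apply: cont_opp; exact: cont_cosw.
apply: cont_mul; first exact: cont_cst.
move=> x; apply: (@continuous_comp _ _ _ (fun x => freq n.+1 * x)).
  by apply: cont_mul; [exact: cont_cst|exact: cont_id].
exact: sinc_cont.
Qed.

Definition oquot_sum (s : R) : R := limn (series (oquot ^~ s)).

Lemma oquot_sum_cont : continuous oquot_sum.
Proof.
move=> x; apply: (@weierstrass_cont R oquot (fun n => 4 * r3inv n) (`|x| + 1)).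
- exact: oquot_cont.
- by move=> n s _; exact: oquot_le.
- exact: r3invZ_cvg.
- by rewrite ltrDl.
Qed.

Lemma oquot_cvg (s : R) : cvgn (series (oquot ^~ s)).
Proof.
apply: normed_cvg; apply: (@cvg_dominated _ _ (fun n => 4 * r3inv n)) (@r3invZ_cvg R 4).
by move=> n; exact: oquot_le.
Qed.

Lemma o_sum2E (s : R) : o_sum 2 s = s * oquot_sum s.
Proof.
apply: cvg_lim => //.
rewrite (_ : series _ = (fun N => s * series (oquot ^~ s) N)).
  by apply: cvgM; [exact: cvg_cst|exact: oquot_cvg].
by apply/funext => N; rewrite /series /= mulr_sumr; apply: eq_bigr => n _; exact: o_term2E.
Qed.

Lemma oquot_sum0 : oquot_sum 0 = - C_coef R 0.
Proof.
apply: cvg_lim => //; have := @o_term0_series R 0.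
rewrite (_ : (fun n => _) = (oquot ^~ 0))//.
apply/funext => n; rewrite o_term0 /oquot mulr0 /sinc eqxx cos0 cimS cre0 expr1.
have f0 : freq n.+1 != 0 :> R by rewrite gt_eqF// (lt_le_trans ltr01)// freq_ge1.
by congr (_ * _); move: (freq n.+1 : R) f0 => w w0; field.
Qed.

(** The constant term C_1 of level 2 is zero and does not appear. *)
Definition defect2 (s : R) : R :=
  N3k 2 s - leading_term 2 s - C_coef R 0 * s - o_sum 2 s.

Lemma defect2_cont : continuous defect2.
Proof.
apply: cont_add; last by apply: cont_opp; exact: o_sum_cont.
apply: cont_add; last by apply: cont_opp; apply: cont_mul; [exact: cont_cst|exact: cont_id].
by apply: cont_add; [exact: N3kS_cont|apply: cont_opp; exact: leading_cont].
Qed.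

Lemma defect2_pbd : pbd defect2.
Proof.
apply: pbd_add; last by apply: pbd_opp; exact: o_sum_pbd.
apply: pbd_add; last by apply: pbd_opp; apply: pbd_mul; [exact: pbd_cst|exact: pbd_id].
by apply: pbd_add; [exact: N3k_pbd|apply: pbd_opp; exact: leading_pbd].
Qed.

Lemma defect2_test (a : R) : 0 < a ->
  \int[mu]_(x in `[0, +oo[) (defect2 x * gauss3 a x) = 0.
Proof.
move=> a0; have mI := @itv0y_meas R; have rg := gauss3_rapid a0.
have [l [h1 h2]] := theta_transform a0.
have pa0 : 0 < pi ^+ 2 / a by rewrite divr_gt0// exprn_gt0// pi_gt0.
have c1 := r3_gauss_cvg pa0 h1; have c2 := r3_gauss_cvg a0 h2.
have E1 : - (\int[mu]_(x in `[0, +oo[) (N3k 2 x * gauss3 a x)) = (2 * gauss0 a * l) ^+ 3.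
  exact: (cvg_unique (@Rhausdorff R) (N3_test a0) c2).
have E2 : \int[mu]_(x in `[0, +oo[) (o_sum 2 x * gauss3 a x) =
    - ((2 * gauss0 a) ^+ 3 * (l ^+ 3 - 1)).
  apply: (cvg_unique (@Rhausdorff R) (@o_sum_test_cvg R 2 _ (leqnn 2) rg)).
  rewrite /=.
  (* The remainder starts at n = 1, whence the subtraction of the term r_3(0) = 1; that term is
     supplied by [leading_term]. *)
  rewrite (_ : (fun N => _) = (fun N => - ((2 * gauss0 a) ^+ 3 *
    (\sum_(0 <= n < N.+1) (r3 n)%:R * expR (- (pi ^+ 2 / a * n%:R)) - 1)))); last first.
    apply/funext => N; rewrite big_nat_recl//= r3_0 mulr0 oppr0 expR0 mulr1 addrC addKr.
    by rewrite mulr_sumr -sumrN; apply: eq_bigr => n _; exact: o_term_test.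
  apply: cvgN; apply: cvgM; first exact: cvg_cst.
  by apply: cvgB; [move: c1; rewrite -cvg_shiftS|exact: cvg_cst].
have IN : mu.-integrable `[0, +oo[ (EFin \o (fun x => N3k 2 x * gauss3 a x)).
  by apply: pbd_rapid_int => //; [exact: N3k_meas|exact: N3k_pbd].
have IL : mu.-integrable `[0, +oo[ (EFin \o (fun x => leading_term 2 x * gauss3 a x)).
  by apply: pbd_rapid_int => //; [apply: cont_meas => //; exact: leading_cont|exact: leading_pbd].
have IC : mu.-integrable `[0, +oo[ (EFin \o (fun x => C_coef R 0 * x * gauss3 a x)).
  apply: pbd_rapid_int => //.
  by apply: pbd_mul; [exact: pbd_cst|exact: pbd_id].
have IO : mu.-integrable `[0, +oo[ (EFin \o (fun x => o_sum 2 x * gauss3 a x)).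
  by apply: pbd_rapid_int => //; [apply: cont_meas => //; exact: o_sum_cont|exact: o_sum_pbd].
rewrite (_ : (fun x => _) = (fun x => N3k 2 x * gauss3 a x - leading_term 2 x * gauss3 a x
  - C_coef R 0 * x * gauss3 a x - o_sum 2 x * gauss3 a x)); last first.
  by apply/funext => x; rewrite /defect2; ring.
have I1 : mu.-integrable `[0, +oo[
    (EFin \o (fun x => N3k 2 x * gauss3 a x - leading_term 2 x * gauss3 a x)).
  exact: (@integrableB _ _ R mu _ mI _ _ IN IL).
have I2 : mu.-integrable `[0, +oo[
    (EFin \o (fun x => N3k 2 x * gauss3 a x - leading_term 2 x * gauss3 a x
      - C_coef R 0 * x * gauss3 a x)).
  exact: (@integrableB _ _ R mu _ mI _ _ I1 IC).
rewrite (@RintegralB _ _ R mu _ _ _ mI I2 IO) (@RintegralB _ _ R mu _ _ _ mI I1 IC).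
rewrite (@RintegralB _ _ R mu _ _ _ mI IN IL) E2 linear_test// leading_test//.
move/eqP: E1; rewrite eqr_oppLR => /eqP ->.
by ring.
Qed.

Lemma pbd_max0 (f : R -> R) : pbd f -> pbd (fun x => f (Num.max x 0)).
Proof.
move=> /pbd_ge0[m [c [c0 h]]]; exists m, c => x; apply: (le_trans (h _)).
rewrite ler_wpM2l// lerXn2r ?nnegrE ?addr_ge0// lerD2l.
by have [x0|x0] := leP x 0; rewrite ?normr0.
Qed.

Lemma cont_comp_max0 (f : R -> R) : continuous f ->
  continuous (fun x : R => f (Num.max x 0)).
Proof.
move=> cf x; apply: (@continuous_comp _ _ _ (fun x : R => Num.max x 0)).
  exact: cont_max0.
exact: cf.
Qed.

(* The test functions g''' do not see multiples of s: the orthogonality of the defect D to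
   all of them gives s J = 4 s^3 D with J' = 12 s D, hence D is linear. *)
Lemma defect2_linear : exists c : R, forall s : R, 0 < s -> defect2 s = c * s.
Proof.
have mI := @itv0y_meas R.
(* The maximum extends 12 s D by zero to the negative axis, as required for the primitive J. *)
pose h (x : R) : R := 12 * Num.max x 0 * defect2 (Num.max x 0).
have ch : continuous h.
  apply: cont_mul; last by apply: cont_comp_max0; exact: defect2_cont.
  by apply: cont_mul; [exact: cont_cst|exact: cont_max0].
have ph : pbd h.
  apply: pbd_mul; last by apply: pbd_max0; exact: defect2_pbd.
  by apply: pbd_mul; [exact: pbd_cst|apply: (@pbd_max0 id); exact: pbd_id].
have hneg x : x <= 0 -> h x = 0 by move=> x0; rewrite /h max_r// mulr0 mul0r.
have [J [dJ J0 pJ]] := antiderivative ch hneg ph.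
have cJ := der_cont dJ.
(* The test reads 12 a^2 int(x D g) - 8 a^3 int(x^3 D g) = 0. Replacing 12 x D by J' and integrating
   by parts gives 12 int(x D g) = 2 a int(x J g), so both terms carry the same power of a and int(H
   g) = 0 for every a > 0. *)
pose H (x : R) := x * J x - 4 * (x ^+ 3 * defect2 x).
have cx3 : continuous (fun x : R => x ^+ 3 * defect2 x).
  by apply: cont_mul; [apply: cont_pow; exact: cont_id|exact: defect2_cont].
have px3 : pbd (fun x : R => x ^+ 3 * defect2 x).
  by apply: pbd_mul; [apply: pbd_pow; exact: pbd_id|exact: defect2_pbd].
have cxJ : continuous (fun x : R => x * J x) by apply: cont_mul => //; exact: cont_id.
have pxJ : pbd (fun x : R => x * J x) by apply: pbd_mul => //; exact: pbd_id.
have cx1 : continuous (fun x : R => x * defect2 x).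
  by apply: cont_mul; [exact: cont_id|exact: defect2_cont].
have px1 : pbd (fun x : R => x * defect2 x).
  by apply: pbd_mul; [exact: pbd_id|exact: defect2_pbd].
have H0 s : 0 <= s -> H s = 0.
  apply: gauss_unique.
  - by apply: cont_add => //; apply: cont_opp; apply: cont_mul => //; exact: cont_cst.
  - by apply: pbd_add => //; apply: pbd_opp; apply: pbd_mul => //; exact: pbd_cst.
  move=> a a0; have rg := gauss_rapid a0.
  have I3 : mu.-integrable `[0, +oo[ (EFin \o (fun x => x ^+ 3 * defect2 x * gauss a x)).
    by apply: pbd_rapid_int => //; exact: cont_meas.
  have I1 : mu.-integrable `[0, +oo[ (EFin \o (fun x => x * defect2 x * gauss a x)).
    by apply: pbd_rapid_int => //; exact: cont_meas.
  have IJ : mu.-integrable `[0, +oo[ (EFin \o (fun x => x * J x * gauss a x)).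
    by apply: pbd_rapid_int => //; exact: cont_meas.
  have := defect2_test a0.
  rewrite (_ : (fun x => _) = (fun x => 12 * a ^+ 2 * (x * defect2 x * gauss a x)
    - 8 * a ^+ 3 * (x ^+ 3 * defect2 x * gauss a x))); last first.
    by apply/funext => x; rewrite /gauss3; ring.
  rewrite (@RintegralB _ _ R mu _ _ _ mI (int_mul _ mI I1) (int_mul _ mI I3)).
  rewrite !RintegralZl// => T1.
  have := gauss_IBP 0 a0 dJ ch pJ ph; rewrite J0 mul0r oppr0 add0r.
  rewrite (@eq_Rintegral _ _ _ mu _ (fun x => 12 * (x * defect2 x * gauss a x))); last first.
    move=> x; rewrite inE /= in_itv /= andbT => x0; rewrite /h max_l//; ring.
  rewrite (_ : (fun x => J x * _) = (fun x => - (2 * a) * (x * J x * gauss a x))); last first.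
    by apply/funext => x; ring.
  rewrite !RintegralZl// mulNr opprK => T2.
  rewrite (_ : (fun x => _) = (fun x => x * J x * gauss a x
    - 4 * (x ^+ 3 * defect2 x * gauss a x))); last by apply/funext => x; rewrite /H; ring.
  rewrite (@RintegralB _ _ R mu _ _ _ mI IJ (int_mul _ mI I3)) RintegralZl//.
  set A := (\int[mu]_(x in _) (x * defect2 x * _)) in T1 T2 *.
  set B := (\int[mu]_(x in _) (x ^+ 3 * defect2 x * _)) in T1 *.
  set C := (\int[mu]_(x in _) (x * J x * _)) in T2 *.
  have a2 : 2 * a ^+ 3 != 0 by rewrite mulf_neq0 ?expf_neq0 ?gt_eqF.
  apply: (mulfI a2); rewrite mulr0 -T1.
  have -> : 2 * a ^+ 3 * (C - 4 * B) = a ^+ 2 * (2 * a * C) - 8 * a ^+ 3 * B by ring.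
  by rewrite -T2; ring.
have JE s : 0 < s -> J s = 4 * s ^+ 2 * defect2 s.
  move=> s0; have := H0 s (ltW s0); rewrite /H => /eqP.
  rewrite (_ : _ - _ = s * (J s - 4 * s ^+ 2 * defect2 s)); last by ring.
  by rewrite mulf_eq0 gt_eqF//= subr_eq0 => /eqP.
(* J = 4 s^2 D and J' = 12 s D give s J' = 3 J; so J / s^3 is constant and D is a multiple of s. *)
pose q (s : R) := J s * (s ^+ 3)^-1.
have dq (s : R) : 0 < s -> is_derive s (1 : R) q 0.
  move=> s0; have sN : s != 0 by rewrite gt_eqF.
  have d1 := dJ s.
  have d2 : is_derive s (1 : R) (fun s => (s ^+ 3)^-1) (- (3 * s ^+ 2) / (s ^+ 3) ^+ 2).
    apply: (der_recip (f := fun s : R => s ^+ 3)); first by rewrite expf_neq0.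
    by der_eq; ring.
  rewrite /q; der_eq; rewrite (JE s s0) /h max_l ?(ltW s0)//.
  by field.
exists (J 1 / 4) => s s0.
have qE (u v : R) : 0 < u -> u <= v -> q v = q u.
  move=> u0 uv; apply/eqP; rewrite -subr_eq0 -normr_le0 -[leRHS](mul0r (v - u)).
  apply: (@MVT_le R q (fun=> 0) u v 0 uv) => y /andP[uy _]; last by rewrite normr0.
  by apply: dq; exact: lt_le_trans uy.
have qs : q s = q 1 by have [s1|/ltW s1] := leP s 1; rewrite (qE _ _ _ s1).
move: qs; rewrite /q expr1n invr1 mulr1 (JE s s0) => <-.
by field; rewrite gt_eqF.
Qed.

Lemma defect2_zero (s : R) : 0 <= s -> defect2 s = 0.
Proof.
move=> s0; have [c hc] := defect2_linear.
suff c0 : c = 0.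
  move: s0; rewrite le_eqVlt => /predU1P[<-|]; last by move=> /hc ->; rewrite c0 mul0r.
  rewrite /defect2 (@N3k_sum R 2 0 1); last by rewrite expr0n ltr01.
  rewrite big_nat1 /etrunc sqrtr0 lexx ptruncS0 !mulr0 leading0 o_sum0// !subr0.
  by [].
(* On ]0, 1[ only the origin is counted, N_{3,2}(s) = s^2 / 2, and E is the defect divided by s. Its
   value at 0 is - C_0 - [oquot_sum 0] = 0. *)
pose E (s : R) := 2^-1 * s - 8 * pi / 5`!%:R * s ^+ 4 - C_coef R 0 - oquot_sum s.
have cE : continuous E.
  apply: cont_add; last by apply: cont_opp; exact: oquot_sum_cont.
  apply: cont_add; last exact: cont_cst.
  apply: cont_add; first by apply: cont_mul; [exact: cont_cst|exact: cont_id].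
  by apply: cont_opp; apply: cont_mul; [exact: cont_cst|apply: cont_pow; exact: cont_id].
have EE s' : 0 < s' < 1 -> E s' = c.
  move=> /andP[s0' s1]; have sN : s' != 0 by rewrite gt_eqF.
  apply: (mulIf sN); rewrite -hc// /defect2 (@N3k_sum R 2 s' 1); last first.
    by rewrite expr_lt1// ltW.
  rewrite big_nat1 r3_0 /etrunc sqrtr0 (ltW s0') /ptrunc subr0 o_sum2E /leading_term /E.
  rewrite (_ : 2`!%:R = 2 :> R)//; move: (5`!%:R : R) => F.
  by ring.
(* The shift by 2 keeps 1 / (n+2) strictly below 1. *)
have c1 : E n.+2%:R^-1 @[n --> \oo] --> E 0.
  have h : (n.+2%:R^-1 : R) @[n --> \oo] --> (0 : R).
    by have := @cvg_harmonic R; rewrite -cvg_shiftS.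
  by apply: (cvg_comp _ _ h); exact: cE.
have c2 : E n.+2%:R^-1 @[n --> \oo] --> c.
  rewrite (_ : (fun n : nat => _) = cst c); first exact: cvg_cst.
  apply/funext => n; apply: EE; rewrite invr_gt0 ltr0n /= invf_lt1// ltr1n.
  by [].
rewrite (cvg_unique (@Rhausdorff R) c2 c1) /E mulr0 expr0n mulr0 subrr oquot_sum0.
by rewrite opprK sub0r addrC subrr.
Qed.

Lemma N3k_2 (s : R) : 0 <= s ->
  N3k 2 s = leading_term 2 s + \sum_(m < 2) poly_term 2 m s + o_sum 2 s.
Proof.
move=> /defect2_zero; rewrite /defect2 => /eqP; rewrite subr_eq0 => /eqP <-.
rewrite !big_ord_recl big_ord0 /poly_term /=.
have -> : C_coef R 1 = 0 by [].
by rewrite (_ : bump 0 0 = 1%N)// fact0 !divr1 expr1; ring.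
Qed.

End Level2.

(** * Levels above two by integration *)

Section AllLevels.
Context {R : realType}.
Notation mu := (@lebesgue_measure R).

Lemma poly_term_der k m (s : R) : is_derive s (1 : R) (poly_term k.+1 m.+1) (poly_term k m s).
Proof.
rewrite /poly_term (_ : (k.+1 - 1 - m.+1 = k - 1 - m)%N); last by lia.
der_eq; rewrite factS natrM; have := natSr (R := R) m.
have : m.+1%:R != 0 :> R by rewrite pnatr_eq0.
have : m`!%:R != 0 :> R by rewrite pnatr_eq0 -lt0n fact_gt0.
by move: (m`!%:R : R) (m.+1%:R : R) => F M F0 M0 _; field; rewrite F0.
Qed.

Lemma poly_term_cont k m : continuous (@poly_term R k m).
Proof. by apply: cont_mul; [exact: cont_cst|apply: cont_pow; exact: cont_id]. Qed.

Lemma poly_term_pbd k m : pbd (@poly_term R k m).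
Proof. by apply: pbd_mul; [exact: pbd_cst|apply: pbd_pow; exact: pbd_id]. Qed.

Lemma poly_term0 k (s : R) : poly_term k.+1 0 s = C_coef R k.
Proof. by rewrite /poly_term subn0 subn1 fact0 divr1 expr0 mulr1. Qed.

Lemma poly_termS0 k m : poly_term k m.+1 0 = 0 :> R.
Proof. by rewrite /poly_term expr0n mulr0. Qed.

Lemma o_sumS0 k : (2 <= k)%N -> o_sum k.+1 0 = - C_coef R k.
Proof. by move=> k2; apply: cvg_lim => //; exact: o_term0_series. Qed.

Lemma o_sum_int k (s : R) : (2 <= k)%N -> 0 <= s ->
  \int[mu]_(x in `[0, s]) o_sum k x = o_sum k.+1 s - o_sum k.+1 0.
Proof.
move=> k2 s0; have mI := itv_meas `[0, s]%R.
have [_ c1] := @Rdominated R `[0, s] (fun N x => \sum_(0 <= n < N) o_term k n.+1 x)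
  (o_sum k) (fun s : R => 2 * (`|s| + k.+1%:R) * r3tot) mI
  (fun N => cont_meas mI (cont_sum (fun n => @o_term_cont R k n.+1)))
  (fun x _ => @o_sum_cvg R k x k2) (int_itv_cont 0 s (@obound_cont R k))
  (fun N x _ => @o_partial_le R k N x k2).
have k3 : (2 <= k.+1)%N by exact: leqW.
have c2 := cvgB (@o_sum_cvg R k.+1 s k3) (@o_sum_cvg R k.+1 0 k3).
apply: (cvg_unique (@Rhausdorff R) c1).
rewrite (_ : (fun N => _) = (fun N => \sum_(0 <= n < N) o_term k.+1 n.+1 s -
  \sum_(0 <= n < N) o_term k.+1 n.+1 0)); first exact: c2.
apply/funext => N.
apply: (@FTC_bounded R (fun x => \sum_(0 <= n < N) o_term k.+1 n.+1 x) _ 0 s s0).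
  move=> x; exact: (@der_sum R N (fun n => o_term k.+1 n.+1) (fun n => o_term k n.+1) x
    (fun n => o_term_der k n x)).
by apply: cont_sum => n; exact: o_term_cont.
Qed.

Lemma N3k_expansion k (s : R) : (2 <= k)%N -> 0 <= s ->
  N3k k s = leading_term k s + \sum_(m < k) poly_term k m s + o_sum k s.
Proof.
elim: k s => [//|k IH] s; rewrite leq_eqVlt => /predU1P[[<-]|]; first exact: N3k_2.
rewrite ltnS => k2 s0; have mI := itv_meas `[0, s]%R.
pose P (x : R) := leading_term k x + \sum_(0 <= m < k) poly_term k m x.
have cP : continuous P.
  by apply: cont_add; [exact: leading_cont|apply: cont_sum => m; exact: poly_term_cont].
rewrite -(big_mkord xpredT (fun m => poly_term k.+1 m s)) /= (@eq_Rintegral _ _ _ mu _ (fun x => P x + o_sum k x)); last first.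
  move=> x; rewrite inE /= in_itv /= => /andP[x0 _].
  by rewrite IH// /P big_mkord.
rewrite (@RintegralD _ _ R mu _ _ _ mI (int_itv_cont 0 s cP)
  (int_itv_cont 0 s (o_sum_cont k2))) o_sum_int// o_sumS0// opprK.
rewrite (@FTC_bounded R (fun x => leading_term k.+1 x +
   \sum_(0 <= m < k) poly_term k.+1 m.+1 x) P _ _ s0 _ cP).
  rewrite leading0 (_ : \sum_(0 <= m < k) poly_term k.+1 m.+1 0 = 0); last first.
    by rewrite big1// => m _; exact: poly_termS0.
  by rewrite big_nat_recl//= poly_term0; ring.
move=> x; have d1 := leading_der k x.
have d2 := @der_sum R k (fun m => poly_term k.+1 m.+1) (fun m => poly_term k m) x
  (fun m => poly_term_der k m x).
by rewrite /P; der.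
Qed.

End AllLevels.

(** * Tempered distributions on the half-line *)

Section RealSchwartz.
Context {R : realType}.
Notation mu := (@lebesgue_measure R).
Implicit Types (psi f : R -> R) (N : nat).

(** Real test functions, to which the calculus above applies directly; complex ones are treated
    through their real and imaginary parts. *)
Definition rschwartz psi : Prop := smooth psi /\
  forall a b : nat, exists M : R, forall x, `|x| ^+ a * `|derive1n b psi x| <= M.

(** One number M bounds all seminorms of order below N. Continuity of a functional and uniformity on
    bounded sets both reduce to it, and a derivative costs one unit of N. *)
Definition wbounded N psi (M : R) : Prop := forall (a b : nat) x,
  (a < N)%N -> (b < N)%N -> `|x| ^+ a * `|derive1n b psi x| <= M.

Lemma wbounded_der N psi M : wbounded N.+1 psi M -> wbounded N (psi^`()) M.
Proof. by move=> h a b x aN bN; rewrite -derive1Sn; apply: h => //; exact: leqW. Qed.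

Lemma wbounded_le N psi M m x : (m < N)%N -> wbounded N psi M ->
  (1 + `|x|) ^+ m * `|psi x| <= 2 ^+ m.+1 * M.
Proof.
move=> mN h; have N0 : (0 < N)%N by exact: leq_trans mN.
have h0 := h 0%N 0%N x N0 N0; have hm := h m 0%N x mN N0.
rewrite /= in h0 hm.
have : (1 + `|x|) ^+ m <= 2 ^+ m * (1 + `|x| ^+ m).
  have [x1|x1] := leP `|x| 1.
    apply: (@le_trans _ _ (2 ^+ m)); first by rewrite lerXn2r ?nnegrE ?addr_ge0//; lra.
    by rewrite ler_pMr ?exprn_gt0// lerDl exprn_ge0.
  apply: (@le_trans _ _ ((2 * `|x|) ^+ m)).
    by rewrite lerXn2r ?nnegrE ?addr_ge0 ?mulr_ge0//; lra.
  by rewrite exprMn ler_pM2l ?exprn_gt0// lerDr.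
move=> /(ler_wpM2r (normr_ge0 (psi x))) /le_trans; apply.
rewrite exprSr -!mulrA ler_pM2l ?exprn_gt0// mulrDl -[1 in leLHS](expr0 `|x|).
by apply: (le_trans (lerD h0 hm)); rewrite mulrDl mul1r.
Qed.

Lemma rschwartz_wbounded psi N : rschwartz psi -> exists M, wbounded N psi M.
Proof.
move=> [_ h]; have [M hM] := choice (fun p : nat * nat => h p.1 p.2).
exists (\sum_(a < N) \sum_(b < N) `|M (nat_of_ord a, nat_of_ord b)|) => a b x aN bN.
apply: (le_trans (hM (a, b) x)); apply: (le_trans (ler_norm _)).
rewrite (bigD1 (Ordinal aN))//= (bigD1 (Ordinal bN))//= -addrA lerDl.
by rewrite addr_ge0// sumr_ge0// => i _; rewrite sumr_ge0.
Qed.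

Lemma rschwartz_der psi : rschwartz psi -> rschwartz (psi^`()).
Proof.
move=> [s h]; split; first by move=> n x; rewrite -derive1Sn; exact: s.
by move=> a b; have [M hM] := h a b.+1; exists M => x; rewrite -derive1Sn.
Qed.

Lemma rschwartz_is_derive psi (x : R) : rschwartz psi -> is_derive x (1 : R) psi (psi^`() x).
Proof. by move=> [s _]; apply: DeriveDef; [exact: (s 0%N)|rewrite derive1E]. Qed.

Lemma rschwartz_rapid psi : rschwartz psi -> rapid psi.
Proof.
move=> rp; split; first by apply: der_cont => x; exact: rschwartz_is_derive.
move=> m; have [M hM] := rschwartz_wbounded m.+1 rp; exists (2 ^+ m.+1 * M) => x.
exact: (wbounded_le x (ltnSn m) hM).
Qed.

Definition halfint f psi : R := \int[mu]_(x in `[0, +oo[) (f x * psi x).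

(** Growth of order m and the integrable weight 1 / (1 + x^2) use (1 + |x|)^(m+2), hence seminorms
    of order below m + 3. The bound is linear in c, so that the smallness of the n-th term of a
    series survives. *)
Lemma halfint_bound f psi (c M : R) m : measurable_fun (`[0, +oo[ : set R) f ->
  0 <= c -> (forall x, `|f x| <= c * (1 + `|x|) ^+ m) -> rschwartz psi ->
  wbounded m.+3 psi M ->
  `|halfint f psi| <= 2 ^+ m.+3 * (\int[mu]_(x in `[0, +oo[) (oneDsqr x)^-1) * M * c.
Proof.
move=> mf c0 fc rp wb; have mI := @itv0y_meas R.
have Ib := int_mul (c * (2 ^+ m.+3 * M)) mI (oneDsqrV_int mI).
apply: (@le_trans _ _ (\int[mu]_(x in `[0, +oo[) (c * (2 ^+ m.+3 * M) * (oneDsqr x)^-1))).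
  apply: Rint_bound => //.
    apply: measurable_funM => //; apply: cont_meas => //.
    by have [] := rschwartz_rapid rp.
  move=> x _; have o0 : 0 < oneDsqr x by exact: (lt_le_trans ltr01 (oneDsqr_ge1 x)).
  rewrite ler_pdivlMr// normrM.
  apply: (@le_trans _ _ (c * ((1 + `|x|) ^+ m.+2 * `|psi x|))).
    rewrite -[m.+2]addn2 exprD -!mulrA mulrC !mulrA mulrC !mulrA.
    rewrite [X in X <= _](_ : _ = oneDsqr x * `|psi x| * `|f x|); last by ring.
    rewrite [X in _ <= X](_ : _ = (1 + `|x|) ^+ 2 * `|psi x| * (c * (1 + `|x|) ^+ m));
      last by ring.
    apply: ler_pM => //.
    rewrite ler_wpM2r// /oneDsqr -[x ^+ 2]real_normK ?num_real// sqrrD expr1n mul1r.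
    by rewrite lerD2r lerDl mulrn_wge0.
  by rewrite ler_wpM2l//; exact: (wbounded_le x (ltnSn _) wb).
rewrite RintegralZl//; last exact: oneDsqrV_int.
by rewrite le_eqVlt; apply/orP; left; apply/eqP; ring.
Qed.

(** Real counterpart of [dotS']. The support condition is the stronger one that L kills every test
    function vanishing on [0, oo), without compactness of its support. *)
Definition rtempered (L : (R -> R) -> R) : Prop :=
  [/\ forall (c d : R) f g, rschwartz f -> rschwartz g ->
        L (fun x => c * f x + d * g x) = c * L f + d * L g,
      exists N (C : R), 0 <= C /\ forall psi M, rschwartz psi -> wbounded N psi M ->
        `|L psi| <= C * M &
      forall psi, rschwartz psi -> (forall x, 0 <= x -> psi x = 0) -> L psi = 0].

Lemma halfint_int f psi : measurable_fun (`[0, +oo[ : set R) f -> pbd f -> rschwartz psi ->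
  mu.-integrable `[0, +oo[ (EFin \o (fun x => f x * psi x)).
Proof. by move=> mf pf /rschwartz_rapid rp; apply: pbd_rapid_int => //; exact: itv0y_meas. Qed.

Lemma halfint_lin f (c d : R) g h : measurable_fun (`[0, +oo[ : set R) f -> pbd f ->
  rschwartz g -> rschwartz h ->
  halfint f (fun x => c * g x + d * h x) = c * halfint f g + d * halfint f h.
Proof.
move=> mf pf sg sh; have mI := @itv0y_meas R.
have Ig := halfint_int mf pf sg; have Ih := halfint_int mf pf sh.
rewrite /halfint (_ : (fun x => _) = (fun x => c * (f x * g x) + d * (f x * h x))).
  by rewrite (@RintegralD _ _ R mu _ _ _ mI (int_mul c mI Ig) (int_mul d mI Ih)) !RintegralZl.
by apply/funext => x; ring.
Qed.

Lemma halfint_eq0 f psi : (forall x, 0 <= x -> psi x = 0) -> halfint f psi = 0.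
Proof.
move=> h; rewrite /halfint (@eq_Rintegral _ _ _ mu _ (cst 0)) ?Rintegral_cst ?mul0r//.
by move=> x; rewrite inE /= in_itv /= andbT => /h ->; rewrite mulr0.
Qed.

Lemma halfint_rtempered f : measurable_fun (`[0, +oo[ : set R) f -> pbd f -> rtempered (halfint f).
Proof.
move=> mf pf; split.
- by move=> c d g h sg sh; exact: halfint_lin.
- have [m [c [c0 fc]]] := pbd_ge0 pf.
  exists m.+3, (2 ^+ m.+3 * (\int[mu]_(x in `[0, +oo[) (oneDsqr x)^-1) * c); split.
    apply: mulr_ge0 => //; apply: mulr_ge0; first exact: exprn_ge0.
    apply: Rintegral_ge0 => x _.
    by rewrite invr_ge0 (le_trans ler01 (oneDsqr_ge1 x)).
  by move=> psi M sp wb; rewrite mulrAC; exact: halfint_bound wb.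
- by move=> psi _; exact: halfint_eq0.
Qed.

Lemma halfint_IBP f f' psi : (forall x : R, is_derive x (1 : R) f (f' x)) -> continuous f' ->
  pbd f -> pbd f' -> rschwartz psi ->
  halfint f' psi = - (f 0 * psi 0) - halfint f (psi^`()).
Proof.
move=> df cf' pf pf' sp; apply: IBP_itvy => //.
- by move=> x; exact: rschwartz_is_derive.
- exact: rschwartz_rapid.
- by apply: rschwartz_rapid; exact: rschwartz_der.
Qed.

End RealSchwartz.

(** * The remainder as a functional on test functions *)

Section Remainder.
Context {R : realType}.
Notation mu := (@lebesgue_measure R).
Notation Rp := (`[0%R, +oo[%classic : set R).
Implicit Types (psi : R -> R).

Definition otest (k n : nat) psi : R := halfint (o_term k n.+1) psi.

Lemma otestS k n psi : rschwartz psi ->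
  otest k n psi = - (o_term k.+1 n.+1 0 * psi 0) - otest k.+1 n (psi^`()).
Proof.
move=> sp; apply: halfint_IBP => //.
- by move=> x; exact: o_term_der.
- exact: o_term_cont.
- exact: o_term_pbd.
- exact: o_term_pbd.
Qed.

(* For k >= 2 the terms themselves are summable with weight r3inv; one integration by parts
   lowers k by one at the cost of one derivative of the test function. *)
Lemma otest_bound k : exists N (C : R), 0 <= C /\ forall n psi M, rschwartz psi ->
  wbounded N psi M -> `|otest k n psi| <= C * M * r3inv n.
Proof.
have down j : (exists N (C : R), 0 <= C /\ forall n psi M, rschwartz psi ->
    wbounded N psi M -> `|otest j.+1 n psi| <= C * M * r3inv n) ->
  exists N (C : R), 0 <= C /\ forall n psi M, rschwartz psi ->
    wbounded N psi M -> `|otest j n psi| <= C * M * r3inv n.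
  move=> [N [C [C0 h]]]; exists N.+1, (j.+2%:R + C); split; first by rewrite addr_ge0.
  move=> n psi M sp wb; rewrite otestS//; apply: (le_trans (ler_normB _ _)).
  rewrite normrN normrM [leRHS](_ : _ = j.+2%:R * r3inv n * M + C * M * r3inv n);
    last by move: (j.+2%:R : R) => c; ring.
  rewrite lerD//; last first.
    by apply: h; [exact: rschwartz_der|exact: wbounded_der].
  apply: ler_pM => //; first exact: o_term0_le.
  by have := wb 0%N 0%N 0 isT isT; rewrite expr0 mul1r.
have base j : (2 <= j)%N -> exists N (C : R), 0 <= C /\ forall n psi M, rschwartz psi ->
    wbounded N psi M -> `|otest j n psi| <= C * M * r3inv n.
  move=> j2; set I := \int[mu]_(x in Rp) (oneDsqr x)^-1.
  have I0 : 0 <= I.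
    by rewrite Rintegral_ge0// => x _; rewrite invr_ge0 (le_trans ler01 (oneDsqr_ge1 x)).
  exists 4%N, (2 ^+ 4 * I * (2 * j.+1%:R)); split; first by rewrite !mulr_ge0.
  move=> n psi M sp wb.
  have := @halfint_bound R (o_term j n.+1) psi (2 * j.+1%:R * r3inv n) M 1.
  rewrite -/I => H; apply: (le_trans (H _ _ _ sp wb)).
  - by apply: cont_meas; [exact: itv0y_meas|exact: o_term_cont].
  - by rewrite !mulr_ge0// r3inv_ge0.
  - move=> x; apply: (le_trans (o_term_le n x j2)); rewrite expr1 [leRHS]mulrAC.
    rewrite ler_wpM2r ?r3inv_ge0// -mulrA ler_pM2l// mulrDr mulr1 addrC lerD2l.
    by rewrite ler_peMl// ler1n.
  by rewrite le_eqVlt; apply/orP; left; apply/eqP; ring.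
case: k => [|[|k]]; last exact: base.
  exact: (down 0%N (down 1%N (base 2%N isT))).
exact: (down 1%N (base 2%N isT)).
Qed.

(** The remainder at every level, including k < 2, where convergence is established only after
    pairing each term with a test function. *)
Definition osum_test (k : nat) psi : R := limn (series (fun n => otest k n psi)).

Lemma otest_abs k psi : rschwartz psi -> cvgn [normed series (fun n => otest k n psi)].
Proof.
move=> sp; have [N [C [C0 h]]] := otest_bound k.
have [M wb] := rschwartz_wbounded N sp.
apply: (@cvg_dominated _ _ (fun n => C * M * r3inv n)); last exact: r3invZ_cvg.
by move=> n; exact: h.
Qed.

Lemma osum_test_cvg k psi : rschwartz psi ->
  \sum_(0 <= n < K) otest k n psi @[K --> \oo] --> osum_test k psi.
Proof. by move=> sp; apply: normed_cvg; exact: otest_abs. Qed.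

Lemma otest_rtempered k n : rtempered (otest k n).
Proof.
apply: halfint_rtempered; last exact: o_term_pbd.
by apply: cont_meas; [exact: itv0y_meas|exact: o_term_cont].
Qed.

Lemma lim_r3invZ (c : R) : limn (series (fun n => c * r3inv n)) = c * r3tot.
Proof.
apply: cvg_lim => //.
rewrite (_ : series _ = (fun K => c * series r3inv K)).
  by apply: cvgM; [exact: cvg_cst|exact: r3inv_cvg].
by apply/funext => K; rewrite /series /= mulr_sumr.
Qed.

Lemma r3tot_ge0 : 0 <= r3tot :> R.
Proof.
apply: limr_ge; first exact: r3inv_cvg.
by near=> K; rewrite /series /= sumr_ge0// => n _; exact: r3inv_ge0.
Unshelve. all: by end_near. Qed.

Lemma osum_test_rtempered k : rtempered (osum_test k).
Proof.
split.
- move=> c d f g sf sg; apply: cvg_lim => //.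
  rewrite (_ : series _ = (fun K => c * (\sum_(0 <= n < K) otest k n f)
    + d * (\sum_(0 <= n < K) otest k n g))).
    by apply: cvgD; (apply: cvgM; [exact: cvg_cst|exact: osum_test_cvg]).
  apply/funext => K; rewrite /series /= !mulr_sumr -big_split; apply: eq_bigr => n _ /=.
  by have [H _ _] := otest_rtempered k n; exact: H.
- have [N [C [C0 h]]] := otest_bound k; exists N, (C * r3tot); split.
    by rewrite mulr_ge0// r3tot_ge0.
  move=> psi M sp wb; rewrite mulrAC -lim_r3invZ /osum_test.
  apply: (@lim_series_norm_le _ _ (fun n => C * M * r3inv n)).
    by move=> n; exact: h.
  exact: r3invZ_cvg.
- move=> psi sp h; apply: cvg_lim => //.
  rewrite (_ : series _ = (fun=> 0)); first exact: cvg_cst.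
  by apply/funext => K; rewrite /series /= big1// => n _; exact: halfint_eq0.
Qed.

Lemma osum_test_halfint k psi : (2 <= k)%N -> rschwartz psi ->
  osum_test k psi = halfint (o_sum k) psi.
Proof.
by move=> k2 sp; apply: cvg_lim => //; apply: o_sum_test_cvg => //; exact: rschwartz_rapid.
Qed.

Lemma osum_testS k psi : rschwartz psi ->
  osum_test k psi = C_coef R k * psi 0 - osum_test k.+1 (psi^`()).
Proof.
move=> sp; apply: cvg_lim => //.
rewrite (_ : series _ = (fun K => - (series (fun n => o_term k.+1 n.+1 0) K * psi 0)
  - \sum_(0 <= n < K) otest k.+1 n (psi^`())%classic)).
  apply: cvgB; last by apply: osum_test_cvg; exact: rschwartz_der.
  rewrite -[C_coef R k]opprK mulNr; apply: cvgN; apply: cvgM; last exact: cvg_cst.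
  exact: o_term0_series.
apply/funext => K; rewrite /series /= mulr_suml -!sumrN -big_split.
by apply: eq_bigr => n _; exact: otestS.
Qed.

Lemma N3k_test k psi : rschwartz psi -> halfint (N3k k) psi =
  halfint (leading_term k) psi + \sum_(m < k) halfint (poly_term k m) psi + osum_test k psi.
Proof.
have mI := @itv0y_meas R.
have high j psi' : (2 <= j)%N -> rschwartz psi' -> halfint (N3k j) psi' =
    halfint (leading_term j) psi' + \sum_(0 <= m < j) halfint (poly_term j m) psi'
    + osum_test j psi'.
  move=> j2 sp; rewrite osum_test_halfint// /halfint.
  have IL : mu.-integrable Rp (EFin \o (fun x => leading_term j x * psi' x)).
    apply: halfint_int => //; last exact: leading_pbd.
    by apply: cont_meas => //; exact: leading_cont.
  have IP m : mu.-integrable Rp (EFin \o (fun x => poly_term j m x * psi' x)).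
    apply: halfint_int => //; last exact: poly_term_pbd.
    by apply: cont_meas => //; exact: poly_term_cont.
  have IS : mu.-integrable Rp
      (EFin \o (fun x => \sum_(0 <= m < j) poly_term j m x * psi' x)).
    exact: (@int_sum R Rp j (fun m x => poly_term j m x * psi' x) mI (fun m _ => IP m)).
  have IO : mu.-integrable Rp (EFin \o (fun x => o_sum j x * psi' x)).
    apply: halfint_int => //; last exact: o_sum_pbd.
    by apply: cont_meas => //; exact: o_sum_cont.
  rewrite -(@Rint_sum R Rp j (fun m x => poly_term j m x * psi' x) mI (fun m _ => IP m)).
  rewrite -(@RintegralD _ _ R mu _ _ _ mI IL IS).
  rewrite -(@RintegralD _ _ R mu _ _ _ mI (int_add mI IL IS) IO).
  apply: eq_Rintegral => x; rewrite inE /= in_itv /= andbT => x0.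
  by rewrite N3k_expansion// -(big_mkord xpredT (fun m => poly_term j m x)) !mulrDl mulr_suml.
have down j : (forall psi', rschwartz psi' -> halfint (N3k j.+1) psi' =
    halfint (leading_term j.+1) psi' + \sum_(0 <= m < j.+1) halfint (poly_term j.+1 m) psi'
    + osum_test j.+1 psi') ->
  forall psi', rschwartz psi' -> halfint (N3k j) psi' =
    halfint (leading_term j) psi' + \sum_(0 <= m < j) halfint (poly_term j m) psi'
    + osum_test j psi'.
  move=> h psi' sp; have sp' := rschwartz_der sp.
  have -> : halfint (N3k j) psi' = - halfint (N3k j.+1) (psi'^`()).
    apply: N3k_IBP; [|exact: rschwartz_rapid|exact: rschwartz_rapid].
    by move=> x; exact: rschwartz_is_derive.
  rewrite h// big_nat_recl//= (osum_testS j sp).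
  have -> : halfint (leading_term j) psi' = - halfint (leading_term j.+1) (psi'^`()).
    have := @halfint_IBP R _ _ psi' (leading_der j) (@leading_cont R j)
      (@leading_pbd R j.+1) (@leading_pbd R j) sp.
    by rewrite leading0 mul0r oppr0 add0r.
  (* The constant term of level j + 1 disappears under differentiation, but its jump at 0 leaves C_j
     psi(0); this cancels the boundary value produced by [osum_testS]. *)
  have -> : halfint (poly_term j.+1 0) (psi'^`()) = - (C_coef R j * psi' 0).
    have d0 (x : R) : is_derive x (1 : R) (poly_term j.+1 0) 0.
      rewrite (_ : poly_term j.+1 0 = (fun=> C_coef R j)); first exact: der_cst.
      by apply/funext => y; exact: poly_term0.
    have := @halfint_IBP R _ _ psi' d0 (@cont_cst R 0) (@poly_term_pbd R j.+1 0)
      (@pbd_cst R 0) sp.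
    rewrite poly_term0 (_ : halfint (fun=> 0) psi' = 0); last first.
      rewrite /halfint (@eq_Rintegral _ _ _ mu _ (cst 0)) ?Rintegral_cst ?mul0r//.
      by move=> x _; rewrite mul0r.
    by move=> /eqP; rewrite eq_sym subr_eq0 => /eqP <-.
  have -> : \sum_(0 <= m < j) halfint (poly_term j m) psi' =
      - \sum_(0 <= m < j) halfint (poly_term j.+1 m.+1) (psi'^`())%classic.
    rewrite -sumrN; apply: eq_bigr => m _.
    have := @halfint_IBP R _ _ psi' (poly_term_der j m) (@poly_term_cont R j m)
      (@poly_term_pbd R j.+1 m.+1) (@poly_term_pbd R j m) sp.
    by rewrite poly_termS0 mul0r oppr0 add0r.
  by ring.
rewrite -(big_mkord xpredT (fun m => halfint (poly_term k m) psi)).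
move: psi; case: k => [|[|k]]; last by move=> psi; exact: high.
  by apply: (down 0%N (down 1%N _)) => psi; exact: high.
by apply: (down 1%N _) => psi; exact: high.
Qed.

End Remainder.

(** * From real functionals to complex distributions *)

Section ComplexLift.
Context {R : realType}.
Notation mu := (@lebesgue_measure R).
Notation S := (schwartz R).
Notation Re := (@complex.Re R).
Notation Im := (@complex.Im R).
Notation Rp := (`[0%R, +oo[%classic : set R).
Implicit Types (f : R -> R) (phi : S) (L : (R -> R) -> R).

Lemma Re_le_normc (z : R[i]) : `|Re z| <= Normc.normc z.
Proof. by case: z => a b /=; rewrite -sqrtr_sqr ler_wsqrtr// lerDl sqr_ge0. Qed.

Lemma Im_le_normc (z : R[i]) : `|Im z| <= Normc.normc z.
Proof. by case: z => a b /=; rewrite -sqrtr_sqr ler_wsqrtr// lerDr sqr_ge0. Qed.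

Lemma normc_le (a b : R) : Normc.normc (Complex a b) <= `|a| + `|b|.
Proof.
rewrite /Normc.normc -[leRHS]ger0_norm ?addr_ge0// -sqrtr_sqr ler_wsqrtr// sqrrD.
by rewrite !real_normK ?num_real// -addrA [X in _ <= _ + X]addrC addrA lerDl mulrn_wge0.
Qed.

Lemma schwartz_is phi : is_schwartz phi.
Proof. by have /asboolP := valP phi. Qed.

Lemma schwartz_re phi : rschwartz (Re \o phi).
Proof.
have [s _ h] := schwartz_is phi; split=> // a b; have [M hM] := h a b.
exists M => x; apply: le_trans (hM x); rewrite ler_wpM2l ?exprn_ge0//.
exact: (Re_le_normc (cderivn b phi x)).
Qed.

Lemma schwartz_im phi : rschwartz (Im \o phi).
Proof.
have [_ s h] := schwartz_is phi; split=> // a b; have [M hM] := h a b.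
exists M => x; apply: le_trans (hM x); rewrite ler_wpM2l ?exprn_ge0//.
exact: (Im_le_normc (cderivn b phi x)).
Qed.

Lemma schwartz_norm_ub a b phi x :
  `|x| ^+ a * Normc.normc (cderivn b phi x) <= schwartz_norm a b phi.
Proof.
apply: ub_le_sup; last by exists x.
have [_ _ h] := schwartz_is phi; have [M hM] := h a b; exists M => _ [y _ <-]; exact: hM.
Qed.

Lemma schwartz_norm_ge0 a b phi : 0 <= schwartz_norm a b phi.
Proof.
apply: le_trans (schwartz_norm_ub a b phi 0); rewrite mulr_ge0 ?exprn_ge0//.
by rewrite (le_trans _ (Re_le_normc _)).
Qed.

Lemma wbounded_reim N phi (M : R) :
  (forall a b, (a < N)%N -> (b < N)%N -> schwartz_norm a b phi <= M) ->
  wbounded N (Re \o phi) M /\ wbounded N (Im \o phi) M.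
Proof.
move=> h; split=> a b x aN bN; apply: le_trans (h a b aN bN);
  apply: le_trans (schwartz_norm_ub a b phi x); rewrite ler_wpM2l ?exprn_ge0//.
- exact: (Re_le_normc (cderivn b phi x)).
- exact: (Im_le_normc (cderivn b phi x)).
Qed.

Lemma ler_sum2 (F : nat -> nat -> R) N a b : (forall i j, 0 <= F i j) ->
  (a < N)%N -> (b < N)%N -> F a b <= \sum_(i < N) \sum_(j < N) F i j.
Proof.
move=> F0 aN bN; rewrite (bigD1 (Ordinal aN))//= (bigD1 (Ordinal bN))//= -addrA lerDl.
by rewrite addr_ge0// sumr_ge0// => i _; rewrite sumr_ge0.
Qed.

Lemma rschwartz_lin (c d : R) f g : rschwartz f -> rschwartz g ->
  rschwartz (fun x => c * f x + d * g x).
Proof.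
move=> [sf hf] [sg hg]; split; first exact: smoothZD.
move=> a b; have [M1 h1] := hf a b; have [M2 h2] := hg a b.
exists (`|c| * M1 + `|d| * M2) => x; rewrite derive1nZD//.
apply: (@le_trans _ _ (`|x| ^+ a * (`|c * derive1n b f x| + `|d * derive1n b g x|))).
  by rewrite ler_wpM2l ?exprn_ge0// ler_normD.
by rewrite mulrDr !normrM !(mulrCA (`|x| ^+ a)) lerD// ler_wpM2l.
Qed.

Definition clift L : S -> R[i]^o := fun phi => Complex (L (Re \o phi)) (L (Im \o phi)).

Lemma clift_dotS' L : rtempered L -> dotS' (clift L).
Proof.
move=> [lin [N [C [C0 bd]]] supp]; split; first split.
- move=> [c d] u v.
  have [ru iu] := (schwartz_re u, schwartz_im u).
  have [rv iv] := (schwartz_re v, schwartz_im v).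
  have Ex x : (Complex c d *: u + v : S) x = Complex c d * u x + v x by [].
  (* The coefficients 1 bring both parts into the shape c f + d g, so that the two-term linearity of
     L applies twice. *)
  pose er x := 1 * (c * (Re \o u) x + (- d) * (Im \o u) x) + 1 * (Re \o v) x.
  pose ei x := 1 * (c * (Im \o u) x + d * (Re \o u) x) + 1 * (Im \o v) x.
  have Er : Re \o (Complex c d *: u + v : S) = er.
    apply/funext => x; apply: (etrans (congr1 Re (Ex x))); rewrite /er !mul1r /=.
    by case: (u x) (v x) => [p q] [r s] /=; rewrite mulNr.
  have Ei : Im \o (Complex c d *: u + v : S) = ei.
    apply/funext => x; apply: (etrans (congr1 Im (Ex x))); rewrite /ei !mul1r /=.
    by case: (u x) (v x) => [p q] [r s] /=.
  have -> : clift L (Complex c d *: u + v) = Complex (L er) (L ei) by rewrite -Er -Ei.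
  rewrite lin//; last exact: rschwartz_lin.
  rewrite lin// lin//; last exact: rschwartz_lin.
  by rewrite lin// !mul1r mulNr.
- exists N, (C + C) => phi; set M := \sum_(a < N) _.
  have [w1 w2] : wbounded N (Re \o phi) M /\ wbounded N (Im \o phi) M.
    apply: wbounded_reim => a b aN bN.
    apply: (@ler_sum2 (fun a b => schwartz_norm a b phi)) => // i j.
    exact: schwartz_norm_ge0.
  apply: (le_trans (normc_le _ _)); rewrite mulrDl lerD//.
    by apply: bd => //; exact: schwartz_re.
  by apply: bd => //; exact: schwartz_im.
move=> phi supp_phi _ hneg.
have p0 x : 0 <= x -> phi x = 0.
  move=> x0; apply: contrapT => /eqP p0.
  have /hneg : supp_phi x by exact: subset_closure.
  by rewrite /= ltNge x0.
rewrite /clift !supp//.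
- exact: schwartz_im.
- by move=> x /p0 /= ->.
- exact: schwartz_re.
- by move=> x /p0 /= ->.
Qed.

Lemma distr_clift f : (forall x, x < 0 -> f x = 0) -> distr f = clift (halfint f).
Proof.
move=> f0; apply/funext => phi.
have E (psi : R -> R) : \int[mu]_x (f x * psi x) = halfint f psi.
  rewrite /halfint [RHS]Rintegral_mkcond; apply: eq_Rintegral => x _.
  rewrite patchE; case: ifPn => //; rewrite notin_setE /= in_itv /= andbT.
  by move=> /negP; rewrite -ltNge => /f0 ->; rewrite mul0r.
by rewrite /distr /clift -!E.
Qed.

Lemma heavisideE (x : R) : heaviside R x = (0 <= x)%R%:R.
Proof.
rewrite /heaviside indicE; congr (nat_of_bool _)%:R.
by apply/idP/idP; rewrite inE.
Qed.

Lemma heaviside_neg f (x : R) : x < 0 -> (heaviside R \* f) x = 0.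
Proof. by rewrite /= heavisideE ltNge => /negbTE ->; rewrite mul0r. Qed.

Lemma distr_heaviside f : distr (heaviside R \* f) = clift (halfint f).
Proof.
rewrite distr_clift; last exact: heaviside_neg.
congr clift; apply/funext => psi; apply: eq_Rintegral => x.
by rewrite inE /= in_itv /= andbT heavisideE => ->; rewrite mul1r.
Qed.

Lemma dotS'_funP f : measurable_fun [set: R] f -> pbd f -> (forall x, x < 0 -> f x = 0) ->
  dotS'_fun f.
Proof.
move=> mf pf f0; split; last first.
  rewrite distr_clift//; apply: clift_dotS'; apply: halfint_rtempered => //.
  by apply: measurable_funS mf.
split; last by have [m [c h]] := pf; exists m, c.
have [m [c [c0 h]]] := pbd_ge0 pf.
split=> //; first exact: openT.
move=> K _ cK; have mK : measurable K by exact: compact_measurable.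
have [B [_ hB]] := compact_bounded cK.
have KB : K `<=` `[- (B + 1), B + 1].
  move=> x Kx /=; rewrite in_itv /= -ler_norml.
  by apply: (hB (B + 1)) => //; rewrite ltrDl.
have Ib := int_itv_cont (- (B + 1)) (B + 1) (_ : continuous (fun x : R => c * (1 + `|x|) ^+ m)).
have IK : mu.-integrable K (EFin \o f).
  apply: (@integrableS _ _ R mu `[- (B + 1), B + 1] K (EFin \o f)) => //.
  apply: int_le (Ib _) _ => //.
  - by apply: measurable_funS mf.
  - apply: cont_mul; first exact: cont_cst.
    by apply: cont_pow; apply: cont_add; [exact: cont_cst|exact: norm_cont].
by have /integrableP[] := IK.
Qed.

Lemma dotS'_heaviside f : continuous f -> pbd f -> dotS'_fun (heaviside R \* f).
Proof.
move=> cf pf; apply: dotS'_funP; last exact: heaviside_neg.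
  apply: measurable_funM; last exact: cont_meas.
  apply: measurable_indic; rewrite (_ : [set x | _] = Rp).
    exact: itv0y_meas.
  by apply/seteqP; split=> x /=; rewrite in_itv /= andbT.
apply: pbd_le pf _ => x; rewrite /= heavisideE normrM.
by case: (0 <= x); rewrite ?normr1 ?normr0 ?mul1r ?mul0r.
Qed.

Lemma Complex_sum (I : Type) (s : seq I) (a b : I -> R) :
  \sum_(i <- s) Complex (a i) (b i) = Complex (\sum_(i <- s) a i) (\sum_(i <- s) b i).
Proof. by elim: s => [|i s IH]; rewrite ?big_nil// !big_cons IH. Qed.

End ComplexLift.

(** * Unconditional summability *)

Section UnconditionalSum.
Context {R : realType}.
Notation S := (schwartz R).
Notation Re := (@complex.Re R).
Notation Im := (@complex.Im R).

(** Setting the terms with index in A to zero leaves a series whose first N terms vanish and whose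
    sum is the error, so the ordinary tail bound covers arbitrary finite sets of indices. *)
Lemma fset_series_tail (f M : nat -> R) (A : {fset nat}) N :
  (forall n, `|f n| <= M n) -> cvgn (series M) -> (forall i, (i < N)%N -> i \in A) ->
  `|limn (series f) - \sum_(i <- A) f i| <= limn (series M) - series M N.
Proof.
move=> fM cM NA; pose g (i : nat) : R := if i \in A then 0 else f i.
have gM n : `|g n| <= M n.
  by rewrite /g; case: ifP => // _; rewrite normr0 (le_trans _ (fM n)).
have := series_tail N gM cM.
have -> : series g N = 0.
  by rewrite /series /= big_nat big1// => i /andP[_ iN]; rewrite /g NA.
rewrite subr0 (_ : limn (series g) = limn (series f) - \sum_(i <- A) f i)//.
apply: cvg_lim => //.
have cf : series f @ \oo --> limn (series f) by apply: normed_cvg; exact: cvg_dominated cM.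
apply: (@cvg_trans _ ((series f K - \sum_(i <- A) f i) @[K --> \oo])); last first.
  by apply: cvgB => //; exact: cvg_cst.
apply: near_eq_cvg; exists (\max_(i <- A) i).+1 => // K /= AK.
rewrite /series /= (_ : \sum_(i <- A) f i = \sum_(0 <= i < K | i \in A) f i); last first.
  rewrite -[RHS]big_filter; apply: perm_big; apply: uniq_perm; rewrite ?fset_uniq//.
    by rewrite filter_uniq// iota_uniq.
  move=> i; rewrite mem_filter mem_index_iota /=; case iA : (i \in A) => //=.
  by rewrite (leq_ltn_trans _ AK)// (@leq_bigmax_seq _ _ xpredT id).
rewrite (bigID (fun i => i \in A)) /= addrAC subrr add0r [in LHS]big_mkcond /=.
by apply: eq_bigr => i _; rewrite /g; case: (i \in A).
Qed.

(** On a bounded set the finitely many seminorms involved have a common bound, so one convergent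
    majorant serves all its test functions and the tail estimate is uniform on the set. *)
Lemma clift_unconditional_sum (L : nat -> (R -> R) -> R) (M0 : nat -> R) N (C : R) :
  cvgn (series M0) ->
  (forall n psi M, rschwartz psi -> wbounded N psi M -> `|L n psi| <= C * M * M0 n) ->
  unconditional_sum (fun n => clift (L n)) (clift (fun psi => limn (series (L ^~ psi)))).
Proof.
move=> cM h; have TF := @summability.totally_filter nat.
apply/fam_cvgP => B hB; have [M hM] := choice (fun p : nat * nat => hB p.1 p.2).
pose MB : R := \sum_(a < N) \sum_(b < N) `|M (nat_of_ord a, nat_of_ord b)|.
have wB phi : B phi -> wbounded N (Re \o phi) MB /\ wbounded N (Im \o phi) MB.
  move=> Bphi; apply: wbounded_reim => a b aN bN; apply: (le_trans (hM (a, b) phi Bphi)).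
  apply: (le_trans (ler_norm _)).
  exact: (@ler_sum2 R (fun a b => `|M (a, b)|)).
have cMB : cvgn (series (fun n => C * MB * M0 n)).
  move: (C * MB) => c; rewrite (_ : series _ = (fun K => c * series M0 K)).
    by apply: is_cvgM => //; exact: is_cvg_cst.
  by apply/funext => K; rewrite /series /= mulr_sumr.
move=> P /uniform_nbhs[E [entE hE]].
move: entE; rewrite -entourage_ballE => -[[e e'] /= e0 eE].
(* The radius of a ball in R[i] is itself complex; being positive means that its imaginary part is
   zero and its real part is positive. *)
move: e0; rewrite ltcE /= => /andP[/eqP e'0 e0].
have e20 : 0 < e / 2 by rewrite divr_gt0.
have [K _ hK] := series_tail_small cMB e20.
exists [fset i in iota 0 K]%fset => // A /= KA; apply: hE => phi Bphi; apply: eE.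
rewrite /= /ball /= /ball_ /=.
have -> : summability.partial_sum (fun n => clift (L n)) A phi =
    Complex (\sum_(i <- A) L i (Re \o phi)) (\sum_(i <- A) L i (Im \o phi)).
  rewrite -Complex_sum /summability.partial_sum fct_sumE big_seq_fsetE /=.
  by [].
have iA i : (i < K)%N -> i \in A.
  by move=> iK; apply: (fsubsetP KA); rewrite !inE mem_iota.
have [w1 w2] := wB _ Bphi.
have t1 := fset_series_tail (fun n => h n _ _ (schwartz_re phi) w1) cMB iA.
have t2 := fset_series_tail (fun n => h n _ _ (schwartz_im phi) w2) cMB iA.
have tK := hK K (leqnn K).
rewrite normc_def ltcE /= e'0 eqxx /=; apply: (le_lt_trans (normc_le _ _)).
by move: t1 t2 tK => /=; lra.
Qed.

End UnconditionalSum.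

Theorem theorem1p1 (R : realType) (k : nat) :
  [/\ forall j : nat, ~~ odd j -> cvgn [normed series (@C_term R j)],
      [/\ dotS'_fun (@N3k R k),
          dotS'_fun (heaviside R \* leading_term k),
          forall m : nat, (m < k)%N -> dotS'_fun (heaviside R \* poly_term k m) &
          forall n : nat, dotS'_fun (heaviside R \* o_term k n.+1)] &
      exists o : schwartz R -> R[i]^o,
        [/\ dotS' o,
            unconditional_sum
              (fun n => distr (heaviside R \* o_term k n.+1)) o,
            distr (@N3k R k) =
              distr (heaviside R \* leading_term k)
              + \sum_(m < k) distr (heaviside R \* poly_term k m)
              + o &
            (2 <= k)%N ->
            [/\ forall s : R, 0 <= s ->
                  cvgn [normed series (fun n => o_term k n.+1 s)],
                forall s : R, 0 <= s ->
                  N3k k s = leading_term k s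
                            + \sum_(m < k) poly_term k m s + o_sum k s,
                dotS'_fun (heaviside R \* o_sum k) /\
                  o = distr (heaviside R \* o_sum k),
                {within [set s : R | 0 <= s], continuous (o_sum k)} /\
                  (~~ odd k -> o_sum k (0 : R) = 0) &
                forall K : set R, compact K -> K `<=` [set s | 0 <= s] ->
                  {uniform K, (fun N s =>
                     \sum_(0 <= n < N) o_term k n.+1 s) @ \oo --> o_sum k}]]].
Proof.
split=> [j _||]; first exact: C_term_cvg.
  split.
  - apply: dotS'_funP; [exact: N3k_meas|exact: N3k_pbd|exact: N3k_neg].
  - by apply: dotS'_heaviside; [exact: leading_cont|exact: leading_pbd].
  - by move=> m _; apply: dotS'_heaviside; [exact: poly_term_cont|exact: poly_term_pbd].
  - by move=> n; apply: dotS'_heaviside; [exact: o_term_cont|exact: o_term_pbd].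
(* The witness is the termwise pairing, which makes sense for every k; its identification with the
   function [o_sum k] is made only for k >= 2. *)
exists (clift (osum_test k)); split.
- by apply: clift_dotS'; exact: osum_test_rtempered.
- rewrite (_ : (fun n => _) = (fun n => clift (otest k n))); last first.
    by apply/funext => n; exact: distr_heaviside.
  have [N [C [_ h]]] := @otest_bound R k.
  exact: (clift_unconditional_sum (@r3inv_cvg R) h).
- rewrite distr_clift; last exact: N3k_neg.
  rewrite distr_heaviside (eq_bigr (fun m : 'I_k => clift (halfint (poly_term k m)))); last first.
    by move=> m _; exact: distr_heaviside.
  apply/funext => phi; rewrite fct_sumE /clift.
  rewrite !N3k_test; [|exact: schwartz_im|exact: schwartz_re].
  by rewrite -[RHS]/(_ + (\sum_(m < k) _) + _) Complex_sum.
move=> k2; split.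
- by move=> s _; exact: o_sum_abs.
- by move=> s s0; exact: N3k_expansion.
- split; first by apply: dotS'_heaviside; [exact: o_sum_cont|exact: o_sum_pbd].
  rewrite distr_heaviside; apply/funext => phi; rewrite /clift !osum_test_halfint//.
    exact: schwartz_im.
  exact: schwartz_re.
- by split; [apply: continuous_subspaceT; exact: o_sum_cont|exact: o_sum0].
move=> K cK _; have [B [_ hB]] := compact_bounded cK.
apply: (@weierstrass_unif R (fun n s => o_term k n.+1 s)
  (fun n => 2 * (B + 1 + k.+1%:R) * r3inv n)); last exact: r3invZ_cvg.
move=> n s Ks; apply: (le_trans (o_term_le n s k2)).
rewrite ler_wpM2r ?r3inv_ge0// ler_wpM2l// lerD2r.
by apply: (hB (B + 1)) => //; rewrite ltrDl.
Qed.
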